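(* Let $(X,\alpha)$ and $(Y,\beta)$ be Cantor minimal systems. The following are equivalent. (1) There is a unital order homomorphism $\rho$ from $K^0(Y,\beta)$ to $K^0(X,\alpha)$. (2) There exist a continuous map $F:X\to Y$ and a minimal homeomorphism $\gamma\in[\alpha]$ such that the integer valued cocycle $n:X\to\mathbb{Z}$ associated with $\gamma$ (defined by $\gamma(x)=\alpha^{n(x)}(x)$) has at most one point of discontinuity and $\beta F=F\gamma$. (3) There exists a continuous map $F:X\to Y$ such that $\{g\circ F:g\in B_\beta\}\subset B_\alpha$. (4) There exists a sequence of homeomorphisms $\sigma_n:X\to Y$ such that $\sigma_n\alpha\sigma_n^{-1}\to\beta$ in $\operatorname{Homeo}(Y)$ and $\lim_{n\to\infty}[f\circ\sigma_n]_\alpha$ exists in $K^0(X,\alpha)$ (with the discrete topology, i.e. the sequence is eventually constant) for every $f\in C(Y,\mathbb{Z})$.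
   Context: A Cantor minimal system $(X,\alpha)$ consists of a Cantor set $X$ and a homeomorphism $\alpha$ of $X$ with no nontrivial closed invariant subsets. $\operatorname{Homeo}(Y)$ carries the topology of uniform convergence: $\gamma_n\to\gamma$ iff $\sup_{y}d(\gamma_n(y),\gamma(y))\to0$ for a compatible metric $d$. $B_\alpha=\{f-f\circ\alpha^{-1}: f\in C(X,\mathbb{Z})\}$, $K^0(X,\alpha)=C(X,\mathbb{Z})/B_\alpha$ with class of $f$ written $[f]_\alpha$; it is an ordered group with positive cone the classes of nonnegative functions and order unit $[1_X]_\alpha$. A unital order homomorphism is a group homomorphism mapping the positive cone into the positive cone and the order unit to the order unit. The full group $[\alpha]$ is the group of homeomorphisms $\gamma$ of $X$ such that $\gamma(x)$ lies in the $\alpha$-orbit of $x$ for every $x\in X$. *)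

(* Defs.v *)
From mathcomp Require Import all_boot all_order all_algebra.
From mathcomp Require Import all_classical all_reals all_analysis.

Set Implicit Arguments.
Unset Strict Implicit.
Unset Printing Implicit Defensive.

Import Order.TTheory GRing.Theory Num.Theory.
Local Open Scope classical_set_scope.
Local Open Scope ring_scope.

(* A Cantor set: a nonempty (pointed) metric space which is perfect,
   compact, Hausdorff and zero-dimensional (library notion [cantor_like]). *)
Definition cantor_set {R : realType} (X : pseudoPMetricType R) : Prop :=
  cantor_like X.

Definition is_homeo {X Y : topologicalType} (h : X -> Y) (hi : Y -> X) : Prop :=
  [/\ continuous h, continuous hi, cancel h hi & cancel hi h].

Definition minimal_map {X : topologicalType} (a : X -> X) : Prop :=
  forall A : set X, closed A -> a @` A = A -> A = set0 \/ A = setT.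

Definition cantor_minimal {R : realType} (X : pseudoPMetricType R)
    (a ai : X -> X) : Prop :=
  [/\ cantor_set X, is_homeo a ai & minimal_map a].

Definition zpow {X : Type} (a ai : X -> X) (k : int) : X -> X :=
  match k with
  | Posz n => iter n a
  | Negz n => iter n.+1 ai
  end.

(* f : X -> Z is continuous at x (Z discrete): locally constant at x *)
Definition zcont_at {X : topologicalType} (f : X -> int) (x : X) : Prop :=
  \forall y \near x, f y = f x.

Definition CZ {X : topologicalType} (f : X -> int) : Prop :=
  forall x, zcont_at f x.

Definition Bset {X : topologicalType} (ai : X -> X) (g : X -> int) : Prop :=
  exists2 f : X -> int, CZ f & g = (fun x => f x - f (ai x)).

Definition K0eq {X : topologicalType} (ai : X -> X) (f g : X -> int) : Prop :=
  Bset ai (fun x => f x - g x).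

Definition K0pos {X : topologicalType} (ai : X -> X) (f : X -> int) : Prop :=
  exists2 h : X -> int, CZ h /\ (forall x, 0 <= h x) & K0eq ai f h.

(* A unital order homomorphism K^0(Y,b) -> K^0(X,a), presented through a
   map r on representatives C(Y,Z) -> C(X,Z) which is well defined on
   classes; rho([f]_b) := [r f]_a. *)
Definition unital_order_hom {X Y : topologicalType} (ai : X -> X) (bi : Y -> Y)
    (r : (Y -> int) -> (X -> int)) : Prop :=
  [/\ (forall f, CZ f -> CZ (r f)),
      (forall f g, CZ f -> CZ g -> K0eq bi f g -> K0eq ai (r f) (r g)),
      (forall f g, CZ f -> CZ g ->
         K0eq ai (r (fun y => f y + g y)) (fun x => r f x + r g x)),
      (forall f, CZ f -> K0pos bi f -> K0pos ai (r f)) &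
      K0eq ai (r (fun _ => 1)) (fun _ => 1)].

(* Main.v *)
(* Classes in K^0(X, alpha) are read off from sums over the segments between
   consecutive visits to a small clopen set V: a coboundary has zero segment
   sums once V is small enough, and conversely zero segment sums over any V
   make a coboundary. Hence a class rho [1_C] dominated by [1_A] is realized
   by a clopen subset of A (keep the first points of A in each segment), and
   two clopen sets of equal class are exchanged by a piecewise power of alpha
   (match their points in order within each segment).

   (1) => (4). Take a fine Kakutani-Rokhlin partition of Y with small base. The
   segment sums of rho [1_(B_i)] say how many towers of each height fit exactly
   into a segment of X; cutting the segments accordingly gives a partition of X
   on which alpha acts as beta does on Y, up to the small base.

   (1) => (2). Along a sequence of Kakutani-Rokhlin partitions of Y shrinking to
   y0, build matching partitions of X together with homeomorphisms c_k that are
   locally constant powers of alpha, where c_(k+1) = c_k outside the top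
   T_k = c_k^-1 (D_k). The bases D_k are made to shrink to x0 and the tops T_k to
   x1 = alpha^-1 (x0), so c_k converges to a homeomorphism gamma whose cocycle is
   discontinuous at most at x1. Every gamma-orbit accumulates at x0, and the
   orbit of x0 is forced through every clopen set, so gamma is minimal.

   (2) => (3). Subtracting a constant makes f o F vanish near the discontinuity,
   where it then does not matter. (3) => (1) is composition with F, and in
   (4) => (1) rho [f] is the limit of [f o sigma_n]. *)
Require Import Defs.
From mathcomp Require Import all_boot all_order all_algebra.
From mathcomp Require Import all_classical all_reals all_analysis.
From mathcomp Require Import zify ring lra.
Set Implicit Arguments.
Unset Strict Implicit.
Unset Printing Implicit Defensive.
Import Order.TTheory GRing.Theory Num.Theory.
Local Open Scope classical_set_scope.
Local Open Scope ring_scope.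

(** * Locally constant functions *)

(** Partitions are coded by locally constant labellings in [nat]. A partition of X matches one of Y
    when equal labels carry corresponding classes, so no map between the spaces is needed until the
    labels are fine enough to define one.

    The delicate implication is (1) => (2). Changing the map only on its top forces the old labels
    to survive, while the new base and the new top must fall in prescribed neighbourhoods. The
    labels along a tower are determined by those on its base, so every requirement, even the one on
    the top, becomes a requirement on base points: those below the new top must climb into a
    neighbourhood of x1. Three requirements (base, top, visit to a given clopen set) thus give three
    disjoint clopen targets in the base of X, and the sets of Y to be realized inside them need
    classes dominated by those of the targets. This is why the new base of Y is taken so small that
    many of its translates are disjoint: a large multiple of its class is then at most the unit, and
    unperforation gives the comparison. Aperiodicity and the absence of isolated points provide the
    room that keeps the targets disjoint. *)

Definition lc {X : topologicalType} {T : Type} (f : X -> T) : Prop :=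
  forall x, \forall y \near x, f y = f x.

Lemma near_forall_ltn {T : Type} (F : set_system T) (FF : Filter F)
    (P : nat -> T -> Prop) (m : nat) :
  (forall i, \forall y \near F, P i y) ->
  \forall y \near F, forall i, (i < m)%N -> P i y.
Proof.
move=> h; elim: m => [|m IH]; first by apply: nearW.
apply: filterS (filterI IH (h m)) => y [h1 h2] i.
by rewrite ltnS leq_eqVlt => /orP[/eqP->|/h1].
Qed.

Section LocallyConstant.
Context {X : topologicalType}.

Lemma lc_cst (T : Type) (c : T) : lc (fun _ : X => c).
Proof. by move=> x; apply: nearW. Qed.

Lemma lc_comp1 (T U : Type) (h : T -> U) (f : X -> T) :
  lc f -> lc (fun x => h (f x)).
Proof. by move=> lf x; apply: filterS (lf x) => y ->. Qed.

Lemma lc_comp2 (T1 T2 U : Type) (h : T1 -> T2 -> U) (f : X -> T1) (g : X -> T2) :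
  lc f -> lc g -> lc (fun x => h (f x) (g x)).
Proof.
by move=> lf lg x; apply: filterS (filterI (lf x) (lg x)) => y [-> ->].
Qed.

(** Covers iterates whose exponent itself depends on the point, such as the return to the base from
    a varying height. *)
Lemma lc_dep (K T : Type) (g : K -> X -> T) (n : X -> K) :
  (forall k, lc (g k)) -> lc n -> lc (fun x => g (n x) x).
Proof.
move=> lg ln x; apply: filterS (filterI (lg (n x) x) (ln x)) => y [h1 h2].
by rewrite h2 h1.
Qed.

Lemma lc_cont (Z : topologicalType) (T : Type) (c : Z -> X) (f : X -> T) :
  continuous c -> lc f -> lc (fun z => f (c z)).
Proof. by move=> cc lf z; apply: (cc z) (lf (c z)). Qed.

Lemma continuous_iter (a : X -> X) : continuous a ->
  forall j, continuous (iter j a).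
Proof.
move=> ca; elim=> [|j IH] x; first exact: cvg_id.
by apply: (@continuous_comp _ _ _ (iter j a) a); [exact: IH|exact: ca].
Qed.

Lemma lc_iter (T : Type) (a : X -> X) (f : X -> T) j : continuous a ->
  lc f -> lc (fun x => f (iter j a x)).
Proof. by move=> ca; apply: lc_cont; exact: continuous_iter. Qed.

Lemma lc_map (T U : Type) (g : U -> X -> T) (s : seq U) :
  (forall k, lc (g k)) -> lc (fun x => [seq g k x | k <- s]).
Proof.
move=> lg; elim: s => [|k s IH] /=; first exact: lc_cst.
by apply: (lc_comp2 cons).
Qed.

Lemma lc_all (U : Type) (g : U -> X -> bool) (s : seq U) :
  (forall k, lc (g k)) -> lc (fun x => all (g^~ x) s).
Proof.
move=> lg; elim: s => [|k s IH] /=; first exact: lc_cst.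
by apply: (lc_comp2 andb).
Qed.

Lemma lc_sum (T : nmodType) (g : nat -> X -> T) n :
  (forall k, lc (g k)) -> lc (fun x => \sum_(k < n) g k x).
Proof.
move=> lg; elim: n => [|n IH].
  by move=> x; apply: nearW => y; rewrite !big_ord0.
move=> x; apply: filterS (filterI (IH x) (lg n x)) => y [h1 h2].
by rewrite !big_ord_recr /= h1 h2.
Qed.

Lemma lc_set (f : X -> bool) : lc f -> open [set x | f x].
Proof.
move=> lf; rewrite openE => x /= fx; apply: filterS (lf x) => y /=.
by rewrite fx => ->.
Qed.

Lemma lc_open (T : Type) (f : X -> T) (P : T -> Prop) : lc f -> open [set x | P (f x)].
Proof.
by move=> lf; rewrite openE => x /= fx; apply: filterS (lf x) => y /= ->.
Qed.

Lemma lc_closed (T : Type) (f : X -> T) (P : T -> Prop) : lc f -> closed [set x | P (f x)].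
Proof.
move=> lf; rewrite -openC; exact: (lc_open (fun t => ~ P t) lf).
Qed.

End LocallyConstant.

(** * First hitting times *)

(** A total function, so that hitting times can be defined before recurrence is known; the default 0
    is taken only when there is no hit. *)
Definition first (P : nat -> bool) : nat :=
  match pselect (exists j, P j) with
  | left e => ex_minn e
  | right _ => 0%N
  end.

Lemma firstP (P : nat -> bool) : (exists j, P j) ->
  P (first P) /\ forall i, (i < first P)%N -> ~~ P i.
Proof.
rewrite /first; case: pselect => // e _; case: ex_minnP => m Pm hm; split=> //.
by move=> i im; apply/negP => /hm; rewrite leqNgt im.
Qed.

Lemma first_unique (P : nat -> bool) m : P m ->
  (forall i, (i < m)%N -> ~~ P i) -> first P = m.
Proof.
move=> Pm hm; have [h1 h2] := firstP (ex_intro _ m Pm).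
case: (ltngtP (first P) m) => // [/hm|/h2]; first by rewrite h1.
by rewrite Pm.
Qed.

Lemma lc_first (X : topologicalType) (P : nat -> X -> bool) :
  (forall j, lc (P j)) -> (forall x, exists j, P j x) ->
  lc (fun x => first (P^~ x)).
Proof.
move=> lP eP x; have [h1 h2] := firstP (eP x).
set m := first _ in h1 h2 *.
apply: filterS (near_forall_ltn _ m.+1 (fun i => lP i x)) => y hy; apply: first_unique; first by rewrite hy.
by move=> i im; rewrite hy ?h2 // ltnW.
Qed.

(** * Kakutani-Rokhlin segments *)

(** The past visit may be the present one, the future visit is strictly later: points of [V] open
    segments, and each segment stops just before the next visit. *)
Record recurrent {X : Type} (a ai : X -> X) (V : X -> bool) : Prop := {
  rec_can : cancel a ai;
  rec_canV : cancel ai a;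
  rec_past : forall x, exists j, V (iter j ai x);
  rec_future : forall x, exists j, V (iter j.+1 a x)
}.

Lemma iterK {X : Type} (a ai : X -> X) j :
  cancel a ai -> cancel (iter j a) (iter j ai).
Proof.
move=> aK x; elim: j x => [|j IH] x //.
by rewrite iterSr [iter _ a _]/= aK IH.
Qed.

Section Segments.
Context {X : Type}.
Variables (a ai : X -> X) (V : X -> bool).
Hypothesis rV : recurrent a ai V.

Let aK : cancel a ai := rec_can rV.
Let aiK : cancel ai a := rec_canV rV.
Let recb : forall x, exists j, V (iter j ai x) := rec_past rV.
Let recf : forall x, exists j, V (iter j.+1 a x) := rec_future rV.

(* [pos x] is the time elapsed since the last visit to [V], and [ht x] the
   length of the segment of [x]. *)
Definition pos (x : X) : nat := first (fun j => V (iter j ai x)).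
Definition base (x : X) : X := iter (pos x) ai x.
Definition ht (x : X) : nat := (first (fun j => V (iter j.+1 a (base x)))).+1.

Lemma V_base x : V (base x).
Proof. exact: (firstP (recb x)).1. Qed.

Lemma iter_base x : iter (pos x) a (base x) = x.
Proof. by rewrite /base iterK. Qed.

Lemma pos_unique x m : V (iter m ai x) ->
  (forall i, (i < m)%N -> ~~ V (iter i ai x)) -> pos x = m.
Proof. exact: first_unique. Qed.

Lemma pos_V x : V x -> pos x = 0%N.
Proof. by move=> Vx; apply: pos_unique. Qed.

Lemma pos0V x : pos x = 0%N -> V x.
Proof. by move=> p0; have := V_base x; rewrite /base p0. Qed.

Lemma base_V x : V x -> base x = x.
Proof. by move=> Vx; rewrite /base pos_V. Qed.

Lemma pos_step x : ~~ V (a x) -> pos (a x) = (pos x).+1.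
Proof.
move=> nV; have [h1 h2] := firstP (recb x); apply: pos_unique.
  by rewrite iterSr aK.
by case=> [|i] // im; rewrite iterSr aK h2.
Qed.

Lemma base_step x : ~~ V (a x) -> base (a x) = base x.
Proof. by move=> nV; rewrite /base pos_step // iterSr aK. Qed.

Lemma htP x : V (iter (ht x) a (base x)) /\
  forall i, (0 < i < ht x)%N -> ~~ V (iter i a (base x)).
Proof.
have [h1 h2] := firstP (recf (base x)); split=> // -[|i] //= im.
exact: (h2 i).
Qed.

Lemma ht_gt0 x : (0 < ht x)%N. Proof. by []. Qed.

Lemma base_iter x j : (j < ht x)%N ->
  pos (iter j a (base x)) = j /\ base (iter j a (base x)) = base x.
Proof.
have [_ h2] := htP x.
elim: j => [|j IH] jh /=; first by split; [exact/pos_V/V_base|exact/base_V/V_base].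
have [p b] := IH (ltnW jh).
by have nV := h2 j.+1 jh; rewrite pos_step // base_step // p b.
Qed.

Lemma ht_base x : ht (base x) = ht x.
Proof. by rewrite /ht (base_V (V_base x)). Qed.

Lemma ht_eq x y : base x = base y -> ht x = ht y.
Proof. by rewrite /ht => ->. Qed.

Lemma pos_lt_ht x : (pos x < ht x)%N.
Proof.
rewrite ltnNge; apply/negP => le.
have [h1 _] := htP x; have [_ h2] := firstP (recb x).
have := h2 (pos x - ht x)%N; rewrite -/(pos x) => h3.
move: h1; rewrite -[X in iter _ a X]/(iter (pos x) ai x).
rewrite -{1}(subnKC le) iterD iterK //; apply/negP/h3.
have := ht_gt0 x; lia.
Qed.

Lemma V_next x : V (a x) = ((pos x).+1 == ht x).
Proof.
have [h1 h2] := htP x; apply/idP/eqP => [Vax|e].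
  apply/eqP; rewrite eqn_leq pos_lt_ht /= leqNgt; apply/negP => lt.
  by have := h2 _ (introT andP (conj (ltn0Sn _) lt)); rewrite /= iter_base Vax.
by move: h1; rewrite -e /= iter_base.
Qed.

Lemma pos_a x : pos (a x) = if V (a x) then 0%N else (pos x).+1.
Proof. by case: ifP => [/pos_V|/negbT/pos_step]. Qed.

Lemma pos_ai x : ~~ V x -> pos x = (pos (ai x)).+1.
Proof. by move=> nV; rewrite -{1}(aiK x) pos_step // aiK. Qed.

Lemma base_ai x : ~~ V x -> base (ai x) = base x.
Proof. by move=> nV; rewrite -{2}(aiK x) base_step // aiK. Qed.

Lemma pos_iter v j : V v -> (forall i, (i < j)%N -> ~~ V (iter i.+1 a v)) ->
  pos (iter j a v) = j /\ base (iter j a v) = v.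
Proof.
move=> Vv; elim: j => [|j IH] h; first by split; [exact: pos_V|exact: base_V].
have [p b] := IH (fun i ij => h i (ltnW ij)).
by have nV := h j (ltnSn j); rewrite /= pos_step // base_step // p b.
Qed.

Section Sums.
Variable T : nmodType.
Implicit Types f : X -> T.

Definition sbelow f x : T := \sum_(j < pos x) f (iter j a (base x)).
Definition stot f x : T := \sum_(j < ht x) f (iter j a (base x)).

Lemma sbelow_a f x : ~~ V (a x) -> sbelow f (a x) = sbelow f x + f x.
Proof.
move=> nV; rewrite /sbelow pos_step // base_step // big_ord_recr /=.
by rewrite iter_base.
Qed.

Lemma sbelow_V f x : V x -> sbelow f x = 0.
Proof. by move=> Vx; rewrite /sbelow pos_V // big_ord0. Qed.

Lemma stot_a f x : V (a x) -> stot f x = sbelow f x + f x.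
Proof.
rewrite V_next /stot /sbelow => /eqP <-; rewrite big_ord_recr /=.
by rewrite iter_base.
Qed.

Lemma stot_base f x y : base x = base y -> stot f x = stot f y.
Proof. by move=> e; rewrite /stot (ht_eq e) e. Qed.

Lemma stot0 x : stot (fun _ => 0) x = 0.
Proof. by rewrite /stot big1. Qed.

Lemma eq_stot f g x : f =1 g -> stot f x = stot g x.
Proof. by move=> e; apply: eq_bigr => j _. Qed.

Lemma stot_sum n (F : nat -> X -> T) x :
  stot (fun y => \sum_(i < n) F i y) x = \sum_(i < n) stot (F i) x.
Proof. by rewrite /stot exchange_big. Qed.

End Sums.

Lemma stotB (f g : X -> int) x : stot (fun y => f y - g y) x = stot f x - stot g x.
Proof. by rewrite /stot sumrB. Qed.

Lemma stotZ (k : int) (f : X -> int) x : stot (fun y => k * f y) x = k * stot f x.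
Proof. by rewrite /stot mulr_sumr. Qed.

Lemma stot_ge0 (f : X -> int) x : (forall y, 0 <= f y) -> 0 <= stot f x.
Proof. by move=> h; apply: sumr_ge0. Qed.

(** The sum telescopes to the difference of [g \o ai] at two consecutive visits to [V], where this
    function has the same value [k]. *)
Lemma stot_cobound (g : X -> int) (k : int) x :
  (forall y, V y -> g (ai y) = k) -> stot (fun y => g y - g (ai y)) x = 0.
Proof.
move=> gV; rewrite /stot.
transitivity (\sum_(j < ht x)
   (g (ai (iter j.+1 a (base x))) - g (ai (iter j a (base x))))).
  by apply: eq_bigr => j _ /=; rewrite aK.
rewrite -(big_mkord xpredT (fun j => g (ai (iter j.+1 a (base x)))
  - g (ai (iter j a (base x))))).
rewrite telescope_sumr // !gV ?subrr ?V_base //.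
exact: (htP x).1.
Qed.

(** The transfer function is the partial sum along the segment, [x] included. It jumps correctly at
    the start of a segment because the previous segment ends with its total, which is 0. *)
Lemma cobound_stot (f : X -> int) : (forall x, stot f x = 0) ->
  f = (fun x => (sbelow f x + f x) - (sbelow f (ai x) + f (ai x))).
Proof.
move=> f0; apply/funext => x.
have [Vx|nVx] := boolP (V x).
  by rewrite sbelow_V // -stot_a ?aiK // f0 add0r subr0.
have -> : sbelow f x = sbelow f (ai x) + f (ai x).
  by rewrite -{1}(aiK x) sbelow_a // aiK.
by rewrite addrAC subrr add0r.
Qed.

End Segments.

Section SegmentsLc.
Context {X : topologicalType}.
Variables (a ai : X -> X) (V : X -> bool).
Hypotheses (ha : is_homeo a ai) (lV : lc V) (rV : recurrent a ai V).

Let ca : continuous a. Proof. by case: ha. Qed.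
Let cai : continuous ai. Proof. by case: ha. Qed.

Lemma lc_pos : lc (pos ai V).
Proof. by apply: lc_first => [j|]; [exact: lc_iter|exact: (rec_past rV)]. Qed.

Lemma lc_at_base (T : Type) (f : X -> T) : lc f -> lc (fun x => f (base ai V x)).
Proof.
move=> lf; apply: (@lc_dep _ _ _ (fun k x => f (iter k ai x)) (pos ai V)).
  by move=> k; apply: lc_iter.
exact: lc_pos.
Qed.

Lemma lc_ht : lc (ht a ai V).
Proof.
have := @lc_at_base _ (fun x => (first (fun j => V (iter j.+1 a x))).+1); apply.
apply: lc_comp1; apply: (@lc_first _ (fun j x => V (iter j.+1 a x))) => [j|].
  exact: lc_iter.
exact: (rec_future rV).
Qed.

Lemma lc_sbelow (T : nmodType) (f : X -> T) : lc f -> lc (sbelow a ai V f).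
Proof.
move=> lf.
apply: (@lc_dep _ _ _ (fun k x => \sum_(j < k) f (iter j a (base ai V x))) (pos ai V)).
  move=> k; apply: (@lc_sum _ _ (fun j x => f (iter j a (base ai V x)))) => j.
  by apply: (@lc_at_base _ (fun x => f (iter j a x))); exact: lc_iter.
exact: lc_pos.
Qed.

Lemma lc_stot (T : nmodType) (f : X -> T) : lc f -> lc (stot a ai V f).
Proof.
move=> lf.
apply: (@lc_dep _ _ _ (fun k x => \sum_(j < k) f (iter j a (base ai V x))) (ht a ai V)).
  move=> k; apply: (@lc_sum _ _ (fun j x => f (iter j a (base ai V x)))) => j.
  by apply: (@lc_at_base _ (fun x => f (iter j a x))); exact: lc_iter.
exact: lc_ht.
Qed.

End SegmentsLc.

(** * Cantor sets with binary coordinates *)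

(** Compactness and injectivity make the cylinders of these coordinates a base of the topology. Once
    coordinates are chosen, the metric matters only for the convergence in (4). *)
Record coord_space (X : topologicalType) (phi : X -> nat -> bool) : Prop := {
  coord_compact : compact [set: X];
  coord_inj : injective phi;
  coord_lc : forall i, lc (fun x => phi x i);
  coord_perfect : forall (D : X -> bool) x, lc D -> D x -> exists2 y, D y & y != x
}.

Lemma cantor_coord (R : realType) (X : pseudoPMetricType R) :
  cantor_like X -> exists phi : X -> nat -> bool, coord_space phi.
Proof.
move=> cX; have [f [cf clf]] := homeomorphism_cantor_like cX.
case: cX => [[_ pX] kX hX zX].
pose fi : X -> cantor_space := (f^-1)%FUN.
have fK : cancel fi f by move=> x; rewrite /fi invK ?inE.
have fiK : cancel f fi by move=> x; rewrite /fi funK ?inE.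
exists fi; split => //.
- move=> i x.
  (* Continuity of the inverse comes from closedness of [f]: the complement of a level set of a
     coordinate is the image of a closed set. *)
  pose B := [set x' : X | fi x' i = fi x i].
  have oB : open B.
    rewrite -closedC.
    have -> : ~` B = f @` [set z | z i <> fi x i].
      apply/seteqP; split => y /=.
        by move=> h; exists (fi y); rewrite ?fK.
      by case=> z h <-; rewrite /B /= fiK.
    apply: clf.
    have ci : continuous ((fun z => z i) : cantor_space -> bool).
      exact: (@proj_continuous nat (fun=> bool) i).
    have pc := (@continuousP cantor_space bool _).1 ci.
    rewrite -openC.
    have := pc [set fi x i] (discrete_open _).
    congr open; apply/seteqP; split => z /=; first by move=> ->; apply.
    by move/contrapT.
  by apply: (@open_nbhs_nbhs _ x B); split.
- move=> D x lD Dx.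
  have : limit_point [set: X] x by rewrite pX.
  case/(_ [set y | D y]); first by apply: open_nbhs_nbhs; split => //; exact: lc_set.
  by move=> y [yx _ Dy]; exists y.
Qed.

Section Coord.
Context {X : topologicalType}.
Variable phi : X -> nat -> bool.
Hypothesis cX : coord_space phi.

(** All later compactness arguments go through this exchange of an eventual bound with a quantifier
    over points. *)
Lemma compact_near_all (I : Type) (F : set_system I) (P : I -> X -> Prop) :
  Filter F -> (forall x : X, \forall x' \near x & i \near F, P i x') ->
  \forall i \near F, forall x, P i x.
Proof.
move=> FF h; have := coord_compact cX => /compact_near_coveringP.
move=> /(_ _ F P FF (fun x _ => h x)).
by apply: filterS => i hi x; apply: hi.
Qed.

Lemma lc_bounded (f : X -> nat) : lc f -> exists N, forall x, (f x < N)%N.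
Proof.
move=> lf; suff /(@filter_ex _ _ _) [N hN] : \forall N \near \oo, forall x, (f x < N)%N.
  by exists N.
apply: compact_near_all => x.
exists ([set x' | f x' = f x], [set N | (f x < N)%N]); first by split; [exact: lf|exists (f x).+1].
by move=> [x' N] /= [-> ].
Qed.

Definition cyl (p : X) (k : nat) (x : X) : bool :=
  all (fun i => phi x i == phi p i) (iota 0 k).

Lemma cylP p k x : reflect (forall i, (i < k)%N -> phi x i = phi p i) (cyl p k x).
Proof.
apply: (iffP allP) => [h i ik|h i]; first by apply/eqP/h; rewrite mem_iota.
by rewrite mem_iota => ik; apply/eqP/h.
Qed.

Lemma cyl_refl p k : cyl p k p.
Proof. exact/cylP. Qed.

Lemma lc_cyl p k : lc (cyl p k).
Proof.
apply: (@lc_all _ _ (fun i x => phi x i == phi p i)) => i.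
by apply: (lc_comp1 (fun b => b == phi p i)); exact: coord_lc.
Qed.

Lemma cyl_leq p k k' x : (k <= k')%N -> cyl p k' x -> cyl p k x.
Proof. by move=> kk /cylP h; apply/cylP => i ik; apply: h; exact: leq_trans kk. Qed.

Lemma cyl_near p (P : X -> Prop) : (\forall x \near p, P x) ->
  \forall k \near \oo, forall x, cyl p k x -> P x.
Proof.
move=> nP; apply: compact_near_all => x.
have [->|/eqP xp] := eqVneq x p.
  by exists (P, setT); [split=> //; exact: filterT|move=> [x' k] /= []].
have [i hi] : exists i, phi x i <> phi p i.
  by apply/existsNP => h; apply: xp; apply: (coord_inj cX); apply/funext.
exists ([set x' | phi x' i = phi x i], [set k | (i < k)%N]).
  by split; [exact: coord_lc|exists i.+1].
by move=> [x' k] /= [h ik] /cylP /(_ i ik); rewrite h.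
Qed.

Lemma cyl_lc p (T : Type) (f : X -> T) : lc f ->
  \forall k \near \oo, forall x, cyl p k x -> f x = f p.
Proof. by move=> lf; apply: cyl_near. Qed.

Lemma cyl_sep p x : x != p -> \forall k \near \oo, ~~ cyl p k x.
Proof.
move=> /eqP xp; have [i hi] : exists i, phi x i <> phi p i.
  by apply/existsNP => h; apply: xp; apply: (coord_inj cX); apply/funext.
by exists i.+1 => // k /= ik; apply/negP => /cylP /(_ i ik).
Qed.

Lemma avoid_seq (s : seq X) (D : X -> bool) x : lc D -> D x ->
  exists2 y, D y & y \notin s.
Proof.
elim: s D x => [|z s IH] D x lD Dx; first by exists x.
have [y Dy ys] := IH D x lD Dx.
have [yz|yz] := eqVneq y z; last by exists y => //; rewrite inE negb_or yz.
have [y' Dy' y'y] := coord_perfect cX lD Dy.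
(* When the point found is the excluded [z] itself, search again in [D] outside a cylinder around
   it; [y'] shows that this part is not empty. *)
have [k hk] := filter_ex (cyl_sep (p := y) y'y).
have [||w /andP[Dw nw] ws] := IH (fun w => D w && ~~ cyl y k w) y'.
- apply: (lc_comp2 (fun b c => b && ~~ c)) => //; exact: lc_cyl.
- by rewrite Dy'.
exists w => //; rewrite inE negb_or ws andbT -yz; apply/eqP => wy.
by rewrite wy cyl_refl in nw.
Qed.

(** * Recurrence and aperiodicity of minimal homeomorphisms *)

Variables (a ai : X -> X).
Hypotheses (ha : is_homeo a ai) (ma : minimal_map a).

Let ca : continuous a. Proof. by case: ha. Qed.
Let cai : continuous ai. Proof. by case: ha. Qed.
Let aK : cancel a ai. Proof. by case: ha. Qed.
Let aiK : cancel ai a. Proof. by case: ha. Qed.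

(** The points whose two-sided orbit misses [V] form a closed invariant set without [p], hence the
    empty set; compactness then makes the visiting time uniform. *)
Lemma minimal_visits (V : X -> bool) p : lc V -> V p ->
  exists N, forall x, exists2 j, (j < N)%N & V (iter j a x) || V (iter j ai x).
Proof.
move=> lV Vp.
pose Z := [set x | forall j, ~~ V (iter j a x) /\ ~~ V (iter j ai x)].
have cZ : closed Z.
  have -> : Z = \bigcap_j [set x | ~~ V (iter j a x) && ~~ V (iter j ai x)].
    apply/seteqP; split => x /= h j; first by move=> _; apply/andP.
    by have /andP := h j I.
  apply: closed_bigI => j _.
  apply: (@lc_closed _ _ (fun x => ~~ V (iter j a x) && ~~ V (iter j ai x)) is_true).
  apply: (lc_comp2 (fun b c => ~~ b && ~~ c)); exact: lc_iter.
have aZ : a @` Z = Z.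
  apply/seteqP; split => [_ [x Zx <-] j|x Zx].
    rewrite -iterSr; split; first exact: (Zx j.+1).1.
    by case: j => [|j]; [exact: (Zx 1%N).1|rewrite iterSr aK; exact: (Zx j).2].
  exists (ai x) => // j; rewrite -iterSr; split; last exact: (Zx j.+1).2.
  by case: j => [|j]; [exact: (Zx 1%N).2|rewrite iterSr aiK; exact: (Zx j).1].
have Z0 : forall x, ~ Z x.
  have [->|ZT] := ma cZ aZ; first by move=> x.
  have : Z p by rewrite ZT.
  by case/(_ 0%N) => /=; rewrite Vp.
suff /(@filter_ex _ _ _) [N hN] : \forall N \near \oo,
  forall x, exists2 j, (j < N)%N & V (iter j a x) || V (iter j ai x) by exists N.
apply: compact_near_all => x.
have [j hj] : exists j, V (iter j a x) || V (iter j ai x).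
  apply: contrapT => h; apply: (Z0 x) => j; apply/andP; rewrite -negb_or.
  by apply/negP => h'; apply: h; exists j.
have l : lc (fun x => V (iter j a x) || V (iter j ai x)).
  by apply: (lc_comp2 orb); exact: lc_iter.
exists ([set x' | V (iter j a x') || V (iter j ai x') = (V (iter j a x) || V (iter j ai x))],
        [set N | (j < N)%N]); first by split; [exact: l|exists j.+1].
by move=> [x' N] /= [h jN]; exists j; rewrite ?h.
Qed.

Lemma rec_fwd (V : X -> bool) p : lc V -> V p ->
  exists N, forall x, exists2 j, (j < N)%N & V (iter j.+1 a x).
Proof.
(* The two-sided bound is applied at [iter N a x]: a visit less than [N] steps away in either
   direction is still in the strict future of [x], at a time below [N + N]. *)
move=> lV Vp; have [N hN] := minimal_visits lV Vp; exists (N + N)%N => x.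
have [j jN /orP[h|h]] := hN (iter N a x).
  exists (j + N).-1; first lia.
  by rewrite prednK ?iterD; last lia.
exists (N - j).-1; first lia.
rewrite prednK; last lia.
by move: h; rewrite -{1}(subnKC (ltnW jN)) iterD iterK.
Qed.

Lemma rec_bwd (V : X -> bool) p : lc V -> V p -> forall x, exists j, V (iter j ai x).
Proof.
move=> lV Vp x; have [N hN] := minimal_visits lV Vp.
have [j jN /orP[h|h]] := hN (iter N ai x).
  exists (N - j)%N; move: h.
  by rewrite -{1}(subnKC (ltnW jN)) iterD iterK.
by exists (j + N)%N; rewrite iterD.
Qed.

Lemma minimal_recurrent (V : X -> bool) p : lc V -> V p -> recurrent a ai V.
Proof.
move=> lV Vp; split=> // x; first exact: (rec_bwd lV Vp).
by have [N /(_ x) [j _ hj]] := rec_fwd lV Vp; exists j.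
Qed.

Lemma recurrent_cyl p k : recurrent a ai (cyl p k).
Proof. by apply: (@minimal_recurrent _ p); [exact: lc_cyl|exact: cyl_refl]. Qed.

(** A periodic orbit is finite. As there are no isolated points, some cylinder avoids it, which
    contradicts forward recurrence. *)
Lemma aperiodic j x : iter j.+1 a x != x.
Proof.
apply/eqP => e.
pose s := [seq iter i a x | i <- iota 0 j.+1].
have hs : forall i, iter i a x \in s.
  elim=> [|i IH]; first by apply/mapP; exists 0%N.
  rewrite iterS; case/mapP: IH => i' + ->.
  rewrite mem_iota /= add0n ltnS leq_eqVlt => /orP[/eqP ->|ij].
    by rewrite -[a _]/(iter j.+1 a x) e; apply/mapP; exists 0%N.
  by apply/mapP; exists i'.+1 => //; rewrite mem_iota.
have [y _ ys] := @avoid_seq s xpredT x (lc_cst _) isT.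
have [k hk] : exists k, forall z, z \in s -> ~~ cyl y k z.
  suff /(@filter_ex _ _ _) [k hk] : \forall k \near \oo, forall z, z \in s -> ~~ cyl y k z.
    by exists k.
  elim: s ys {hs} => [|z s IH]; first by move=> _; apply: nearW.
  rewrite inE negb_or => /andP[yz /IH h].
  have zy : z != y by rewrite eq_sym.
  apply: filterS (filterI h (cyl_sep zy)) => k [h1 h2] w.
  by rewrite inE => /orP[/eqP->|/h1].
have [N hN] := rec_fwd (lc_cyl y k) (cyl_refl y k).
by have [i _] := hN x; apply/negP/hk/hs.
Qed.

(** The point [p] differs from each of its first [N] images, and continuity spreads each of these
    finitely many separations to a cylinder. *)
Lemma cyl_disjoint p N : \forall k \near \oo, forall x, cyl p k x ->
  forall j, (j < N)%N -> ~~ cyl p k (iter j.+1 a x).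
Proof.
have h : forall j, \forall k \near \oo, forall x, cyl p k x -> ~~ cyl p k (iter j.+1 a x).
  move=> j; have [m hm] := filter_ex (cyl_sep (aperiodic j p)).
  have l : lc (fun x => cyl p m (iter j.+1 a x)) by apply: lc_iter => //; exact: lc_cyl.
  have mk : \forall k \near \oo, (m <= k)%N by exists m.
  apply: filterS (filterI mk (cyl_lc p l)) => k [{}mk hk] x /hk e.
  by apply/negP => /(cyl_leq mk); rewrite e; apply/negP.
apply: filterS (near_forall_ltn _ N h) => k hk x cx j jN.
exact: hk.
Qed.

(** * The dimension group through segment sums *)

Lemma Bset0 : Bset ai (fun _ => 0).
Proof. by exists (fun _ => 0); [exact: lc_cst|apply/funext => x; rewrite subr0]. Qed.

Lemma BsetD f g : Bset ai f -> Bset ai g -> Bset ai (fun x => f x + g x).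
Proof.
move=> [u cu ->] [v cv ->]; exists (fun x => u x + v x).
  exact: (lc_comp2 (fun x y => x + y)).
by apply/funext => x; ring.
Qed.

Lemma BsetZ (k : int) f : Bset ai f -> Bset ai (fun x => k * f x).
Proof.
move=> [u cu ->]; exists (fun x => k * u x); first exact: (lc_comp1 (fun x => k * x)).
by apply/funext => x; ring.
Qed.

Lemma eq_Bset f g : f =1 g -> Bset ai f -> Bset ai g.
Proof. by move=> /funext ->. Qed.

Lemma K0_eq f g : f =1 g -> K0eq ai f g.
Proof. by move=> /funext ->; apply: eq_Bset Bset0 => x; rewrite subrr. Qed.

Lemma K0_refl f : K0eq ai f f.
Proof. exact: K0_eq. Qed.

Lemma K0_sym f g : K0eq ai f g -> K0eq ai g f.
Proof. by move=> /(BsetZ (-1)); apply: eq_Bset => x; ring. Qed.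

Lemma K0_trans g f h : K0eq ai f g -> K0eq ai g h -> K0eq ai f h.
Proof. by move=> h1 h2; apply: eq_Bset (BsetD h1 h2) => x; ring. Qed.

Lemma K0D f g f' g' : K0eq ai f f' -> K0eq ai g g' ->
  K0eq ai (fun x => f x + g x) (fun x => f' x + g' x).
Proof. by move=> h1 h2; apply: eq_Bset (BsetD h1 h2) => x; ring. Qed.

Lemma K0Z (k : int) f g : K0eq ai f g -> K0eq ai (fun x => k * f x) (fun x => k * g x).
Proof. by move=> /(BsetZ k); apply: eq_Bset => x; ring. Qed.

Lemma K0B f g f' g' : K0eq ai f f' -> K0eq ai g g' ->
  K0eq ai (fun x => f x - g x) (fun x => f' x - g' x).
Proof. by move=> h1 /(BsetZ (-1)) h2; apply: eq_Bset (BsetD h1 h2) => x; ring. Qed.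

Lemma K0_sum n (F G : nat -> X -> int) : (forall i, (i < n)%N -> K0eq ai (F i) (G i)) ->
  K0eq ai (fun x => \sum_(i < n) F i x) (fun x => \sum_(i < n) G i x).
Proof.
elim: n => [|n IH] h; first by apply: K0_eq => x; rewrite !big_ord0.
have := K0D (IH (fun i ni => h i (ltnW ni))) (h n (ltnSn n)).
by rewrite /K0eq; apply: eq_Bset => x; rewrite !big_ord_recr.
Qed.

Lemma K0_shift f : lc f -> K0eq ai f (fun x => f (ai x)).
Proof. by move=> lf; exists f. Qed.

Lemma K0_shift_iter j f : lc f -> K0eq ai f (fun x => f (iter j ai x)).
Proof.
move=> lf; elim: j => [|j IH]; first exact: K0_refl.
apply: K0_trans IH _.
have -> : (fun x => f (iter j.+1 ai x)) = (fun x => f (iter j ai (ai x))).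
  by apply/funext => x; rewrite iterSr.
by apply: (@K0_shift (fun x => f (iter j ai x))); exact: lc_iter.
Qed.

Lemma K0_shift_iterV j f : lc f -> K0eq ai f (fun x => f (iter j a x)).
Proof.
move=> lf; have := @K0_shift_iter j (fun x => f (iter j a x)) (lc_iter j ca lf).
move=> /K0_sym; congr K0eq.
by apply/funext => x; rewrite iterK.
Qed.

Lemma K0pos_lc f : lc f -> (forall x, 0 <= f x) -> K0pos ai f.
Proof. by move=> lf f0; exists f => //; exact: K0_refl. Qed.

Lemma K0pos_eq f g : K0eq ai f g -> K0pos ai f -> K0pos ai g.
Proof.
by move=> fg [h hh fh]; exists h => //; exact: K0_trans (K0_sym fg) fh.
Qed.

Lemma K0posD f g : K0pos ai f -> K0pos ai g -> K0pos ai (fun x => f x + g x).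
Proof.
move=> [u [lu u0] fu] [v [lv v0] gv]; exists (fun x => u x + v x); last exact: K0D.
by split=> [|x]; [exact: (lc_comp2 (fun x y => x + y))|rewrite addr_ge0].
Qed.

Lemma stot_Bset f p : Bset ai f ->
  \forall k \near \oo, forall x, stot a ai (cyl p k) f x = 0.
Proof.
move=> [g lg ->].
have l : lc (fun x => g (ai x)) by apply: lc_cont.
apply: filterS (cyl_lc p l) => k hk x.
exact: (stot_cobound (recurrent_cyl p k) (k := g (ai p))).
Qed.

Lemma stot_K0eq f g p : K0eq ai f g ->
  \forall k \near \oo, forall x, stot a ai (cyl p k) f x = stot a ai (cyl p k) g x.
Proof.
move=> /(stot_Bset p); apply: filterS => k hk x.
by apply/eqP; rewrite -subr_eq0 -stotB hk.
Qed.

Lemma stot_K0pos f p : K0pos ai f ->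
  \forall k \near \oo, forall x, 0 <= stot a ai (cyl p k) f x.
Proof.
move=> [h [lh h0] /(stot_K0eq p)]; apply: filterS => k hk x.
by rewrite hk stot_ge0.
Qed.

Section OnV.
Variables (V : X -> bool) (p : X).
Hypotheses (lV : lc V) (Vp : V p).

Let rV : recurrent a ai V. Proof. exact: minimal_recurrent lV Vp. Qed.

Lemma Bset_stot f : lc f -> (forall x, stot a ai V f x = 0) -> Bset ai f.
Proof.
move=> lf f0.
exists (fun x => sbelow a ai V f x + f x).
  apply: (lc_comp2 (fun x y => x + y)) => //.
  exact: (lc_sbelow ha lV rV).
exact: (cobound_stot rV f0).
Qed.

Lemma K0eq_stot f g : lc f -> lc g ->
  (forall x, stot a ai V f x = stot a ai V g x) -> K0eq ai f g.
Proof.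
move=> lf lg h; apply: Bset_stot; first exact: (lc_comp2 (fun x y => x - y)).
by move=> x; rewrite stotB h subrr.
Qed.

(** The nonnegative representative concentrates each segment sum at the base of its segment. *)
Lemma K0pos_stot f : lc f -> (forall x, 0 <= stot a ai V f x) -> K0pos ai f.
Proof.
move=> lf f0; pose h x := if V x then stot a ai V f x else 0.
have lh : lc h.
  apply: (lc_comp2 (fun (b : bool) (x : int) => if b then x else 0)) => //.
  exact: (lc_stot ha lV rV).
exists h; first by split=> // x; rewrite /h; case: ifP.
apply: K0eq_stot => // x; rewrite [in RHS]/stot.
have := ht_gt0 a ai V x; case E : (ht a ai V x) => [//|n] _.
rewrite big_ord_recl big1 ?addr0.
  by rewrite /= /h (V_base rV) (stot_base _ _ (y := x)) // base_V // (V_base rV).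
move=> j _; rewrite lift0 /h ifN //.
by apply: (htP rV x).2; rewrite E /= ltnS ltn_ord.
Qed.

End OnV.

(** Unperforation: positivity is read off from integer segment sums, and these can be divided by
    [n.+1]. *)
Lemma K0pos_unperf (n : nat) f : lc f -> K0pos ai (fun x => n.+1%:R * f x) -> K0pos ai f.
Proof.
move=> lf h.
have [[p _]|nX] := pselect (exists p : X, True); last first.
  by apply: K0pos_lc => // x; case: nX; exists x.
have [k hk] := filter_ex (stot_K0pos p h).
apply: (K0pos_stot (lc_cyl p k) (cyl_refl p k)) => // x.
by have := hk x; rewrite stotZ pmulr_rge0 // ltr0n.
Qed.

End Coord.

(** * Integer powers *)

Section Zpow.
Context {X : Type}.
Variables (a ai : X -> X).
Hypotheses (aK : cancel a ai) (aiK : cancel ai a).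

Lemma zpowS k x : zpow a ai (k + 1) x = a (zpow a ai k x).
Proof.
case: k => [n|[|n]]; first by rewrite /= addn1.
  by rewrite /= aiK.
have -> : Negz n.+1 + 1 = Negz n by lia.
by rewrite /= aiK.
Qed.

Lemma zpowP k x : zpow a ai (k - 1) x = ai (zpow a ai k x).
Proof. by rewrite -{2}(subrK 1 k) zpowS aK. Qed.

Lemma zpowD (k l : int) x : zpow a ai (k + l) x = zpow a ai k (zpow a ai l x).
Proof.
elim: k => [|n IH|n IH]; first by rewrite add0r.
  have -> : n.+1%:Z + l = n%:Z + l + 1 by lia.
  by rewrite zpowS IH -zpowS; congr zpow; lia.
have -> : - n.+1%:Z + l = (- n%:Z + l) - 1 by lia.
by rewrite zpowP IH -zpowP; congr zpow; lia.
Qed.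

Lemma zpowK k x : zpow a ai (- k) (zpow a ai k x) = x.
Proof. by rewrite -zpowD addNr. Qed.

Lemma zpowNK k x : zpow a ai k (zpow a ai (- k) x) = x.
Proof. by rewrite -zpowD addrN. Qed.

Lemma zpow_iter (j p : nat) x : zpow a ai (j%:Z - p%:Z) (iter p a x) = iter j a x.
Proof. by rewrite -[iter p a x]/(zpow a ai p x) -zpowD subrK. Qed.

End Zpow.

Lemma continuous_zpow (X : topologicalType) (a ai : X -> X) k : is_homeo a ai ->
  continuous (zpow a ai k).
Proof. by case=> ca cai _ _; case: k => n; apply: continuous_iter. Qed.

(** The integers of absolute value at most [N] are indexed as [j - N] with [j < 2N + 1]. *)
Lemma sum_delta (N : nat) (k v : int) : (absz k <= N)%N ->
  \sum_(j < N.*2.+1) (if (j : nat)%:Z - N%:Z == k then v else 0) = v.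
Proof.
move=> kN; have h : (absz (k + N%:Z)%R < N.*2.+1)%N by lia.
rewrite (bigD1 (Ordinal h)) //= big1 ?addr0; first by rewrite ifT //; lia.
move=> j /eqP jk; rewrite ifN //; apply/eqP => e; apply: jk; apply/val_inj => /=.
lia.
Qed.

(** * Counting along a segment *)

Lemma count_truncate (B : nat -> bool) m H :
  (\sum_(j < H) (B j && (\sum_(i < j) B i < m)) = minn m (\sum_(i < H) B i))%N.
Proof.
elim: H => [|H IH]; first by rewrite !big_ord0 minn0.
rewrite !big_ord_recr /= IH; case: (B H) => /=; last by rewrite !addn0.
by set s := (\sum_(i < H) _)%N; case: ltnP; lia.
Qed.

Lemma count_attains (B : nat -> bool) r H : (r < \sum_(i < H) B i)%N ->
  exists j, [/\ (j < H)%N, B j & (\sum_(i < j) B i)%N = r].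
Proof.
elim: H => [|H IH]; first by rewrite big_ord0.
rewrite big_ord_recr /=; set s := (\sum_(i < H) _)%N in IH *.
have [rs _|sr] := ltnP r s.
  by have [j [jH Bj e]] := IH rs; exists j; split => //; exact: ltnW.
by case BH: (B H) => /= h; [exists H; split=> //; rewrite -/s; lia|exfalso; lia].
Qed.

Lemma count_mono (B : nat -> bool) j k : (j < k)%N -> B j ->
  (\sum_(i < j) B i < \sum_(i < k) B i)%N.
Proof.
elim: k => // k IH; rewrite ltnS leq_eqVlt big_ord_recr /= => /orP[/eqP -> ->|jk Bj].
  by rewrite addn1.
exact: ltn_addr (IH jk Bj).
Qed.

Lemma count_inj (B : nat -> bool) j k : B j -> B k ->
  (\sum_(i < j) B i = \sum_(i < k) B i)%N -> j = k.
Proof.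
move=> Bj Bk e; case: (ltngtP j k) => // h.
  by have := count_mono h Bj; rewrite e ltnn.
by have := count_mono h Bk; rewrite e ltnn.
Qed.

Definition ind {T : Type} (E : T -> bool) (x : T) : int := (E x)%:R.

Lemma lc_ind (X : topologicalType) (E : X -> bool) : lc E -> lc (ind E).
Proof. exact: (lc_comp1 (fun b : bool => b%:R : int)). Qed.

Lemma ind_ge0 (T : Type) (E : T -> bool) x : 0 <= ind E x.
Proof. by rewrite /ind ler0n. Qed.

Lemma lc_eq (X : topologicalType) (T : eqType) (f : X -> T) l : lc f ->
  lc (fun x => f x == l).
Proof. exact: (lc_comp1 (fun t => t == l)). Qed.

(** * Clopen sets and the order of the dimension group *)

Section MinimalSystem.
Context {X : topologicalType}.
Variables (phi : X -> nat -> bool) (a ai : X -> X).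
Hypotheses (cX : coord_space phi) (ha : is_homeo a ai) (ma : minimal_map a).

Let ca : continuous a. Proof. by case: ha. Qed.
Let cai : continuous ai. Proof. by case: ha. Qed.
Let aK : cancel a ai. Proof. by case: ha. Qed.
Let aiK : cancel ai a. Proof. by case: ha. Qed.

Lemma ind_K0_zero E : lc E -> K0eq ai (ind E) (fun _ => 0) -> forall x, ~~ E x.
Proof.
move=> lE h x; apply/negP => Ex.
have [k /(_ x)] := filter_ex (stot_K0eq cX ha ma x h).
have r := recurrent_cyl cX ha ma x k.
have b : base ai (cyl phi x k) x = x by apply: base_V; exact: cyl_refl.
rewrite stot0 /stot; have := ht_gt0 a ai (cyl phi x k) x.
case: (ht _ _ _ _) => // n _; rewrite big_ord_recl /= b.
apply/eqP; rewrite gt_eqF // ltr_wpDr //; last by rewrite /ind Ex.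
by apply: sumr_ge0 => i _; exact: ind_ge0.
Qed.

(** With [V] taken around [p], the point [p] opens its segment, so it is the first point of [A]
    there. It is kept as soon as the segment sum of [f] is positive, which is what positivity of
    [N f - 1] ensures. *)
Lemma exists_subclopen (A : X -> bool) (f : X -> int) (N : nat) p :
  lc A -> lc f -> A p -> K0pos ai (fun x => N%:R * f x - 1) ->
  K0pos ai f -> K0pos ai (fun x => ind A x - f x) ->
  exists E : X -> bool, [/\ lc E, forall x, E x -> A x, E p & K0eq ai (ind E) f].
Proof.
move=> lA lf Ap f1 f0 fA.
have [k [[h1 h2] h3]] := filter_ex (filterI (filterI (stot_K0pos cX ha ma p f1)
  (stot_K0pos cX ha ma p f0)) (stot_K0pos cX ha ma p fA)).
set V := cyl phi p k in h1 h2 h3.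
have r : recurrent a ai V := recurrent_cyl cX ha ma p k.
have lV : lc V := lc_cyl cX p k.
have fpos x : 0 < stot a ai V f x.
  have := h1 x; rewrite stotB stotZ.
  have : 0 < stot a ai V (fun=> 1 : int) x.
    by rewrite /stot sumr_const card_ord pmulrn_rgt0 // ht_gt0.
  have := h2 x; rewrite /= le_eqVlt => /orP[/eqP <-|//].
  by rewrite mulr0 sub0r oppr_ge0 => /lt_le_trans h /h; rewrite ltxx.
have fle x : stot a ai V f x <= stot a ai V (ind A) x.
  by have := h3 x; rewrite stotB subr_ge0.
pose An x : nat := A x.
pose E x := A x && (sbelow a ai V An x < `|stot a ai V f x|)%N.
have lAn : lc An by apply: (lc_comp1 nat_of_bool).
have lE : lc E.
  apply: (lc_comp2 andb) => //.
  apply: (lc_comp2 (fun (u : nat) (v : int) => u < `|v|)%N).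
    exact: (lc_sbelow ha lV r).
  exact: (lc_stot ha lV r).
exists E; split => //.
- by move=> x /andP[].
- rewrite /E Ap /= sbelow_V; last exact: cyl_refl.
  by rewrite absz_gt0 gt_eqF.
apply: (K0eq_stot cX ha ma lV (cyl_refl phi p k)) => //; first exact: lc_ind.
move=> x; rewrite /stot.
set b := base ai V x; set m := `|stot a ai V f x|%N.
pose B j := A (iter j a b).
have -> : \sum_(j < ht a ai V x) ind E (iter j a b) =
  (\sum_(j < ht a ai V x) (B j && (\sum_(i < j) B i < m)))%N%:R.
  rewrite natr_sum; apply: eq_bigr => j _.
  have [pj bj] := base_iter r (ltn_ord j).
  rewrite /ind /E; congr ((_ && (_ < _))%N%:R).
    by rewrite /sbelow pj bj.
  by rewrite /m (stot_base _ _ bj).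
rewrite count_truncate -[RHS]/(stot a ai V f x).
have e : stot a ai V (ind A) x = (\sum_(i < ht a ai V x) B i)%N%:R.
  by rewrite natr_sum.
have := fle x; have := fpos x; rewrite e /m; move: (stot a ai V f x) => F.
by move: (\sum_(i < _) _)%N => S F0 FS; rewrite /minn; case: ifP; lia.
Qed.

Lemma K0_zpow k f : lc f -> K0eq ai (fun x => f (zpow a ai k x)) f.
Proof.
move=> lf; apply: K0_sym; case: k => n /=.
  exact: (K0_shift_iterV ha).
exact: (K0_shift_iter ha n.+1).
Qed.

(* [n] only has to be locally constant on the support of [h o c]: this
   tolerates a discontinuity of [n] at a point that [c] maps outside the
   support of [h]. *)
Lemma K0_piecewise_power (c ci : X -> X) (n : X -> int) (h : X -> int) :
  is_homeo c ci -> (forall x, c x = zpow a ai (n x) x) -> lc h ->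
  (forall x, h (c x) != 0 -> zcont_at n x) -> K0eq ai (fun x => h (c x)) h.
Proof.
move=> [cc cci cK ciK] cn lh hn.
have lhc : lc (fun x => h (c x)) by apply: lc_cont.
(* Forgetting the exponent where [h \o c] vanishes makes it locally constant, hence bounded. *)
pose n' x := if h (c x) == 0 then 0 else n x.
have ln' : lc n'.
  move=> x; rewrite /n'; case: ifP => h0.
    by apply: filterS (lhc x) => y ->; rewrite h0.
  by apply: filterS (filterI (lhc x) (hn x (negbT h0))) => y [-> ->]; rewrite h0.
have [N hN] := lc_bounded cX (lc_comp1 absz ln').
(* Cut [h \o c] into its pieces over the level sets of [n']; translating the piece of exponent [k]
   by [a^k] reassembles [h], and each translation preserves the class. *)
pose u k x := if k == n' x then h (c x) else 0.
have lu k : lc (u k).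
  by apply: (lc_comp2 (fun s t => if k == s then t else 0 : int)).
pose w (j : nat) : int := j%:Z - N%:Z.
have -> : (fun x => h (c x)) = (fun x => \sum_(j < N.*2.+1) u (w j) x).
  by apply/funext => x; rewrite /u sum_delta // ltnW // hN.
have hE : h = (fun x => \sum_(j < N.*2.+1) u (w j) (zpow a ai (- w j) x)).
  apply/funext => x; rewrite -[LHS](@sum_delta N (n' (ci x))); last by rewrite ltnW // hN.
  apply: eq_bigr => j _; rewrite -/(w j); set k := w j.
  rewrite /u; set z := zpow a ai (- k) x.
  have zk : zpow a ai k z = x by rewrite zpowNK.
  have [kz|kz] := eqVneq k (n' z).
    have [h0|h0] := eqVneq (h (c z)) 0.
      case: eqP => // k2; apply/eqP; apply: contraT => hx.
      rewrite h0 in hx.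
      suff e : z = ci x by rewrite e ciK in h0; rewrite h0 eqxx in hx.
      rewrite -(zpowK aK aiK k (ci x)) /z; congr zpow.
      rewrite k2 /n' ciK (negbTE hx) -cn ciK //.
    have cz : c z = x by rewrite cn -[RHS]zk kz /n' (negbTE h0).
    by rewrite -cz cK kz eqxx.
  case: eqP => // k2; apply/eqP; apply: contraT => hx.
  have k3 : k = n (ci x) by rewrite k2 /n' ciK (negbTE hx).
  have e : z = ci x.
    by rewrite -(zpowK aK aiK k (ci x)) /z; congr zpow; rewrite k3 -cn ciK.
  by rewrite e k2 eqxx in kz.
rewrite [X in K0eq _ _ X]hE.
apply: (@K0_sum _ ai _ (fun j => u (w j)) (fun j x => u (w j) (zpow a ai (- w j) x))) => j _.
exact/K0_sym/K0_zpow.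
Qed.

(** Bounded return times give [n [1_G] >= 1] for some positive [n]. If also [n f <= 1], then [n
    ([1_G] - f)] is positive, and unperforation removes the factor. *)
Lemma clopen_dominates (G : X -> bool) p : lc G -> G p ->
  exists n : nat, forall f : X -> int, lc f ->
    K0pos ai (fun x => 1 - n%:R * f x) -> K0pos ai (fun x => ind G x - f x).
Proof.
move=> lG Gp; have [n hn] := rec_fwd cX ha ma lG Gp.
exists n.+1 => f lf h.
apply: (K0pos_unperf cX ha ma (n := n)).
  by apply: (lc_comp2 (fun x y => x - y)) => //; exact: lc_ind.
have hp : K0pos ai (fun x => n.+1%:R * ind G x - 1).
  have lS : lc (fun x => \sum_(j < n.+1) ind G (iter j.+1 a x)).
    by apply: (@lc_sum _ _ (fun j x => ind G (iter j.+1 a x))) => j; apply: lc_iter => //; exact: lc_ind.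
  have lS1 : lc (fun x => \sum_(j < n.+1) ind G (iter j.+1 a x) - 1).
    exact: (lc_comp1 (fun x => x - 1)).
  apply: (K0pos_eq (f := fun x => \sum_(j < n.+1) ind G (iter j.+1 a x) - 1)).
    apply: K0B; last exact: K0_refl.
    have -> : (fun x => n.+1%:R * ind G x) = (fun x => \sum_(j < n.+1) ind G x).
      by apply/funext => x; rewrite sumr_const card_ord mulr_natl.
    apply: (@K0_sum _ ai _ (fun j x => ind G (iter j.+1 a x)) (fun j => ind G)) => j _.
    by apply: K0_sym; apply: (@K0_shift_iterV _ _ _ ha j.+1); exact: lc_ind.
  apply: K0pos_lc => // x; have [j jn Gj] := hn x.
  rewrite subr_ge0 (bigD1 (Ordinal (ltnW jn : (j < n.+1)%N))) //=.
  rewrite {1}/ind Gj lerDl; apply: sumr_ge0 => i _; exact: ind_ge0.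
have := K0posD hp h; congr K0pos; apply/funext => x; ring.
Qed.

End MinimalSystem.

(** * Matching keyed clopen sets by piecewise powers *)

Section Matching.
Context {X : topologicalType}.
Variables (a ai : X -> X) (V : X -> bool).
Hypotheses (ha : is_homeo a ai) (lV : lc V) (r : recurrent a ai V).

Let aK : cancel a ai. Proof. by case: ha. Qed.
Let aiK : cancel ai a. Proof. by case: ha. Qed.

Section TwoKeys.
Variables kU kV : X -> nat.

Definition rank (k : X -> nat) (l : nat) (x : X) : nat :=
  sbelow a ai V (fun y => (k y == l) : nat) x.

(** The partner of [x] is the level of its segment with the same key and the same rank among the
    points of that key. Key 0 marks points that are not to be matched: the condition then always
    holds, and their [shift] carries no meaning. *)
Definition matched (j : nat) (x : X) : bool :=
  (kU x == 0%N) || [&& (j < ht a ai V x)%N, kV (iter j a (base ai V x)) == kU x &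
   rank kV (kU x) (iter j a (base ai V x)) == rank kU (kU x) x].

Definition shift (x : X) : int :=
  (first (matched^~ x))%:Z - (pos ai V x)%:Z.

End TwoKeys.

Lemma lc_rank k l : lc k -> lc (rank k l).
Proof.
move=> lk; apply: (lc_sbelow ha lV r).
exact: (lc_comp1 (fun t : nat => nat_of_bool (t == l))).
Qed.

Lemma rank_iter k l x j : (j < ht a ai V x)%N ->
  rank k l (iter j a (base ai V x)) = (\sum_(i < j) (k (iter i a (base ai V x)) == l))%N.
Proof. by move=> jh; rewrite /rank /sbelow; have [-> ->] := base_iter r jh. Qed.

Definition balanced (kU kV : X -> nat) : Prop :=
  forall l, (0 < l)%N -> forall x, stot a ai V (fun y => (kU y == l) : nat) x =
    stot a ai V (fun y => (kV y == l) : nat) x.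

Lemma matched_ex kU kV : balanced kU kV -> forall x, exists j, matched kU kV j x.
Proof.
move=> bal x; rewrite /matched; have [U0|U0] := eqVneq (kU x) 0%N; first by exists 0%N.
have Upos : (0 < kU x)%N by rewrite lt0n.
set b := base ai V x.
have bx : iter (pos ai V x) a b = x := iter_base r x.
have : (rank kU (kU x) x < \sum_(i < ht a ai V x) (kV (iter i a b) == kU x))%N.
  rewrite -[X in (_ < X)%N](bal _ Upos x) /rank /sbelow /stot -/b.
  apply: (@count_mono (fun i => kU (iter i a b) == kU x)); first exact: pos_lt_ht.
  by rewrite bx.
move=> /(@count_attains (fun i => kV (iter i a b) == kU x)) [j [jh kj ej]].
by exists j; rewrite /= jh kj /= rank_iter // -/b; apply/eqP.
Qed.

Lemma lc_shift kU kV : lc kU -> lc kV -> balanced kU kV -> lc (shift kU kV).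
Proof.
move=> lU lW bal.
apply: (lc_comp2 (fun u v : nat => u%:Z - v%:Z)); last exact: (lc_pos ha lV r).
apply: (@lc_first _ (matched kU kV)); last exact: matched_ex.
move=> j; rewrite /matched.
apply: (lc_comp2 orb); first exact: (lc_comp1 (fun u : nat => u == 0%N)).
apply: (lc_comp2 andb).
  by apply: (lc_comp1 (fun u => j < u)%N); exact: (lc_ht ha lV r).
have lb (f : X -> nat) : lc f -> lc (fun x => f (iter j a (base ai V x))).
  move=> lf; apply: (@lc_at_base _ _ _ _ ha lV r _ (fun x => f (iter j a x))).
  by apply: lc_iter => //; case: ha.
apply: (lc_comp2 andb).
  by apply: (lc_comp2 (fun u v : nat => u == v)) => //; exact: lb.
apply: (@lc_dep _ _ _ (fun l x => rank kV l (iter j a (base ai V x)) == rank kU l x)) => // l.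
by apply: (lc_comp2 (fun u v : nat => u == v)); [exact/lb/lc_rank|exact: lc_rank].
Qed.

(** Equality of key and rank is symmetric, and a rank determines the level, so searching back from
    the partner returns to [x]. *)
Lemma shift_matched kU kV x : balanced kU kV -> (0 < kU x)%N ->
  kV (zpow a ai (shift kU kV x) x) = kU x /\
  shift kV kU (zpow a ai (shift kU kV x) x) = - shift kU kV x.
Proof.
move=> bal Ux.
have [] := firstP (matched_ex bal x).
rewrite {2 4}/shift; set j := first (matched kU kV ^~ x).
rewrite {1}/matched gtn_eqF //= => /and3P[jh /eqP kj /eqP rj] _.
set b := base ai V x in kj rj *.
have bx : iter (pos ai V x) a b = x := iter_base r x.
have -> : zpow a ai (shift kU kV x) x = iter j a b.
  by rewrite /shift -/j -{2}bx zpow_iter.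
split=> //; have [pj bj] := base_iter r jh.
rewrite /shift pj opprB -/b; congr (_%:Z - _).
have e : ht a ai V (iter j a b) = ht a ai V x by apply: ht_eq.
apply: first_unique.
  rewrite /matched kj gtn_eqF //= bj e -/b bx rj !eqxx !andbT.
  exact: pos_lt_ht.
move=> i ip; rewrite /matched kj gtn_eqF //= bj e -/b.
have ih : (i < ht a ai V x)%N := ltn_trans ip (pos_lt_ht r x).
rewrite ih /=; apply/negP => /andP[/eqP ki]; rewrite rj rank_iter // -/b => /eqP ei.
suff : i = pos ai V x by move=> e2; rewrite e2 ltnn in ip.
apply: (@count_inj (fun i => kU (iter i a b) == kU x)).
- by rewrite ki.
- by rewrite bx.
- exact: ei.
Qed.

End Matching.

Lemma stot_natr (X : Type) (a ai : X -> X) V (B : X -> bool) x :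
  (stot a ai V (fun y => B y : nat) x)%:R = stot a ai V (ind B) x.
Proof. by rewrite /stot natr_sum. Qed.

Lemma keyed_matching (X : topologicalType) (phi : X -> nat -> bool) (a ai : X -> X)
    (kU kV : X -> nat) (p : X) :
  coord_space phi -> is_homeo a ai -> minimal_map a -> lc kU -> lc kV ->
  (forall l, (0 < l)%N -> K0eq ai (ind (fun x => kU x == l)) (ind (fun x => kV x == l))) ->
  exists m m' : X -> int, [/\ lc m, lc m',
    forall x, (0 < kU x)%N ->
      kV (zpow a ai (m x) x) = kU x /\ m' (zpow a ai (m x) x) = - m x &
    forall x, (0 < kV x)%N ->
      kU (zpow a ai (m' x) x) = kV x /\ m (zpow a ai (m' x) x) = - m' x].
Proof.
move=> cX ha ma lU lW hK.
have [N1 hN1] := lc_bounded cX lU; have [N2 hN2] := lc_bounded cX lW.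
(* One [V] has to serve all keys; [N1 + N2] exceeds every key that occurs on either side. *)
have : \forall k \near \oo, forall l, (l < N1 + N2)%N -> (0 < l)%N ->
    forall x, stot a ai (cyl phi p k) (ind (fun x => kU x == l)) x
            = stot a ai (cyl phi p k) (ind (fun x => kV x == l)) x.
  apply: near_forall_ltn => l.
  have [l0|l0] := posnP l; first by rewrite l0; apply: nearW.
  by apply: filterS (stot_K0eq cX ha ma p (hK l l0)) => k h _.
move=> /(@filter_ex _ _ _) [k hk].
set V := cyl phi p k in hk.
have lV : lc V := lc_cyl cX p k.
have r : recurrent a ai V := recurrent_cyl cX ha ma p k.
have bal : balanced a ai V kU kV.
  move=> l l0 x; have [lN|lN] := ltnP l (N1 + N2)%N.
    have := hk l lN l0 x; rewrite -!stot_natr => /eqP.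
    by rewrite eqr_nat => /eqP.
  apply: eq_stot => y; have := hN1 y; have := hN2 y.
  by case: eqP; case: eqP => //; lia.
have bal' : balanced a ai V kV kU by move=> l l0 x; rewrite bal.
exists (shift a ai V kU kV), (shift a ai V kV kU); split.
- exact: lc_shift.
- exact: lc_shift.
- by move=> x; apply: shift_matched.
- by move=> x; apply: shift_matched.
Qed.

(** * Realizing classes by clopen sets *)

Section Realize.
Context {X Y : topologicalType}.
Variables (phi : X -> nat -> bool) (psi : Y -> nat -> bool).
Variables (a ai : X -> X) (b bi : Y -> Y) (r : (Y -> int) -> (X -> int)).
Hypotheses (cX : coord_space phi) (ha : is_homeo a ai) (ma : minimal_map a).
Hypotheses (cY : coord_space psi) (hb : is_homeo b bi) (mb : minimal_map b).
Hypothesis hr : unital_order_hom ai bi r.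
Variable pt : X.

Let lr f : lc f -> lc (r f). Proof. by case: hr => h _ _ _ _; exact: h. Qed.

Lemma hom_wd f g : lc f -> lc g -> K0eq bi f g -> K0eq ai (r f) (r g).
Proof. by case: hr => _ h _ _ _; exact: h. Qed.

Lemma homD f g : lc f -> lc g ->
  K0eq ai (r (fun y => f y + g y)) (fun x => r f x + r g x).
Proof. by case: hr => _ _ h _ _; exact: h. Qed.

Lemma hom_pos f : lc f -> (forall y, 0 <= f y) -> K0pos ai (r f).
Proof. by case: hr => _ _ _ h _ lf f0; apply: h => //; exact: K0pos_lc. Qed.

Lemma hom1 : K0eq ai (r (fun _ => 1)) (fun _ => 1).
Proof. by case: hr. Qed.

Lemma hom0 : K0eq ai (r (fun _ => 0)) (fun _ => 0).
Proof.
have := homD (@lc_cst Y _ 0) (@lc_cst Y _ 0).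
have -> : (fun _ : Y => 0 + 0 : int) = (fun _ => 0) by apply/funext => y; rewrite addr0.
move=> /K0_sym; apply: eq_Bset => x; ring.
Qed.

Lemma homB f g : lc f -> lc g ->
  K0eq ai (r (fun y => f y - g y)) (fun x => r f x - r g x).
Proof.
move=> lf lg.
have := @homD (fun y => f y - g y) g (lc_comp2 (fun x y => x - y) lf lg) lg.
have -> : (fun y => f y - g y + g y) = f by apply/funext => y; rewrite subrK.
by move=> /K0_sym; apply: eq_Bset => x; ring.
Qed.

Lemma hom_sum n (F : nat -> Y -> int) : (forall i, lc (F i)) ->
  K0eq ai (r (fun y => \sum_(i < n) F i y)) (fun x => \sum_(i < n) r (F i) x).
Proof.
move=> lF; elim: n => [|n IH].
  have -> : (fun y => \sum_(i < 0) F i y) = (fun _ => 0).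
    by apply/funext => y; rewrite big_ord0.
  by apply: K0_trans hom0 _; apply: K0_eq => x; rewrite big_ord0.
have -> : (fun y => \sum_(i < n.+1) F i y) = (fun y => \sum_(i < n) F i y + F n y).
  by apply/funext => y; rewrite big_ord_recr.
have -> : (fun x => \sum_(i < n.+1) r (F i) x) = (fun x => \sum_(i < n) r (F i) x + r (F n) x).
  by apply/funext => y; rewrite big_ord_recr.
apply: K0_trans (homD _ _) _ => //; first exact: lc_sum.
by apply: K0D => //; exact: K0_refl.
Qed.

Lemma hom_shift j f : lc f -> K0eq ai (r (fun y => f (iter j b y))) (r f).
Proof.
move=> lf; apply: hom_wd => //; first by apply: lc_iter => //; case: hb.
exact/K0_sym/(K0_shift_iterV hb).
Qed.

(** The first [N] translates of [C] cover Y by recurrence, and all have the class of [C]. *)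
Lemma hom_full (C : Y -> bool) y : lc C -> C y ->
  exists N : nat, K0pos ai (fun x => N%:R * r (ind C) x - 1).
Proof.
move=> lC Cy; have [N hN] := rec_fwd cY hb mb lC Cy; exists N.
have lCj j : lc (fun y => ind C (iter j.+1 b y)).
  by apply: lc_iter; [case: hb|exact: lc_ind].
have lS : lc (fun y => \sum_(j < N) ind C (iter j.+1 b y)).
  exact: (@lc_sum _ _ (fun j y => ind C (iter j.+1 b y))).
apply: (@K0pos_eq _ _ (r (fun y => \sum_(j < N) ind C (iter j.+1 b y) - 1))).
  apply: K0_trans (homB lS (lc_cst _)) _; apply: K0B; last exact: hom1.
  have -> : (fun x => N%:R * r (ind C) x) = (fun x => \sum_(j < N) r (ind C) x).
    by apply/funext => x; rewrite sumr_const card_ord mulr_natl.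
  apply: K0_trans (@hom_sum N (fun j y => ind C (iter j.+1 b y)) lCj) _.
  apply: (@K0_sum _ ai _ (fun j => r (fun y => ind C (iter j.+1 b y))) (fun _ => r (ind C))).
  by move=> j _; apply: (hom_shift j.+1); exact: lc_ind.
apply: hom_pos; first exact: (lc_comp1 (fun x => x - 1)).
move=> z; have [j jn Gj] := hN z.
rewrite subr_ge0 (bigD1 (Ordinal jn)) //= {1}/ind Gj lerDl.
by apply: sumr_ge0 => i _; exact: ind_ge0.
Qed.

(** Dual to the covering bound: [N] disjoint translates of [C] have indicators summing to at most
    1. *)
Lemma hom_sparse (C : Y -> bool) N : lc C ->
  (forall y i j, (i < j < N)%N -> C (iter i b y) -> ~~ C (iter j b y)) ->
  K0pos ai (fun x => 1 - N%:R * r (ind C) x).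
Proof.
move=> lC hC.
have lCj j : lc (fun y => ind C (iter j b y)).
  by apply: lc_iter; [case: hb|exact: lc_ind].
have lS : lc (fun y => \sum_(j < N) ind C (iter j b y)).
  exact: (@lc_sum _ _ (fun j y => ind C (iter j b y))).
apply: (@K0pos_eq _ _ (r (fun y => 1 - \sum_(j < N) ind C (iter j b y)))).
  apply: K0_trans (homB (lc_cst _) lS) _; apply: K0B; first exact: hom1.
  have -> : (fun x => N%:R * r (ind C) x) = (fun x => \sum_(j < N) r (ind C) x).
    by apply/funext => x; rewrite sumr_const card_ord mulr_natl.
  apply: K0_trans (@hom_sum N (fun j y => ind C (iter j b y)) lCj) _.
  apply: (@K0_sum _ ai _ (fun j => r (fun y => ind C (iter j b y))) (fun _ => r (ind C))).
  by move=> j _; apply: (hom_shift j); exact: lc_ind.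
apply: hom_pos; first exact: (lc_comp1 (fun x => 1 - x)).
move=> z; rewrite subr_ge0.
have [[j /= Cj]|nC] := pselect (exists j : 'I_N, C (iter j b z)).
  rewrite (bigD1 j) //= {1}/ind Cj big1 ?addr0 // => i ij; rewrite /ind.
  case: (ltngtP i j) => h.
  - case Ci: (C (iter i b z)) => //.
    by have := hC z i j; rewrite h ltn_ord Cj => /(_ isT Ci).
  - by have /negbTE -> := hC z j i (introT andP (conj h (ltn_ord i))) Cj.
  - by move: ij; rewrite (val_inj h) eqxx.
rewrite big1 // => j _; rewrite /ind; case Cj: (C _) => //.
by case: nC; exists j.
Qed.

Definition cls (E : X -> bool) (C : Y -> bool) : Prop :=
  K0eq ai (ind E) (r (ind C)).

Implicit Types (E A : X -> bool) (C : Y -> bool) (t : X -> nat).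

Lemma eq_cls E C E' C' : E =1 E' -> C =1 C' -> cls E C -> cls E' C'.
Proof. by move=> /funext -> /funext ->. Qed.

Lemma cls_disj E C E' C' : lc C -> lc C' ->
  (forall x, ~~ (E x && E' x)) -> (forall y, ~~ (C y && C' y)) ->
  cls E C -> cls E' C' ->
  cls (fun x => E x || E' x) (fun y => C y || C' y).
Proof.
move=> lC lC' dE dC h h'.
have e : ind (fun x => E x || E' x) = (fun x => ind E x + ind E' x).
  by apply/funext => x; rewrite /ind; have := dE x; case: (E x); case: (E' x).
have e' : ind (fun x => C x || C' x) = (fun x => ind C x + ind C' x).
  by apply/funext => x; rewrite /ind; have := dC x; case: (C x); case: (C' x).
rewrite /cls e e'; apply: K0_trans (K0D h h') _.
by apply: K0_sym; apply: homD; exact: lc_ind.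
Qed.

Lemma cls_diff E C E' C' : lc C -> lc C' ->
  (forall x, E' x -> E x) -> (forall y, C' y -> C y) ->
  cls E C -> cls E' C' ->
  cls (fun x => E x && ~~ E' x) (fun y => C y && ~~ C' y).
Proof.
move=> lC lC' dE dC h h'.
have e : ind (fun x => E x && ~~ E' x) = (fun x => ind E x - ind E' x).
  by apply/funext => x; rewrite /ind; have := dE x; case: (E x); case: (E' x) => // /(_ isT).
have e' : ind (fun x => C x && ~~ C' x) = (fun x => ind C x - ind C' x).
  by apply/funext => x; rewrite /ind; have := dC x; case: (C x); case: (C' x) => // /(_ isT).
rewrite /cls e e'; apply: K0_trans (K0B h h') _.
by apply: K0_sym; apply: homB; exact: lc_ind.
Qed.

Lemma cls_empty E C : (forall x, ~~ E x) -> (forall y, ~~ C y) -> cls E C.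
Proof.
move=> hE hC; rewrite /cls.
have -> : ind E = (fun _ => 0) by apply/funext => x; rewrite /ind (negbTE (hE x)).
have -> : ind C = (fun _ => 0) by apply/funext => x; rewrite /ind (negbTE (hC x)).
exact/K0_sym/hom0.
Qed.

Lemma cls_exY E C x : lc E -> cls E C -> E x -> exists y, C y.
Proof.
move=> lE h Ex; apply: contrapT => nC.
have : cls E xpred0.
  apply: eq_cls h => // y; apply/negP => Cy; by apply: nC; exists y.
have -> : cls E xpred0 = K0eq ai (ind E) (r (fun _ => 0)) by [].
move=> /K0_trans /(_ hom0) /(ind_K0_zero cX ha ma lE) /(_ x).
by rewrite Ex.
Qed.

(** If [E] were empty, the image of [[1_C]] would be 0, although some multiple of it dominates the
    unit; that would make -1 positive. *)
Lemma cls_exX E C y : lc C -> cls E C -> C y -> exists x, E x.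
Proof.
move=> lC h Cy; apply: contrapT => nE.
have [N hN] := hom_full lC Cy.
have h0 : K0eq ai (r (ind C)) (fun _ => 0).
  apply: K0_trans (K0_sym h) _; apply: K0_eq => x; rewrite /ind; case Ex: (E x) => //.
  by case: nE; exists x.
have : K0pos ai (fun _ : X => -1).
  apply: K0pos_eq hN; apply: K0_trans (K0B (K0Z _ h0) (K0_refl _ _)) _.
  by apply: K0_eq => x; rewrite mulr0 sub0r.
move=> /(stot_K0pos cX ha ma pt) /(@filter_ex _ _ _) [k /(_ pt)].
rewrite /stot sumr_const card_ord mulNrn oppr_ge0 lern0.
by have := ht_gt0 a ai (cyl phi pt k) pt; case: (ht _ _ _ _).
Qed.

Lemma exists_realization A C p y : lc A -> lc C -> A p -> C y ->
  K0pos ai (fun x => ind A x - r (ind C) x) ->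
  exists E : X -> bool, [/\ lc E, forall x, E x -> A x, E p & cls E C].
Proof.
move=> lA lC Ap Cy h; have [N hN] := hom_full lC Cy.
apply: (exists_subclopen cX ha ma lA (lr (lc_ind lC)) Ap hN) => //.
by apply: hom_pos; [exact: lc_ind|exact: ind_ge0].
Qed.

Lemma sub_realization A C C' p y : lc A -> lc C -> lc C' -> A p -> C' y ->
  (forall z, C' z -> C z) -> cls A C ->
  exists E : X -> bool, [/\ lc E, forall x, E x -> A x, E p & cls E C'].
Proof.
move=> lA lC lC' Ap Cy CC' h; apply: (exists_realization lA lC' Ap Cy).
have lD : lc (fun z => C z && ~~ C' z) by apply: (lc_comp2 (fun u v => u && ~~ v)).
apply: (@K0pos_eq _ _ (r (ind (fun z => C z && ~~ C' z)))); last first.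
  by apply: hom_pos; [exact: lc_ind|exact: ind_ge0].
have -> : ind (fun z => C z && ~~ C' z) = (fun z => ind C z - ind C' z).
  apply/funext => z; rewrite /ind; have := CC' z.
  by case: (C z); case: (C' z) => // /(_ isT).
apply: K0_trans (homB (lc_ind lC) (lc_ind lC')) _.
by apply: K0B; [exact: K0_sym|exact: K0_refl].
Qed.

(** * Splitting a realized clopen set along a labelling *)

Section Split.
Variable q : Y -> nat.
Hypothesis lq : lc q.

Definition splits (E : X -> bool) (C : Y -> bool) (t : X -> nat) : Prop :=
  lc t /\ forall l, cls (fun x => E x && (t x == l)) (fun y => C y && (q y == l)).

Lemma lc_sub (Z : topologicalType) (E : Z -> bool) (t : Z -> nat) l :
  lc E -> lc t -> lc (fun x => E x && (t x == l)).
Proof. by move=> lE lt; apply: (lc_comp2 (fun u v => u && (v == l))). Qed.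

Lemma splits_label E C t x : lc E -> splits E C t -> E x ->
  exists2 y, C y & q y = t x.
Proof.
move=> lE [lt h] Ex.
have [||y /andP[Cy /eqP qy]] := @cls_exY _ _ x _ (h (t x)).
- exact: lc_sub.
- by rewrite Ex eqxx.
by exists y.
Qed.

Lemma splits_glue E C E' C' t t' : lc E -> lc C -> lc C' ->
  (forall x, ~~ (E x && E' x)) -> (forall y, ~~ (C y && C' y)) ->
  splits E C t -> splits E' C' t' ->
  splits (fun x => E x || E' x) (fun y => C y || C' y)
    (fun x => if E x then t x else t' x).
Proof.
move=> lE lC lC' dE dC [lt h] [lt' h'].
split=> [|l].
  have lp : lc (fun x => (E x, t x)) by apply: (lc_comp2 pair).
  by apply: (lc_comp2 (fun (s : bool * nat) (u : nat) => if s.1 then s.2 else u) lp).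
apply: eq_cls (cls_disj _ _ _ _ (h l) (h' l)).
- move=> x; have := dE x; case: (E x); case: (E' x) => //= _; by rewrite orbF.
- by move=> y; rewrite andb_orl.
- exact: lc_sub.
- exact: lc_sub.
- by move=> x; have := dE x; case: (E x); case: (E' x) => //= _; rewrite andbF.
- by move=> x; have := dC x; case: (C x); case: (C' x) => //= _; rewrite andbF.
Qed.

(** Labels are peeled off one by one: the part of [C] labelled [l] is realized inside [E], and the
    differences still have corresponding classes. *)
Lemma splits_exist_seq (ls : seq nat) E C : lc E -> lc C -> cls E C ->
  (forall y, C y -> q y \in ls) -> exists t, splits E C t.
Proof.
elim: ls E C => [|l ls IH] E C lE lC h hq.
  exists (fun _ => 0%N); split; first exact: lc_cst.
  have C0 y : ~~ C y by apply/negP => /hq.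
  move=> l; apply: cls_empty => [x|y]; last by rewrite (negbTE (C0 y)).
  apply/negP => /andP[Ex _]; have [y] := cls_exY lE h Ex.
  by rewrite (negbTE (C0 y)).
pose C1 y := C y && (q y == l); have lC1 : lc C1 by exact: lc_sub.
have [E1 [lE1 E1E h1]] : exists E1, [/\ lc E1, forall x, E1 x -> E x & cls E1 C1].
  have [[y C1y]|nC1] := pselect (exists y, C1 y).
    have [Cy _] := andP C1y.
    have [p Ep] := cls_exX lC h Cy.
    have [|E1 [? ? _ ?]] := sub_realization lE lC lC1 Ep C1y _ h; first by move=> z /andP[].
    by exists E1.
  exists xpred0; split=> //; first exact: lc_cst.
  by apply: cls_empty => // y; apply/negP => C1y; apply: nC1; exists y.
have [||||t ht] := IH (fun x => E x && ~~ E1 x) (fun y => C y && ~~ C1 y).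
- by apply: (lc_comp2 (fun u v => u && ~~ v)).
- by apply: (lc_comp2 (fun u v => u && ~~ v)).
- by apply: cls_diff => // z /andP[].
- move=> y /andP[Cy]; rewrite /C1 Cy /= => ql.
  by have := hq y Cy; rewrite inE (negbTE ql).
have s1 : splits E1 C1 (fun _ => l).
  split=> [|l']; first exact: lc_cst.
  have [<-|ll'] := eqVneq l l'.
    by apply: eq_cls h1 => z; rewrite ?andbT // /C1 -andbA andbb.
  apply: cls_empty => [x|y]; first by rewrite andbF.
  by rewrite /C1; case: (eqVneq (q y) l) => [->|]; rewrite ?andbF // (negbTE ll') andbF.
exists (fun x => if E1 x then l else t x).
have [|||lt hl] := splits_glue lE1 lC1 _ _ _ s1 ht.
- by apply: (lc_comp2 (fun u v => u && ~~ v)).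
- by move=> x; case: (E1 x); rewrite ?andbF.
- by move=> y; case: (C1 y); rewrite ?andbF.
split=> // l'; apply: eq_cls (hl l').
  by move=> x; have := E1E x; case: (E1 x) => [/(_ isT) ->|_]; rewrite ?andbT.
by move=> y; rewrite /C1; case: (C y); case: (q y == l).
Qed.

Lemma splits_exist E C : lc E -> lc C -> cls E C -> exists t, splits E C t.
Proof.
move=> lE lC h; have [N hN] := lc_bounded cY lq.
by apply: (@splits_exist_seq (iota 0 N)) => // y _; rewrite mem_iota hN.
Qed.

(** The part of [C] with the label of [y] is realized first, by a set through [p]; every label used
    on that set is the label of [y]. *)
Lemma splits_exist_pointed E C p y : lc E -> lc C -> cls E C -> E p -> C y ->
  exists2 t, splits E C t & t p = q y.
Proof.
move=> lE lC h Ep Cy.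
pose C1 z := C z && (q z == q y); have lC1 : lc C1 by exact: lc_sub.
have C1y : C1 y by rewrite /C1 Cy eqxx.
have [|E1 [lE1 E1E E1p h1]] := sub_realization lE lC lC1 Ep C1y _ h; first by move=> z /andP[].
have [t1 s1] := splits_exist lE1 lC1 h1.
have [|||t2 s2] := @splits_exist (fun x => E x && ~~ E1 x) (fun y => C y && ~~ C1 y).
- by apply: (lc_comp2 (fun u v => u && ~~ v)).
- by apply: (lc_comp2 (fun u v => u && ~~ v)).
- by apply: cls_diff => // z /andP[].
exists (fun x => if E1 x then t1 x else t2 x); last first.
  by rewrite E1p; have [z /andP[_ /eqP <-] <-] := splits_label lE1 s1 E1p.
have [|||lt hl] := splits_glue lE1 lC1 _ _ _ s1 s2.
- by apply: (lc_comp2 (fun u v => u && ~~ v)).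
- by move=> x; case: (E1 x); rewrite ?andbF.
- by move=> z; case: (C1 z); rewrite ?andbF.
split=> // l'; apply: eq_cls (hl l').
  by move=> x; have := E1E x; case: (E1 x) => [/(_ isT) ->|_]; rewrite ?andbT.
by move=> z; rewrite /C1; case: (C z); case: (q z == q y).
Qed.

(** Each old atom is split separately, so that a new label on [E] always comes with an old label it
    is compatible with. *)
Lemma splits_relative (t0 : X -> nat) (q0 : Y -> nat) E C : lc t0 -> lc q0 -> lc E -> lc C ->
  (forall l, cls (fun x => E x && (t0 x == l)) (fun y => C y && (q0 y == l))) ->
  exists2 t, splits E C t &
    forall x, E x -> exists y, [/\ C y, q y = t x & q0 y = t0 x].
Proof.
move=> lt0 lq0 lE lC h.
have /choice [T hT] : forall l, exists t,
    splits (fun x => E x && (t0 x == l)) (fun y => C y && (q0 y == l)) t.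
  by move=> l; apply: splits_exist; try exact: lc_sub; exact: h.
have lT : lc (fun x => T (t0 x) x) by apply: (@lc_dep _ _ _ T) => // l; case: (hT l).
exists (fun x => T (t0 x) x); last first.
  move=> x Ex; have [||y /andP[Cy /eqP q0y] qy] := @splits_label _ _ _ x _ (hT (t0 x)).
  - exact: lc_sub.
  - by rewrite Ex eqxx.
  by exists y.
split=> // l; have [N hN] := lc_bounded cX lt0; have [M hM] := lc_bounded cY lq0.
suff hn n : cls (fun x => [&& E x, T (t0 x) x == l & (t0 x < n)%N])
                (fun y => [&& C y, q y == l & (q0 y < n)%N]).
  apply: eq_cls (hn (N + M)%N) => z.
    by have := hN z; case: ltnP; rewrite ?andbT //; lia.
  by have := hM z; case: ltnP; rewrite ?andbT //; lia.
elim: n => [|n IH]; first by apply: cls_empty => z; rewrite ltn0 !andbF.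
have [_ /(_ l) hTn] := hT n.
have l1 : lc (fun y => [&& C y, q y == l & (q0 y < n)%N]).
  apply: (lc_comp2 andb) => //.
  by apply: (lc_comp2 (fun u v => (u == l) && (v < n)%N)).
have l2 : lc (fun y => C y && (q0 y == n) && (q y == l)).
  by apply: lc_sub => //; exact: lc_sub.
apply: eq_cls (cls_disj l1 l2 _ _ IH hTn).
- move=> x; rewrite ltnS [in RHS]leq_eqVlt; case: (E x) => //=.
  by case: (eqVneq (t0 x) n) => [->|_]; rewrite /= ?ltnn ?andbF ?andbT ?orbF.
- move=> x; rewrite ltnS [in RHS]leq_eqVlt; case: (C x) => //=.
  by case: (eqVneq (q0 x) n) => [->|_]; rewrite /= ?ltnn ?andbF ?andbT ?orbF.
- by move=> x; case: (eqVneq (t0 x) n) => [->|]; rewrite ?ltnn ?andbF.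
- by move=> x; case: (eqVneq (q0 x) n) => [->|]; rewrite ?ltnn ?andbF.
Qed.

End Split.
End Realize.

(** * From a factor map or approximate conjugacies to a homomorphism *)

Section EasyDirections.
Context {R : realType} {X Y : pseudoPMetricType R}.
Variables (phi : X -> nat -> bool) (psi : Y -> nat -> bool).
Variables (a ai : X -> X) (b bi : Y -> Y).
Hypotheses (cX : coord_space phi) (ha : is_homeo a ai) (ma : minimal_map a).
Hypotheses (cY : coord_space psi) (hb : is_homeo b bi).

Lemma factor_preserves_cobound (F : X -> Y) (c ci : X -> X) (n : X -> int) (x0 : X) :
  continuous F -> is_homeo c ci -> (forall x, c x = zpow a ai (n x) x) ->
  (forall x, x <> x0 -> zcont_at n x) -> (forall x, b (F x) = F (c x)) ->
  forall g, Bset bi g -> Bset ai (g \o F).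
Proof.
move=> cF hc cn nc bF g [f lf ->].
have [_ cci cK ciK] := hc; have [_ _ bK _] := hb.
pose u x := f (F x); have lu : lc u by apply: lc_cont.
(* Normalized so that [h (c x) = u x - u x0] vanishes at [x0]. The coboundary [u - u \o ci] is then
   [h \o c - h]. *)
pose h x := u (ci x) - u x0.
have lh : lc h by apply: (lc_comp1 (fun v => v - u x0)); apply: lc_cont.
have hn x : h (c x) != 0 -> zcont_at n x.
  rewrite /h cK => hx; apply: nc => xx0; move: hx.
  by rewrite xx0 subrr eqxx.
have := K0_piecewise_power cX ha hc cn lh hn; rewrite /K0eq; apply: eq_Bset => x.
rewrite /h cK /= /u.
have -> : bi (F x) = F (ci x) by rewrite -{1}(ciK x) -bF bK.
ring.
Qed.

Lemma factor_hom (F : X -> Y) : continuous F ->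
  (forall g, Bset bi g -> Bset ai (g \o F)) ->
  unital_order_hom ai bi (fun f => f \o F).
Proof.
move=> cF hF; split => //.
- by move=> f lf; exact: (lc_cont cF lf).
- by move=> f g _ _ /hF.
- by move=> f g _ _; apply: K0_eq.
- move=> f lf [h [lh h0] fh]; exists (h \o F); last exact: (hF _ fh).
  by split=> [|x]; [exact: (lc_cont cF lh)|exact: h0].
- exact: K0_eq.
Qed.

(** A Lebesgue number for the partition of Y into the level sets of [h]. *)
Lemma lc_uniform (T : Type) (h : Y -> T) : lc h ->
  exists2 e : R, 0 < e & forall y z, ball y e z -> h y = h z.
Proof.
move=> lh.
suff : \forall e \near (0 : R)^'+, forall y z, ball y e z -> h y = h z.
  move=> hn; have [e [he e0]] := filter_ex (filterI hn (nbhs_right_gt (0 : R))).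
  by exists e.
apply: (compact_near_all cY) => y.
have /nbhs_ballP [e /= e0 he] := lh y.
exists (ball y (e / 2), [set d | d < e / 2]).
  split; first by apply: nbhsx_ballx; rewrite divr_gt0.
  by apply: nbhs_right_lt; rewrite divr_gt0.
move=> [y' d] /= [yy' de] z y'z.
have h1 : h y' = h y by apply: he; apply: le_ball yy'; lra.
rewrite h1; apply/esym/he.
have -> : e = e / 2 + e / 2 by lra.
by apply: ball_triangle yy' _; apply: le_ball y'z; exact: ltW.
Qed.

Lemma approx_conj_hom (s : nat -> X -> Y) (si : nat -> Y -> X) :
  (forall k, is_homeo (s k) (si k)) ->
  (forall e : R, 0 < e ->
     \forall k \near \oo, forall y : Y, ball (b y) e (s k (a (si k y)))) ->
  (forall f : Y -> int, CZ f ->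
     exists N : nat, forall k, (N <= k)%N -> K0eq ai (f \o s k) (f \o s N)) ->
  exists r, unital_order_hom ai bi r.
Proof.
move=> hs hconv hK; have [ca _ aK aiK] := ha; have [_ cbi bK biK] := hb.
have /choice [N hN] : forall f : Y -> int, exists N : nat, CZ f ->
    forall k, (N <= k)%N -> K0eq ai (f \o s k) (f \o s N).
  move=> f; have [cf|ncf] := pselect (CZ f); last by exists 0%N.
  by have [N h] := hK f cf; exists N.
have lcs k f : CZ f -> CZ (f \o s k).
  by move=> lf; case: (hs k) => cs _ _ _; exact: (lc_cont cs lf).
have near_r f : CZ f -> \forall k \near \oo, K0eq ai (f \o s (N f)) (f \o s k).
  by move=> lf; exists (N f) => // k /= h; apply/K0_sym/hN.
have wd f g : K0eq bi f g -> \forall k \near \oo, K0eq ai (f \o s k) (g \o s k).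
  move=> [h lh fg].
  (* Working with [h \o bi] lets closeness of the conjugates to [b] suffice, with no statement about
     their inverses: near [b y] the function [h'] takes the value [h y]. *)
  pose h' y := h (bi y); have lh' : lc h' by apply: lc_cont.
  have [e e0 he] := lc_uniform lh'.
  apply: filterS (hconv e e0) => k hk.
  have [cs _ sK _] := hs k.
  exists (fun x => h' (s k (a x))).
    by apply: (@lc_cont _ _ _ a (fun x => h' (s k x))) => //; apply: lc_cont.
  apply/funext => x; rewrite -[LHS]/((fun y => f y - g y) (s k x)) fg aiK.
  congr (_ - _); have := he _ _ (hk (s k x)); rewrite sK => <-.
  by rewrite /h' bK.
exists (fun f => f \o s (N f)); split.
- by move=> f cf; exact: lcs.
- move=> f g lf lg fg.
  have [k [[h1 h2] h3]] := filter_ex (filterI (filterI (near_r f lf) (near_r g lg)) (wd f g fg)).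
  by apply: K0_trans h1 _; apply: K0_trans h3 _; exact: K0_sym.
- move=> f g lf lg.
  have lfg : CZ (fun y => f y + g y) by apply: (lc_comp2 (fun u v => u + v)).
  have [k [[h1 h2] h3]] := filter_ex (filterI (filterI (near_r f lf) (near_r g lg)) (near_r _ lfg)).
  by apply: K0_trans h3 _; apply: K0D; exact: K0_sym.
- move=> f lf [h [lh h0] fh].
  have [k [h1 h2]] := filter_ex (filterI (near_r f lf) (wd f h fh)).
  exists (h \o s k); first by split=> [|x]; [exact: lcs|exact: h0].
  exact: K0_trans h1 h2.
- exact: K0_eq.
Qed.

End EasyDirections.

(** * Limits of compatible labellings *)

Section Limit.
Context {X Y : topologicalType}.
Variables (psi : Y -> nat -> bool) (t : nat -> X -> nat) (q : nat -> Y -> nat).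
Hypotheses (cY : coord_space psi).
Hypotheses (lt : forall k, lc (t k)) (lq : forall k, lc (q k)).
Hypothesis tq : forall k x, exists y, q k y = t k x.
Hypothesis coh : forall k x y, t k.+1 x = q k.+1 y -> t k x = q k y.
Hypothesis sep : forall y z, (forall k, q k y = q k z) -> y = z.

Lemma labels_coherent j k x y : (j <= k)%N -> t k x = q k y -> t j x = q j y.
Proof.
move=> jk; elim: k jk => [|k IH]; first by rewrite leqn0 => /eqP ->.
by rewrite leq_eqVlt => /orP[/eqP -> //|jk /coh /IH]; apply.
Qed.

Lemma labels_excluded x y k : t k x <> q k y ->
  \forall y' \near y & j \near \oo, t j x <> q j y'.
Proof.
move=> h; exists ([set y' | q k y' = q k y], [set j | (k <= j)%N]).
  by split; [exact: lq|exists k].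
by move=> [y' j] /= [e kj] /(labels_coherent kj); rewrite e.
Qed.

(** The image of [x] is the only point of the nested clopen sets where [q k] equals [t k x].
    Compactness makes their intersection nonempty, and also puts one of these sets into any given
    neighbourhood of the image, which gives continuity. *)
Lemma limit_map : exists2 F : X -> Y, continuous F & forall k x, q k (F x) = t k x.
Proof.
have /choice [F hF] : forall x, exists y, forall k, q k y = t k x.
  move=> x; apply: contrapT => h.
  have : \forall j \near \oo, forall y, t j x <> q j y.
    apply: (compact_near_all cY) => y.
    have [k hk] : exists k, t k x <> q k y.
      by apply/existsNP => h'; apply: h; exists y.
    exact: labels_excluded hk.
  move=> /(@filter_ex _ _ _) [j hj]; have [y hy] := tq j x.
  by apply: (hj y).
exists F => //; move=> x U nU.
have : \forall j \near \oo, forall z, t j x = q j z -> U z.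
  apply: (compact_near_all cY) => z.
  have [e|ze] := pselect (z = F x).
    rewrite e; exists (U, setT); first by split=> //; exact: filterT.
    by move=> [z' j] /= [].
  have [k hk] : exists k, t k x <> q k z.
    by apply/existsNP => h'; apply: ze; apply: sep => k; rewrite hF h'.
  by have := labels_excluded hk; apply: filterS => -[z' j] /= h /h.
move=> /(@filter_ex _ _ _) [j hj].
by apply: filterS (lt j x) => x' e; apply: hj; rewrite -e hF.
Qed.

End Limit.

(** * Homeomorphisms respecting clopen partitions *)

Section Partitions.

Definition same_range {X Y : Type} (t : X -> nat) (q : Y -> nat) : Prop :=
  (forall x, exists y, q y = t x) /\ (forall y, exists x, t x = q y).

(** An atom of X cut in two by [f] needs its counterpart in Y cut into two nonempty clopen parts,
    which is possible because Y has no isolated point. *)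
Lemma refine_step (X Y : topologicalType) (psi : Y -> nat -> bool)
    (t : X -> nat) (q : Y -> nat) (f : X -> bool) :
  coord_space psi -> lc t -> lc q -> same_range t q -> lc f ->
  exists (t' : X -> nat) (q' : Y -> nat), [/\ lc t', lc q', same_range t' q',
    forall x x', t' x = t' x' -> f x = f x' &
    forall x y, t' x = q' y -> t x = q y].
Proof.
move=> cY lt lq [tq qt] lf.
have /choice [H hH] : forall l, exists h : Y -> bool, lc h /\
    forall v : bool, (exists2 x, t x = l & f x = v) <-> (exists2 y, q y = l & h y = v).
  move=> l.
  have [[x1 t1 f1]|n1] := pselect (exists2 x, t x = l & f x = true);
  have [[x0 t0 f0]|n0] := pselect (exists2 x, t x = l & f x = false).
  - have [y qy] := tq x1; rewrite t1 in qy.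
    have [||z /eqP qz zy] := @coord_perfect _ _ cY (fun z => q z == l) y.
    + exact: lc_eq.
    + by rewrite qy.
    have [k hk] := filter_ex (cyl_sep cY zy).
    exists (cyl psi y k); split; first exact: lc_cyl.
    case; split=> _.
    + by exists y => //; exact: cyl_refl.
    + by exists x1.
    + by exists z => //; exact: negbTE.
    + by exists x0.
  - exists (fun _ => true); split; first exact: lc_cst.
    case; split=> -[z qz e] //.
    + by have [y hy] := tq z; exists y; rewrite ?hy.
    + by exists x1.
    + by case: n0; exists z.
  - exists (fun _ => false); split; first exact: lc_cst.
    case; split=> -[z qz e] //.
    + by case: n1; exists z.
    + by have [y hy] := tq z; exists y; rewrite ?hy.
    + by exists x0.
  - exists (fun _ => false); split; first exact: lc_cst.
    case; split=> -[z qz e] //.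
    + by case: n1; exists z.
    + by case: n0; exists z.
    + have [x tx] := qt z; case fx: (f x).
        by case: n1; exists x; rewrite ?tx.
      by case: n0; exists x; rewrite ?tx.
pose h y := H (q y) y.
have lh : lc h by apply: (@lc_dep _ _ _ H) => // l; case: (hH l).
(* The new label is twice the old one plus the bit of the cut. *)
pose e (l : nat) (v : bool) := (l.*2 + v)%N.
have einj l v l' v' : e l v = e l' v' -> l = l' /\ v = v'.
  by rewrite /e => ee; split; [lia|case: v v' ee => -[]; lia].
exists (fun x => e (t x) (f x)), (fun y => e (q y) (h y)); split.
- exact: (lc_comp2 e).
- exact: (lc_comp2 e).
- split=> [x|y].
    have [y qy hy] := ((hH (t x)).2 (f x)).1 (ex_intro2 _ _ x erefl erefl).
    by exists y; rewrite /h qy hy.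
  have [x tx fx] := ((hH (q y)).2 (h y)).2 (ex_intro2 _ _ y erefl erefl).
  by exists x; rewrite tx fx.
- by move=> x x' /einj [].
- by move=> x y /einj [].
Qed.

Lemma same_range_sym (X Y : Type) (t : X -> nat) (q : Y -> nat) :
  same_range t q -> same_range q t.
Proof. by case=> h1 h2; split. Qed.

(** A back-and-forth: step [k] refines by the [k]-th coordinate of X and then by that of Y. The
    labels end up separating points on both sides, so the limit maps in the two directions are
    mutually inverse. *)
Lemma partition_homeo (X Y : topologicalType) (phi : X -> nat -> bool)
    (psi : Y -> nat -> bool) (t : X -> nat) (q : Y -> nat) :
  coord_space phi -> coord_space psi -> lc t -> lc q -> same_range t q ->
  exists (s : X -> Y) (si : Y -> X), is_homeo s si /\ forall x, q (s x) = t x.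
Proof.
move=> cX cY lt lq sr.
pose S := {tq : (X -> nat) * (Y -> nat) | [/\ lc tq.1, lc tq.2 & same_range tq.1 tq.2]}.
have step (k : nat) (s : S) : {s' : S |
   [/\ forall x x', (sval s').1 x = (sval s').1 x' -> phi x k = phi x' k,
       forall y y', (sval s').2 y = (sval s').2 y' -> psi y k = psi y' k &
       forall x y, (sval s').1 x = (sval s').2 y -> (sval s).1 x = (sval s).2 y]}.
  apply: cid; case: s => -[t0 q0] /= [lt0 lq0 sr0].
  have [t1 [q1 [lt1 lq1 sr1 f1 c1]]] := refine_step cY lt0 lq0 sr0 (coord_lc cX k).
  have [q2 [t2 [lq2 lt2 sr2 f2 c2]]] :=
    refine_step cX lq1 lt1 (same_range_sym sr1) (coord_lc cY k).
  exists (exist _ (t2, q2) (And3 lt2 lq2 (same_range_sym sr2))) => /=.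
  split=> //.
    move=> x x' e; apply: f1; have [y hy] := sr2.2 x.
    by rewrite -(c2 _ _ hy) -(c2 y x') // -e.
  by move=> x y e; apply: c1; apply/esym/c2.
pose s0 : S := exist _ (t, q) (And3 lt lq sr).
pose fix st (k : nat) : S := if k is k'.+1 then sval (step k' (st k')) else s0.
pose tk k := (sval (st k)).1; pose qk k := (sval (st k)).2.
have lcs k : [/\ lc (tk k), lc (qk k) & same_range (tk k) (qk k)].
  by rewrite /tk /qk; case: (st k).
have stp k := svalP (step k (st k)).
have [s cs hs] : exists2 F : X -> Y, continuous F & forall k x, qk k (F x) = tk k x.
  apply: (limit_map cY).
  - by move=> k; case: (lcs k).
  - by move=> k; case: (lcs k).
  - by move=> k x; case: (lcs k) => _ _ [].
  - by move=> k x y e; case: (stp k) => _ _; apply.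
  - move=> y z e; apply: (coord_inj cY); apply/funext => k.
    by case: (stp k) => _ h _; exact: (h _ _ (e k.+1)).
have [si csi hsi] : exists2 F : Y -> X, continuous F & forall k x, tk k (F x) = qk k x.
  apply: (limit_map cX).
  - by move=> k; case: (lcs k).
  - by move=> k; case: (lcs k).
  - by move=> k x; case: (lcs k) => _ _ [].
  - by move=> k x y e; case: (stp k) => _ _ h; apply/esym/h.
  - move=> y z e; apply: (coord_inj cX); apply/funext => k.
    by case: (stp k) => h _ _; exact: (h _ _ (e k.+1)).
exists s, si; split; last exact: (hs 0%N).
split=> // z.
  apply: (coord_inj cX); apply/funext => k.
  by case: (stp k) => h _ _; apply: h; rewrite -[LHS]/(tk k.+1 _) hsi hs.
apply: (coord_inj cY); apply/funext => k.
by case: (stp k) => _ h _; apply: h; rewrite -[LHS]/(qk k.+1 _) hs hsi.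
Qed.

End Partitions.

(** * Kakutani-Rokhlin labellings *)

(** The atoms are named by numbers and the towers stay implicit. Each atom lies on a single level,
    and below the top [b] induces an injective map of labels. *)
Record KR {Y : topologicalType} (b : Y -> Y) (B : Y -> bool) (q : Y -> nat) : Prop := {
  kr_lc : lc q;
  kr_base : forall y z, q y = q z -> B y = B z;
  kr_top : forall y z, q y = q z -> B (b y) = B (b z);
  kr_succ : forall y z, ~~ B (b y) -> ~~ B (b z) -> q y = q z <-> q (b y) = q (b z)
}.

(** A label records the height of the point and the [g]-name of its whole segment; the length of the
    name is the height of the tower. *)
Lemma KR_exists (Y : topologicalType) (b bi : Y -> Y) (B : Y -> bool) (g : Y -> nat) :
  is_homeo b bi -> lc B -> recurrent b bi B -> lc g ->
  exists2 q, KR b B q & forall y z, q y = q z -> g y = g z.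
Proof.
move=> hb lB rB lg.
pose w y := [seq g (iter j b (base bi B y)) | j <- iota 0 (ht b bi B y)].
have lw : lc w.
  apply: (@lc_dep _ _ _ (fun k y => [seq g (iter j b (base bi B y)) | j <- iota 0 k])
            (ht b bi B)); last exact: (lc_ht hb lB rB).
  move=> k; apply: (@lc_map _ _ _ (fun j y => g (iter j b (base bi B y)))) => j.
  apply: (lc_at_base hb lB rB (f := fun y => g (iter j b y))).
  by apply: lc_iter => //; case: hb.
have sw y : size (w y) = ht b bi B y by rewrite size_map size_iota.
pose q y := pickle (pos bi B y, w y).
have qP y z : q y = q z <-> pos bi B y = pos bi B z /\ w y = w z.
  split=> [|[h1 h2]]; last by rewrite /q h1 h2.
  by move=> /(pcan_inj pickleK) e; split; [exact: (congr1 fst e)|exact: (congr1 snd e)].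
have B0 y : B y = (pos bi B y == 0%N).
  by apply/idP/eqP => [/(pos_V bi)|/(pos0V rB)].
exists q; last first.
  move=> y z /qP [p e].
  have gw u : g u = nth 0%N (w u) (pos bi B u).
    rewrite (nth_map 0%N) ?size_iota ?(pos_lt_ht rB) // nth_iota ?(pos_lt_ht rB) //.
    by rewrite add0n (iter_base rB).
  by rewrite !gw p e.
split.
- apply: (lc_comp2 (fun u v => pickle (u, v))) => //; exact: (lc_pos hb lB rB).
- by move=> y z /qP [p _]; rewrite !B0 p.
- by move=> y z /qP [p e]; rewrite !(V_next rB) p -!sw e.
- move=> y z ny nz; rewrite !qP !(pos_step rB) // /w /ht !(base_step rB) //.
  by split=> -[h1 h2]; split=> //; [rewrite h1|case: h1].
Qed.

Section KRTheory.
Context {Y : topologicalType}.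
Variables (b bi : Y -> Y) (B : Y -> bool) (q : Y -> nat).
Hypotheses (rB : recurrent b bi B) (kq : KR b B q).

Lemma KR_up y z j : q y = q z -> (forall i, (i < j)%N -> ~~ B (iter i.+1 b z)) ->
  q (iter j b y) = q (iter j b z) /\ (forall i, (i < j)%N -> ~~ B (iter i.+1 b y)).
Proof.
move=> e; elim: j => [|j IH] h //.
have [e' h'] := IH (fun i ij => h i (ltnW ij)).
have nz := h j (ltnSn j).
have ny : ~~ B (iter j.+1 b y) by rewrite /= (kr_top kq e').
split; first by apply: (kr_succ kq ny nz).1.
by move=> i; rewrite ltnS leq_eqVlt => /orP[/eqP -> //|/h'].
Qed.

Lemma KR_down y z : q y = q z ->
  pos bi B y = pos bi B z /\ q (base bi B y) = q (base bi B z).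
Proof.
move: {2}(pos bi B z) (erefl (pos bi B z)) => j.
elim: j y z => [|j IH] y z pz e.
  have Bz := pos0V rB pz; have By : B y by rewrite (kr_base kq e).
  by rewrite pz !base_V // pos_V.
have nz : ~~ B z by apply/negP => /(pos_V bi); rewrite pz.
have ny : ~~ B y by rewrite (kr_base kq e).
have e' : q (bi y) = q (bi z).
  have hy : ~~ B (b (bi y)) by rewrite (rec_canV rB).
  have hz : ~~ B (b (bi z)) by rewrite (rec_canV rB).
  by apply: (kr_succ kq hy hz).2; rewrite !(rec_canV rB).
have [||p e2] := IH (bi y) (bi z) => //.
  by have := pos_ai rB nz; rewrite pz => -[].
by rewrite (pos_ai rB ny) (pos_ai rB nz) p -(base_ai rB ny) -(base_ai rB nz).
Qed.

Lemma KR_level y z j : (j < ht b bi B z)%N -> B z ->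
  (q (iter j b y) == q (iter j b z)) = (q y == q z).
Proof.
move=> jh Bz; have zb := base_V bi Bz.
have [hz1 hz2] := base_iter rB jh; rewrite zb in hz1 hz2.
have h0 i : (i < j)%N -> ~~ B (iter i.+1 b z).
  move=> ij; rewrite -{1}zb; apply: (htP rB z).2 => //=.
  exact: leq_ltn_trans ij jh.
apply/eqP/eqP => [e|e]; last by have [] := KR_up e h0.
have [p] := KR_down e; rewrite hz2 => <-; congr q.
by rewrite /base p hz1 (iterK j (rec_can rB)).
Qed.

End KRTheory.

(** * Cutting segments into blocks *)

Lemma size_sum_count (N : nat) (s : seq nat) : all (fun l => l < N)%N s ->
  size s = (\sum_(l < N) count_mem (l : nat) s)%N.
Proof.
elim: s => [|x s IH] /=; first by rewrite big1.
case/andP => xN /IH ->; rewrite big_split /=.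
have -> : (\sum_(i < N) (x == i :> nat) = 1)%N; last by rewrite add1n.
rewrite (bigD1 (Ordinal xN)) //= eqxx big1 ?addn0 // => i ix.
by apply/eqP; rewrite eqb0; apply: contra ix => /eqP e; apply/eqP/val_inj.
Qed.

Lemma sumn_delta (s : seq nat) (F : nat -> nat) i : uniq s -> i \in s ->
  sumn [seq (F l * (l == i))%N | l <- s] = F i.
Proof.
elim: s => // x s IH /= /andP[xs us]; rewrite inE => /orP[/eqP ->|si].
  rewrite eqxx muln1; suff -> : sumn [seq (F l * (l == x))%N | l <- s] = 0%N by rewrite addn0.
  elim: s xs {IH us} => //= y s IH; rewrite inE negb_or => /andP[xy /IH ->].
  by rewrite eq_sym (negbTE xy) muln0.
rewrite IH //; case: eqP => [e|_]; last by rewrite muln0.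
by rewrite e si in xs.
Qed.

Section Blocks.
Variables (isbase istop : nat -> Prop) (next : nat -> nat -> Prop).
Hypothesis top_base : forall l l', istop l -> isbase l' -> next l l'.

Definition blocky (s : seq nat) : Prop := forall j, (j < size s)%N ->
  [/\ j = 0%N -> isbase (nth 0%N s j),
      (j.+1 < size s)%N -> next (nth 0%N s j) (nth 0%N s j.+1) &
      j.+1 = size s -> istop (nth 0%N s j)].

Lemma blocky_cat s1 s2 : blocky s1 -> blocky s2 -> blocky (s1 ++ s2).
Proof.
move=> h1 h2 j; rewrite size_cat !nth_cat => js.
have [j1|j1] := ltnP j (size s1).
  have [b1 n1 t1] := h1 j j1; split=> //.
    move=> j2; have [j3|j3] := ltnP j.+1 (size s1); first exact: n1.
    have e : j.+1 = size s1 by apply/eqP; rewrite eqn_leq j1 j3.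
    rewrite -e subnn; apply: top_base; first exact: t1.
    have s20 : (0 < size s2)%N by lia.
    by have [h _ _] := h2 0%N s20; apply: h.
  move=> e; apply: t1; lia.
have js2 : (j - size s1 < size s2)%N by lia.
have [b2 n2 t2] := h2 _ js2; split.
- by move=> j0; apply: b2; lia.
- move=> j2; rewrite ltnNge (leqW j1) /= subSn //; apply: n2; lia.
- move=> e; apply: t2; lia.
Qed.

Lemma blocky_flatten ss : (forall s, s \in ss -> blocky s) -> blocky (flatten ss).
Proof.
elim: ss => [|s ss IH] h //=; apply: blocky_cat; first by apply: h; rewrite inE eqxx.
by apply: IH => s' hs'; apply: h; rewrite inE hs' orbT.
Qed.

End Blocks.

(** * Copying the towers of Y into X *)

Section CutTowers.
Context {X Y : topologicalType}.
Variables (phi : X -> nat -> bool) (psi : Y -> nat -> bool).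
Variables (a ai : X -> X) (b bi : Y -> Y) (r : (Y -> int) -> (X -> int)).
Hypotheses (cX : coord_space phi) (ha : is_homeo a ai) (ma : minimal_map a).
Hypotheses (cY : coord_space psi) (hb : is_homeo b bi) (mb : minimal_map b).
Hypothesis hr : unital_order_hom ai bi r.
Variables (pt : X) (ptY : Y).

Lemma cls_same_range (t : X -> nat) (q : Y -> nat) : lc t -> lc q ->
  (forall l, cls ai r (fun x => t x == l) (fun y => q y == l)) -> same_range t q.
Proof.
move=> lt lq h; split=> [x|y].
  have [||y /eqP e] := cls_exY cX ha ma hr (x := x) _ (h (t x)).
  - exact: lc_eq.
  - by rewrite eqxx.
  by exists y.
have [||x /eqP e] := cls_exX cX ha ma cY hb mb hr pt (y := y) _ (h (q y)).
- exact: lc_eq.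
- by rewrite eqxx.
by exists x.
Qed.

Variables (B : Y -> bool) (q : Y -> nat).
Hypotheses (lB : lc B) (rB : recurrent b bi B) (kq : KR b B q).

Let lq : lc q := kr_lc kq.
Let f (l : nat) : X -> int := r (ind (fun y => q y == l)).

Let lind l : lc (ind (fun y => q y == l)).
Proof. by apply: lc_ind; exact: lc_eq. Qed.

Let lf l : lc (f l).
Proof. by case: hr => h _ _ _ _; apply: h; exact: lind. Qed.

Lemma label_level y z j : (j < ht b bi B z)%N -> B z -> q y = q (iter j b z) ->
  K0eq ai (f (q y)) (f (q z)).
Proof.
move=> jh Bz e; apply: K0_sym; apply: K0_trans (hom_shift hb hr j (lind (q y))).
apply: K0_eq => x; rewrite /f; congr (r _ x); apply/funext => u.
by rewrite /ind e (KR_level rB kq u jh Bz).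
Qed.

Lemma label_base y : K0eq ai (f (q y)) (f (q (base bi B y))).
Proof.
apply: (@label_level y (base bi B y) (pos bi B y)).
- by rewrite (ht_base rB) (pos_lt_ht rB).
- exact: V_base rB _.
- by rewrite (iter_base rB).
Qed.

(** Below the top the next label is forced; a top label may be followed by any base label. This
    freedom is the whole error of the approximate conjugacy. *)
Definition adjacent (l l' : nat) : Prop := forall y, q y = l ->
  if B (b y) then exists2 z, B z & q z = l' else l' = q (b y).

Lemma cut_towers : exists t : X -> nat, [/\ lc t,
  forall l, cls ai r (fun x => t x == l) (fun y => q y == l) &
  forall x, adjacent (t x) (t (a x))].
Proof.
have [N hN] := lc_bounded cY lq.
pose isb l := exists2 y, B y & q y = l.
pose ist l := exists2 y, B (b y) & q y = l.
have /choice [rep hrep] : forall l, exists y, isb l -> B y /\ q y = l.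
  move=> l; have [[y By qy]|n] := pselect (isb l); first by exists y.
  by exists ptY.
pose bl := [seq l <- iota 0 N | `[< isb l >] ].
have bl_uniq : uniq bl by rewrite filter_uniq // iota_uniq.
have blP l : l \in bl -> isb l by rewrite mem_filter => /andP[/asboolP].
have mem_bl y : B y -> q y \in bl.
  move=> By; rewrite mem_filter mem_iota /= add0n hN andbT.
  by apply/asboolP; exists y.
pose word l := [seq q (iter j b (rep l)) | j <- iota 0 (ht b bi B (rep l))].
have word_uniq l : l \in bl -> uniq (word l).
  move=> /blP /hrep [Bl ql]; rewrite map_inj_in_uniq ?iota_uniq // => i j.
  rewrite !mem_iota !add0n /= => ih jh e.
  have [pij _] := KR_down rB kq e; have rl := base_V bi Bl.
  have [] := base_iter rB ih; have [] := base_iter rB jh.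
  by rewrite rl -pij => -> _ -> _.
have mem_word l y : l \in bl -> (q y \in word l) = (l == q (base bi B y)).
  move=> lbl; have [Bl ql] := hrep _ (blP _ lbl); have rl := base_V bi Bl.
  apply/mapP/eqP => [[j]|e].
    rewrite mem_iota add0n /= => jh e.
    have [_ ->] := KR_down rB kq e.
    by have [_] := base_iter rB jh; rewrite rl => ->.
  have e' : q (base bi B y) = q (rep l) by rewrite ql e.
  have Bb := V_base rB y.
  have hts : ht b bi B (rep l) = ht b bi B y.
    have h0 i : (i < (ht b bi B y).-1)%N -> ~~ B (iter i.+1 b (base bi B y)).
      move=> ih; apply: (htP rB y).2 => /=; have := ht_gt0 b bi B y; lia.
    have [e1 h1] := KR_up kq (esym e') h0.
    have := (htP rB y).1; rewrite -{1}(prednK (ht_gt0 b bi B y)) /= -(kr_top kq e1) => h2.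
    rewrite /ht rl -[RHS](prednK (ht_gt0 b bi B y)); congr _.+1.
    by apply: first_unique.
  exists (pos bi B y); first by rewrite mem_iota add0n hts /= (pos_lt_ht rB).
  rewrite -{1}(iter_base rB y); apply/eqP.
  by rewrite (KR_level rB kq) ?hts ?(pos_lt_ht rB) // e'.
have F1 : K0eq ai (fun x => \sum_(l < N) f l x) (fun _ => 1).
  apply: K0_trans (hom1 hr); apply: K0_sym.
  apply: K0_trans (hom_sum hr N lind); apply: K0_eq => x; congr (r _ x).
  apply/funext => y; rewrite (bigD1 (Ordinal (hN y))) //= {1}/ind eqxx big1 ?addr0 // => i ix.
  rewrite /ind; case: eqP => // e; case/eqP: ix; exact/val_inj.
have F3 l : K0pos ai (f l) by apply: (hom_pos hr (lind l)); exact: ind_ge0.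
have F4 l : ~ (exists y, q y = l) -> K0eq ai (f l) (fun _ => 0).
  move=> nl; apply: K0_trans (hom0 hr); apply: K0_eq => x; congr (r _ x).
  by apply/funext => y; rewrite /ind; case: eqP => // e; case: nl; exists y.
(* The label at the bottom of the tower to which the label [l] belongs. *)
pose bs l : nat := xget 0%N [set i | exists2 y, q y = l & i = q (base bi B y)].
have bsP y : bs (q y) = q (base bi B y).
  rewrite /bs; case: xgetP => [i _ [z qz ->]|]; first by have [_] := KR_down rB kq qz.
  by move=> /(_ (q (base bi B y))) []; exists y.
have : \forall k \near \oo,
   [/\ forall x, stot a ai (cyl phi pt k) (fun x => \sum_(l < N) f l x) x =
          stot a ai (cyl phi pt k) (fun _ => 1) x,
       forall l, (l < N)%N -> forall x, 0 <= stot a ai (cyl phi pt k) (f l) x,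
       forall l, (l < N)%N -> ~ (exists y, q y = l) ->
          forall x, stot a ai (cyl phi pt k) (f l) x = 0 &
       forall l, (l < N)%N -> (exists y, q y = l) ->
          forall x, stot a ai (cyl phi pt k) (f l) x = stot a ai (cyl phi pt k) (f (bs l)) x].
  have n1 := stot_K0eq cX ha ma pt F1.
  have n2 : \forall k \near \oo, forall l, (l < N)%N ->
      forall x, 0 <= stot a ai (cyl phi pt k) (f l) x.
    by apply: near_forall_ltn => l; exact: (stot_K0pos cX ha ma pt (F3 l)).
  have n3 : \forall k \near \oo, forall l, (l < N)%N -> ~ (exists y, q y = l) ->
          forall x, stot a ai (cyl phi pt k) (f l) x = 0.
    apply: near_forall_ltn => l.
    have [h|h] := pselect (exists y, q y = l); first by apply: nearW.
    apply: filterS (stot_K0eq cX ha ma pt (F4 l h)) => k hk _ x.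
    by rewrite hk stot0.
  have n4 : \forall k \near \oo, forall l, (l < N)%N -> (exists y, q y = l) ->
      forall x, stot a ai (cyl phi pt k) (f l) x = stot a ai (cyl phi pt k) (f (bs l)) x.
    apply: near_forall_ltn => l.
    have [[y qy]|h] := pselect (exists y, q y = l); last by apply: nearW.
    have := label_base y; rewrite -bsP qy => /(stot_K0eq cX ha ma pt).
    by apply: filterS => k hk _ x; rewrite hk.
  by apply: filterS (filterI (filterI n1 n2) (filterI n3 n4)) => k [[? ?] [? ?]].
move=> /(@filter_ex _ _ _) [k [S1 S2 S3 S4]].
set V := cyl phi pt k in S1 S2 S3 S4.
have lV : lc V := lc_cyl cX pt k.
have rV : recurrent a ai V := recurrent_cyl cX ha ma pt k.
pose m l x := `|stot a ai V (f l) x|%N.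
have lm l : lc (m l).
  by apply: (lc_comp1 absz); exact: (lc_stot ha lV rV).
(* The segment of [x] is spelled with [m l x] copies of the tower over each base label [l]. Any
   order would do, since every top may precede every base. *)
pose W x := flatten [seq flatten (nseq (m l x) (word l)) | l <- bl].
have lW : lc W.
  apply: (lc_comp1 flatten).
  apply: (@lc_map _ _ _ (fun l x => flatten (nseq (m l x) (word l)))) => l.
  exact: (lc_comp1 (fun n => flatten (nseq n (word l)))).
have Wbase x x' : base ai V x = base ai V x' -> W x = W x'.
  move=> e; rewrite /W; congr flatten; apply: eq_map => l.
  by rewrite /m (stot_base _ _ e).
have countW l x : count_mem l (W x) = sumn [seq (m i x * count_mem l (word i))%N | i <- bl].
  rewrite /W count_flatten -map_comp; congr sumn; apply: eq_map => i /=.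
  by rewrite count_flatten map_nseq sumn_nseq mulnC.
have countl y x : count_mem (q y) (W x) = m (q y) x.
  rewrite countW.
  have -> : [seq (m i x * count_mem (q y) (word i))%N | i <- bl] =
            [seq (m i x * (i == bs (q y)))%N | i <- bl].
    apply/eq_in_map => i ibl; rewrite count_uniq_mem ?word_uniq //.
    by rewrite mem_word // bsP.
  rewrite (@sumn_delta _ (m^~ x)) //; last by rewrite bsP mem_bl // (V_base rB).
  by rewrite /m (S4 (q y)) //; exists y.
have mem_W l x : l \in W x -> exists y, q y = l.
  case/flattenP => s /mapP [i _ ->] /flattenP [s' /nseqP [-> _]] /mapP [j _ ->].
  by eexists.
have count0 l x : ~ (exists y, q y = l) -> count_mem l (W x) = 0%N.
  by move=> h; apply/eqP; rewrite -leqn0 leqNgt -has_count has_pred1; apply/negP => /mem_W.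
have countm l x : (l < N)%N -> count_mem l (W x) = m l x.
  move=> lN; have [[y <-]|h] := pselect (exists y, q y = l); first exact: countl.
  by rewrite count0 // /m S3.
(* The word fills the segment exactly because the classes of all labels add up to the unit. *)
have sizeW x : size (W x) = ht a ai V x.
  rewrite (@size_sum_count N); last by apply/allP => l /mem_W [y <-]; exact: hN.
  have := S1 x; rewrite (@stot_sum _ _ _ _ _ N f) [RHS]/stot sumr_const card_ord => e.
  apply/eqP; rewrite -(eqr_nat int) -e natr_sum; apply/eqP; apply: eq_bigr => l _.
  by rewrite countm // /m natz gez0_abs // S2.
pose t x := nth 0%N (W x) (pos ai V x).
have lt : lc t.
  by apply: (lc_comp2 (fun w j => nth 0%N w j)) => //; exact: (lc_pos ha lV rV).
have titer x j : (j < ht a ai V x)%N -> t (iter j a (base ai V x)) = nth 0%N (W x) j.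
  move=> jh; have [pj bj] := base_iter rV jh.
  by rewrite /t pj (Wbase _ _ bj).
exists t; split=> //.
  move=> l; have [[y yl]|nl] := pselect (exists y, q y = l); last first.
    apply: (cls_empty hr) => [x|y]; apply/negP => /eqP e; apply: nl; last by exists y.
    by apply: (mem_W _ x); rewrite -e mem_nth // sizeW (pos_lt_ht rV).
  apply: (K0eq_stot cX ha ma lV (cyl_refl phi pt k)).
  - by apply: lc_ind; exact: lc_eq.
  - exact: lf.
  move=> x.
  have -> : stot a ai V (ind (fun x => t x == l)) x = (count_mem l (W x))%:R.
    rewrite /stot -sum1_count (big_nth 0%N) natr_sum big_mkord sizeW [RHS]big_mkcond /=.
    by apply: eq_bigr => j _; rewrite /ind titer // /=; case: eqP.
  have lN : (l < N)%N by rewrite -yl hN.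
  by rewrite countm // /m natz gez0_abs // S2.
have block x : blocky isb ist adjacent (W x).
  have tb l l' : ist l -> isb l' -> adjacent l l'.
    by move=> [y By qy] [z Bz qz] u qu; rewrite (kr_top kq (z := y)) ?qu // By; exists z.
  apply: (blocky_flatten tb) => s /mapP [l lbl ->].
  apply: (blocky_flatten tb) => s' /nseqP [-> _].
  have [Bl ql] := hrep _ (blP _ lbl); have rl := base_V bi Bl.
  move=> j; rewrite size_map size_iota => jh.
  have nw i : (i < ht b bi B (rep l))%N -> nth 0%N (word l) i = q (iter i b (rep l)).
    by move=> ih; rewrite (nth_map 0%N) ?size_iota // nth_iota.
  rewrite nw //; split.
  - by move=> -> /=; exists (rep l).
  - move=> jh2 u qu; rewrite nw // (kr_top kq qu) -[b _]/(iter j.+1 b (rep l)).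
    have nB : ~~ B (iter j.+1 b (rep l)) by rewrite -rl; apply: (htP rB _).2.
    rewrite (negbTE nB); apply/esym.
    by apply: (kr_succ kq _ nB).1 => //; rewrite (kr_top kq qu).
  - move=> e; exists (iter j b (rep l)) => //.
    by have := (htP rB (rep l)).1; rewrite -e rl.
move=> x; rewrite {2}/t (pos_a rV).
have pW x' : (pos ai V x' < size (W x'))%N by rewrite sizeW (pos_lt_ht rV).
have [_ h2 h3] := block x _ (pW x).
have [Vax|nVax] := boolP (V (a x)).
  have e : (pos ai V x).+1 = size (W x) by rewrite sizeW; apply/eqP; rewrite -(V_next rV).
  have [y By qy] := h3 e; have W0 : (0 < size (W (a x)))%N by rewrite sizeW.
  have [h1 _ _] := block (a x) 0%N W0.
  by move=> u qu; rewrite (kr_top kq (z := y)) ?qu // By; exact: h1.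
rewrite (Wbase (a x) x) ?(base_step rV) //; apply: h2.
by rewrite sizeW ltn_neqAle (pos_lt_ht rV) andbT -(V_next rV).
Qed.

End CutTowers.

(** * Approximate conjugacies *)

Section ApproxConj.
Context {R : realType} {X Y : pseudoPMetricType R}.
Variables (phi : X -> nat -> bool) (psi : Y -> nat -> bool).
Variables (a ai : X -> X) (b bi : Y -> Y) (r : (Y -> int) -> (X -> int)).
Hypotheses (cX : coord_space phi) (ha : is_homeo a ai) (ma : minimal_map a).
Hypotheses (cY : coord_space psi) (hb : is_homeo b bi) (mb : minimal_map b).
Hypothesis hr : unital_order_hom ai bi r.

Lemma homZ (k : int) f : lc f -> K0eq ai (r (fun y => k * f y)) (fun x => k * r f x).
Proof.
move=> lf.
have hn (n : nat) : K0eq ai (r (fun y => n%:R * f y)) (fun x => n%:R * r f x).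
  have -> : (fun y => n%:R * f y) = (fun y => \sum_(i < n) f y).
    by apply/funext => y; rewrite sumr_const card_ord mulr_natl.
  have -> : (fun x => n%:R * r f x) = (fun x => \sum_(i < n) r f x).
    by apply/funext => y; rewrite sumr_const card_ord mulr_natl.
  exact: (@hom_sum _ _ _ _ _ hr n (fun _ => f)).
case: k => n; first by have := hn n; rewrite natz.
have -> : (fun y => Negz n * f y) = (fun y => 0 - n.+1%:R * f y).
  by apply/funext => y; rewrite NegzE -natz; ring.
have -> : (fun x => Negz n * r f x) = (fun x => 0 - n.+1%:R * r f x).
  by apply/funext => y; rewrite NegzE -natz; ring.
apply: K0_trans (homB hr (lc_cst _) _) _; first exact: (lc_comp1 (fun u => n.+1%:R * u)).
by apply: K0B => //; exact: hom0 hr.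
Qed.

Lemma coord_fine (e : R) : 0 < e ->
  \forall k \near \oo, forall y z : Y, cyl psi y k z -> ball y e z.
Proof.
move=> e0; apply: (compact_near_all cY) => y.
have nb : \forall z \near y, ball y (e / 2) z by apply: nbhsx_ballx; rewrite divr_gt0.
have [K hK] := filter_ex (cyl_near cY nb).
exists ([set z | cyl psi y K z], [set k | (K <= k)%N]).
  by split; [apply: filterS (lc_cyl cY y K y) => z /= ->; exact: cyl_refl|exists K].
move=> [y' k] /= [yy' Kk] z y'z.
have yz : cyl psi y K z.
  apply/cylP => i iK; have /cylP h1 := yy'; have /cylP h2 := y'z.
  by rewrite h2 ?h1 //; exact: leq_trans Kk.
have -> : e = e / 2 + e / 2 by lra.
by apply: (@ball_triangle _ _ y); [apply: ball_sym; exact: hK|exact: hK].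
Qed.

(** Two points of one atom of [q], or two points of [B], are within [e]. Off the top, [s (a (si y))]
    and [b y] have the same label; at the top both lie in [B]. A function constant at scale [e] is a
    combination of indicators of labels, whose classes are right by construction. *)
Lemma approx_conj_stage (e : R) : 0 < e -> exists (s : X -> Y) (si : Y -> X),
  [/\ is_homeo s si, forall y, ball (b y) e (s (a (si y))) &
   forall f : Y -> int, lc f -> (forall y z, ball y e z -> f y = f z) ->
     K0eq ai (f \o s) (r f)].
Proof.
move=> e0; have [k hk] := filter_ex (coord_fine e0).
pose B := cyl psi (point : Y) k.
have lB : lc B := lc_cyl cY _ k.
have rB : recurrent b bi B := recurrent_cyl cY hb mb _ k.
pose g y := pickle [seq psi y i | i <- iota 0 k].
have lg : lc g by apply: (lc_comp1 pickle); apply: lc_map => i; exact: coord_lc.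
have gP y z : g y = g z -> ball y e z.
  move=> /(pcan_inj pickleK) /eq_in_map h; apply: hk; apply/cylP => i ik.
  by apply/esym/h; rewrite mem_iota.
have [q kq qg] := KR_exists hb lB rB lg.
have lq := kr_lc kq.
have [t [lt clt adj]] := cut_towers cX ha ma cY hb hr (point : X) (point : Y) rB kq.
have sr := cls_same_range cX ha ma cY hb mb hr (point : X) lt lq clt.
have [s [si [hs qs]]] := partition_homeo cX cY lt lq sr.
have [cs csi sK siK] := hs.
exists s, si; split=> //.
  move=> y; have := adj (si y) y; rewrite -!qs siK => /(_ erefl).
  case: ifP => [By [z Bz qz]|_ h]; last by apply/gP/qg.
  have /cylP h1 : B (s (a (si y))) by rewrite -(kr_base kq qz).
  have /cylP h2 := By.
  by apply: hk; apply/cylP => i ik; rewrite h1 ?h2.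
move=> f lf fe.
have fq y z : q y = q z -> f y = f z by move=> /qg /gP /fe.
pose F (l : nat) : int := xget 0 [set v | exists2 y, q y = l & f y = v].
have FP y : F (q y) = f y.
  rewrite /F; case: xgetP => [v _ [z qz <-]|]; first exact: fq.
  by move=> /(_ (f y)) []; exists y.
have [N hN] := lc_bounded cY lq.
have sumF (Z : Type) (u : Z -> nat) z : (u z < N)%N ->
    F (u z) = \sum_(l < N) F l * ind (fun z => u z == l) z.
  move=> uN; rewrite (bigD1 (Ordinal uN)) //= {1}/ind eqxx mulr1 big1 ?addr0 // => i iu.
  rewrite /ind; case: eqP => [h|_]; last by rewrite mulr0.
  by case/eqP: iu; exact/val_inj.
have lind l : lc (ind (fun y => q y == l)) by apply: lc_ind; exact: lc_eq.
have -> : f \o s = (fun x => \sum_(l < N) F l * ind (fun x => t x == l) x).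
  by apply/funext => x /=; rewrite -FP qs sumF // -qs hN.
have -> : f = (fun y => \sum_(l < N) F l * ind (fun y => q y == l) y).
  by apply/funext => y; rewrite -FP sumF // hN.
apply: K0_trans; last first.
  apply: K0_sym; apply: (@hom_sum _ _ _ _ _ hr N (fun l y => F l * ind (fun y => q y == l) y)) => l.
  exact: (lc_comp1 (fun u => F l * u)).
apply: (@K0_sum _ ai _ (fun l x => F l * ind (fun x => t x == l) x)
  (fun l => r (fun y => F l * ind (fun y => q y == l) y))) => l _.
by apply: K0_trans (K0_sym (homZ _ (lind l))); apply: K0Z; exact: clt.
Qed.

Lemma hom_approx_conj : exists (s : nat -> X -> Y) (si : nat -> Y -> X),
  [/\ (forall k, is_homeo (s k) (si k)),
      (forall e : R, 0 < e ->
         \forall k \near \oo, forall y : Y, ball (b y) e (s k (a (si k y)))) &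
      (forall f : Y -> int, CZ f -> exists N : nat, forall k, (N <= k)%N ->
         K0eq ai (f \o s k) (f \o s N))].
Proof.
have /choice [p hp] : forall k : nat, exists p : (X -> Y) * (Y -> X),
  [/\ is_homeo p.1 p.2, forall y, ball (b y) (k.+1%:R^-1 : R) (p.1 (a (p.2 y))) &
   forall f : Y -> int, lc f -> (forall y z, ball y (k.+1%:R^-1 : R) z -> f y = f z) ->
     K0eq ai (f \o p.1) (r f)].
  move=> k; have k0 : 0 < k.+1%:R^-1 :> R by rewrite invr_gt0 ltr0n.
  by have [s [si h]] := approx_conj_stage k0; exists (s, si).
have near_small (e : R) : 0 < e -> \forall k \near \oo, k.+1%:R^-1 < e.
  by move=> e0; exact: (near_infty_natSinv_lt (PosNum e0)).
exists (fun k => (p k).1), (fun k => (p k).2); split.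
- by move=> k; case: (hp k).
- move=> e e0; apply: filterS (near_small e e0) => k ke y.
  by case: (hp k) => _ h _; apply: le_ball (h y); exact: ltW.
- move=> f lf; have [e e0 he] := lc_uniform cY lf.
  have [N _ hN] := near_small e e0.
  have hf k : (N <= k)%N -> K0eq ai (f \o (p k).1) (r f).
    move=> Nk; case: (hp k) => _ _; apply => // y z yz; apply: he.
    by apply: le_ball yz; apply/ltW/hN.
  by exists N => k Nk; apply: K0_trans (hf k Nk) (K0_sym (hf N (leqnn N))).
Qed.

End ApproxConj.

(** * Synchronized labellings *)

(** Below the top [c] acts on labels as [b] does. At the top only the return to the base is
    prescribed, so [c] may still be rearranged there. *)
Record synced {X Y : Type} (c : X -> X) (D : X -> bool) (t : X -> nat)
    (b : Y -> Y) (B : Y -> bool) (q : Y -> nat) : Prop := {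
  sy_range : same_range t q;
  sy_base : forall x y, t x = q y -> D x = B y;
  sy_top : forall x y, t x = q y -> D (c x) = B (b y);
  sy_succ : forall x y, t x = q y -> ~~ D (c x) -> t (c x) = q (b y)
}.

Section Synced.
Context {X : Type} {Y : topologicalType}.
Variables (c ci : X -> X) (D : X -> bool) (t : X -> nat).
Variables (b bi : Y -> Y) (B : Y -> bool) (q : Y -> nat).
Hypotheses (cK : cancel c ci) (ciK : cancel ci c).
Hypotheses (rB : recurrent b bi B) (kq : KR b B q) (sy : synced c D t b B q).

(** Some [y'] has the label of [ci x]; following it forward and using that [b] is injective on
    labels below the top identifies this label with that of [bi y]. *)
Lemma sync_pred x y : t x = q y -> ~~ D x -> t (ci x) = q (bi y).
Proof.
move=> e nD; have nB : ~~ B y by rewrite -(sy_base sy e).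
have [y' e'] := (sy_range sy).1 (ci x).
have nD' : ~~ D (c (ci x)) by rewrite ciK.
have := sy_succ sy (esym e') nD'; rewrite ciK e => h.
have h1 : ~~ B (b y') by rewrite -(kr_base kq h).
have h2 : ~~ B (b (bi y)) by rewrite (rec_canV rB).
rewrite -e'; apply: (kr_succ kq h1 h2).2.
by rewrite (rec_canV rB).
Qed.

Lemma sync_up x y j : t x = q y -> (forall i, (i < j)%N -> ~~ B (iter i.+1 b y)) ->
  t (iter j c x) = q (iter j b y) /\ (forall i, (i < j)%N -> ~~ D (iter i.+1 c x)).
Proof.
move=> e; elim: j => [|j IH] h //.
have [e' h'] := IH (fun i ij => h i (ltnW ij)).
have nD : ~~ D (iter j.+1 c x) by rewrite /= (sy_top sy e') h.
split; first exact: (sy_succ sy e' nD).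
by move=> i; rewrite ltnS leq_eqVlt => /orP[/eqP -> //|/h'].
Qed.

Lemma sync_up_rev x y j : t x = q y -> (forall i, (i < j)%N -> ~~ D (iter i.+1 c x)) ->
  t (iter j c x) = q (iter j b y) /\ (forall i, (i < j)%N -> ~~ B (iter i.+1 b y)).
Proof.
move=> e; elim: j => [|j IH] h //.
have [e' h'] := IH (fun i ij => h i (ltnW ij)).
have nD : ~~ D (iter j.+1 c x) := h j (ltnSn j).
split; first exact: (sy_succ sy e' nD).
move=> i; rewrite ltnS leq_eqVlt => /orP[/eqP ->|/h' //].
by rewrite /= -(sy_top sy e').
Qed.

(** Recurrence is imported from Y: points with equal labels climb and descend their towers in step,
    so [x] meets [D] when its partner meets [B]. *)
Lemma sync_recurrent : recurrent c ci D.
Proof.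
split=> // x; have [y /esym e] := (sy_range sy).1 x.
  move: {2}(pos bi B y) (erefl (pos bi B y)) e => j.
  elim: j x y => [|j IH] x y pj e.
    by exists 0%N; rewrite /= (sy_base sy e) (pos0V rB pj).
  have nB : ~~ B y by apply/negP => /(pos_V bi); rewrite pj.
  have nD : ~~ D x by rewrite (sy_base sy e).
  have [|k hk] := IH (ci x) (bi y) _ (sync_pred e nD).
    by have := pos_ai rB nB; rewrite pj => -[].
  by exists k.+1; rewrite iterSr.
have [h1 h2] := firstP (rec_future rB y).
set j := first _ in h1 h2; exists j.
have [e' _] := @sync_up x y j e h2.
by rewrite /= (sy_top sy e').
Qed.

Lemma sync_down x y : t x = q y ->
  pos ci D x = pos bi B y /\ t (base ci D x) = q (base bi B y).
Proof.
move: {2}(pos bi B y) (erefl (pos bi B y)) => j.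
elim: j x y => [|j IH] x y pj e.
  have By := pos0V rB pj; have Dx : D x by rewrite (sy_base sy e).
  by rewrite pj !base_V // pos_V.
have nB : ~~ B y by apply/negP => /(pos_V bi); rewrite pj.
have nD : ~~ D x by rewrite (sy_base sy e).
have [|p e2] := IH (ci x) (bi y) _ (sync_pred e nD).
  by have := pos_ai rB nB; rewrite pj => -[].
have r := sync_recurrent.
by rewrite (pos_ai r nD) (pos_ai rB nB) p -(base_ai r nD) -(base_ai rB nB).
Qed.

End Synced.

Lemma below_base (Y : Type) (b bi : Y -> Y) (B : Y -> bool) (y : Y) :
  recurrent b bi B ->
  forall i, (i < pos bi B y)%N -> ~~ B (iter i.+1 b (base bi B y)).
Proof.
move=> rB i ip; apply: (htP rB y).2 => /=.
exact: leq_ltn_trans ip (pos_lt_ht rB y).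
Qed.

Section TwoLevels.
Context {Y : topologicalType}.
Variables (b bi : Y -> Y) (B B' : Y -> bool) (q q' : Y -> nat).
Hypotheses (rB : recurrent b bi B) (kq : KR b B q) (kq' : KR b B' q').
Hypothesis BB' : forall y, B' y -> B y.
Hypothesis qq' : forall y z, q' y = q' z -> q y = q z.

Lemma KR_refine_up y z j : q' y = q' z -> (forall i, (i < j)%N -> ~~ B (iter i.+1 b z)) ->
  q' (iter j b y) = q' (iter j b z).
Proof.
move=> e h; have [//|-> _ //] := KR_up (j := j) kq' e.
by move=> i /h; apply: contra; exact: BB'.
Qed.

Lemma KR_refine_down y z : q' y = q' z -> q' (base bi B y) = q' (base bi B z).
Proof.
have [bK biK] := (rec_can rB, rec_canV rB).
move: {2}(pos bi B z) (erefl (pos bi B z)) => j.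
elim: j y z => [|j IH] y z pz e.
  have Bz := pos0V rB pz; have By : B y by rewrite (kr_base kq (qq' e)).
  by rewrite !base_V.
have nz : ~~ B z by apply/negP => /(pos_V bi); rewrite pz.
have ny : ~~ B y by rewrite (kr_base kq (qq' e)).
rewrite -(base_ai rB ny) -(base_ai rB nz); apply: IH.
  by have := pos_ai rB nz; rewrite pz => -[].
have hy : ~~ B' (b (bi y)) by rewrite biK; apply: contra ny; exact: BB'.
have hz : ~~ B' (b (bi z)) by rewrite biK; apply: contra nz; exact: BB'.
by apply: (kr_succ kq' hy hz).2; rewrite !biK.
Qed.

End TwoLevels.

(** * Lifting a labelling of the base to the towers *)

Section Propagate.
Context {X Y : topologicalType}.
Variables (phi : X -> nat -> bool) (psi : Y -> nat -> bool).
Variables (a ai : X -> X) (b bi : Y -> Y) (r : (Y -> int) -> (X -> int)).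
Hypotheses (cX : coord_space phi) (ha : is_homeo a ai) (ma : minimal_map a).
Hypotheses (cY : coord_space psi) (hb : is_homeo b bi) (mb : minimal_map b).
Hypothesis hr : unital_order_hom ai bi r.

(** Both sets are unions of atoms with the same labels, and the classes of disjoint atoms add. *)
Lemma cls_saturated (t : X -> nat) (q : Y -> nat) (P : X -> bool) (Q : Y -> bool) :
  lc t -> lc q -> lc Q -> (forall l, cls ai r (fun x => t x == l) (fun y => q y == l)) ->
  same_range t q -> (forall x y, t x = q y -> P x = Q y) -> cls ai r P Q.
Proof.
move=> lt lq lQ h [tq qt] PQ.
have [N hN] := lc_bounded cX lt; have [M hM] := lc_bounded cY lq.
suff hn n : cls ai r (fun x => P x && (t x < n)%N) (fun y => Q y && (q y < n)%N).
  apply: eq_cls (hn (N + M)%N) => z.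
    by have := hN z; case: ltnP; rewrite ?andbT //; lia.
  by have := hM z; case: ltnP; rewrite ?andbT //; lia.
elim: n => [|n IH]; first by apply: (cls_empty hr) => z; rewrite ltn0 !andbF.
have hl : cls ai r (fun x => P x && (t x == n)) (fun y => Q y && (q y == n)).
  have [[y /andP[Qy /eqP qy]]|nQ] := pselect (exists y, Q y && (q y == n)).
    apply: eq_cls (h n) => z; case: eqP => //; rewrite ?andbF // => e; rewrite andbT.
      by apply/esym; rewrite (PQ z y) // e.
    have [x tx] := qt y; have [x' tx'] := qt z.
    by rewrite -(PQ x' z) // (PQ x' y) // tx' e.
  have nQ' y : ~~ (Q y && (q y == n)) by apply/negP => hy; apply: nQ; exists y.
  apply: (cls_empty hr) => // x; apply/negP => /andP[Px /eqP tx].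
  have [y qy] := tq x; have := nQ' y.
  by rewrite -(PQ x y) // Px qy tx eqxx.
have l1 : lc (fun y => Q y && (q y < n)%N).
  by apply: (lc_comp2 (fun u v => u && (v < n)%N)).
have l2 : lc (fun y => Q y && (q y == n)) by exact: lc_sub.
apply: eq_cls (cls_disj hr l1 l2 _ _ IH hl).
- by move=> x; rewrite ltnS [in RHS]leq_eqVlt orbC; case: (P x).
- by move=> x; rewrite ltnS [in RHS]leq_eqVlt orbC; case: (Q x).
- by move=> x; case: (eqVneq (t x) n) => [->|]; rewrite ?ltnn ?andbF.
- by move=> x; case: (eqVneq (q x) n) => [->|]; rewrite ?ltnn ?andbF.
Qed.

Variables (c ci : X -> X) (n : X -> int) (D : X -> bool) (t : X -> nat).
Variables (B B' : Y -> bool) (q q' : Y -> nat).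
Hypotheses (hc : is_homeo c ci) (ln : lc n) (cn : forall x, c x = zpow a ai (n x) x).
Hypotheses (lD : lc D) (lt : lc t).
Hypotheses (lB : lc B) (rB : recurrent b bi B) (kq : KR b B q) (kq' : KR b B' q').
Hypothesis BB' : forall y, B' y -> B y.
Hypothesis qq' : forall y z, q' y = q' z -> q y = q z.
Hypothesis sy : synced c D t b B q.
Variables (pt : X) (tD : X -> nat).
Hypothesis sD : splits ai r q' D B tD.
Hypothesis tDq : forall x, D x -> exists y, [/\ B y, q' y = tD x & q y = t x].

Let cK : cancel c ci. Proof. by case: hc. Qed.
Let ciK : cancel ci c. Proof. by case: hc. Qed.
Let rD : recurrent c ci D. Proof. exact: sync_recurrent cK ciK rB kq sy. Qed.

Lemma cls_iterV j E C : lc E -> lc C -> cls ai r E C ->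
  cls ai r (fun x => E (iter j ci x)) (fun y => C (iter j bi y)).
Proof.
have [cc cci _ _] := hc; have [_ cbi _ biK] := hb.
move=> lE lC h.
have h1 : K0eq ai (ind E) (ind (fun x => E (iter j ci x))).
  elim: j => [|j IH]; first exact: K0_refl.
  apply: K0_trans IH _.
  have := @K0_piecewise_power _ _ _ _ cX ha c ci n (ind (fun x => E (iter j.+1 ci x))) hc cn _ (fun x _ => ln x).
  have -> : (fun x => ind (fun x => E (iter j.+1 ci x)) (c x)) = ind (fun x => E (iter j ci x)).
    by apply/funext => x; rewrite /ind iterSr cK.
  by apply; apply: lc_ind; exact: lc_iter.
apply: K0_trans (K0_sym h1) _; apply: K0_trans h _.
have := hom_shift hb hr j (f := ind (fun y => C (iter j bi y))).
have -> : (fun y => ind (fun y => C (iter j bi y)) (iter j b y)) = ind C.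
  by apply/funext => y; rewrite /ind iterK //; case: hb.
by apply; apply: lc_ind; exact: lc_iter.
Qed.

(** A new label on the base decides the new labels up to the old top: start in Y at any base point
    carrying that label, climb to the height of [x], and read [q'] there. As [B'] lies in [B], no
    new base is met on the way. *)
Lemma propagate : exists t' : X -> nat, [/\ lc t',
  forall l, cls ai r (fun x => t' x == l) (fun y => q' y == l),
  forall x, D x -> t' x = tD x,
  forall x y, t' x = q' y -> t x = q y /\ tD (base ci D x) = q' (base bi B y) &
  forall x y, t' x = q' y -> ~~ D (c x) -> t' (c x) = q' (b y)].
Proof.
have [ltD clD] := sD; have lq' := kr_lc kq'.
have [y0 _] := (sy_range sy).1 pt.
have /choice [rep hrep] : forall l, exists y, (exists2 z, B z & q' z = l) -> B y /\ q' y = l.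
  move=> l; have [[z Bz qz]|h] := pselect (exists2 z, B z & q' z = l); first by exists z.
  by exists y0.
pose ys x := rep (tD (base ci D x)).
have ysP x : [/\ B (ys x), q' (ys x) = tD (base ci D x) & q (ys x) = t (base ci D x)].
  have [y [By qy' qy]] := tDq (V_base rD x).
  have [|h1 h2] := hrep (tD (base ci D x)); first by exists y.
  by split=> //; rewrite -qy; apply: qq'; rewrite h2 qy'.
pose t' x := q' (iter (pos ci D x) b (ys x)).
pose w x := iter (pos ci D x) b (ys x).
have wP x : [/\ q (w x) = t x, pos bi B (w x) = pos ci D x & base bi B (w x) = ys x].
  have [By q'y qy] := ysP x.
  have [e h] := @sync_up_rev _ _ _ _ _ _ _ _ sy (base ci D x) (ys x) (pos ci D x) (esym qy)
     (below_base (y := x) rD).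
  rewrite (iter_base rD) in e.
  have [p _] := sync_down cK ciK rB kq sy e.
  by split=> //; rewrite /base -p /w (iterK _ (rec_can rB)).
have t'w x : t' x = q' (w x) by [].
have C4 x y : t' x = q' y -> t x = q y /\ tD (base ci D x) = q' (base bi B y).
  move=> e; have [e1 e2 e3] := wP x; split; first by rewrite -e1; exact: qq'.
  by have [_ <- _] := ysP x; rewrite -e3; apply: (KR_refine_down rB kq kq' BB' qq').
exists t'; split=> //.
- apply: (@lc_dep _ _ _ (fun j x => q' (iter j b (ys x))) (pos ci D)); last exact: lc_pos hc lD rD.
  move=> j; apply: (lc_comp1 (fun l => q' (iter j b (rep l)))).
  exact: (lc_at_base hc lD rD).
- move=> l; have [[u qu]|nl] := pselect (exists u, q' u = l); last first.
    apply: (cls_empty hr) => [x|y]; apply/negP => /eqP e; apply: nl; last by exists y.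
    by exists (w x).
  (* The atom labelled [l] is the [j]-th image of the base atom labelled [l0], under [c] in X and
     under [b] in Y; both translations preserve classes. *)
  set j := pos bi B u; pose l0 := q' (base bi B u).
  have lDl : lc (fun x => D x && (tD x == l0)) by exact: lc_sub.
  have lBl : lc (fun y => B y && (q' y == l0)) by exact: lc_sub.
  apply: eq_cls (cls_iterV j lDl lBl (clD l0)) => [x|y].
    apply/andP/eqP => [[Dv /eqP tv]|e].
      set v := iter j ci x in Dv tv.
      have bv := base_V ci Dv; have [Byv qyv' qyv] := ysP v; rewrite bv in qyv' qyv.
      have e1 : q' (ys v) = q' (base bi B u) by rewrite qyv' tv.
      have [e2 h2] := KR_up kq (qq' e1) (below_base (y := u) rB).
      have [e3 h3] := sync_up sy (esym qyv) h2.
      have xv : iter j c v = x by rewrite /v iterK.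
      have cix i : (i <= j)%N -> iter i ci x = iter (j - i) c v.
        by move=> ij; rewrite -xv -{1}(subnKC ij) iterD iterK.
      have nDi i : (i < j)%N -> ~~ D (iter i ci x).
        move=> ij; rewrite (cix _ (ltnW ij)) -(subnSK ij); apply: h3.
        by rewrite -/j; lia.
      have px : pos ci D x = j := pos_unique Dv nDi.
      have bx : base ci D x = v by rewrite /base px.
      rewrite t'w /w px.
      have -> : ys x = ys v by rewrite /ys bx bv.
      rewrite (KR_refine_up kq' BB' e1 (below_base (y := u) rB)).
      by rewrite (iter_base rB).
    have eu : t' x = q' u by rewrite e.
    have [txu tDu] := C4 _ _ eu.
    have [pxu _] := sync_down cK ciK rB kq sy txu.
    have bx : iter j ci x = base ci D x by rewrite /base pxu.
    by rewrite bx tDu eqxx; split=> //; exact: V_base rD x.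
  apply/andP/eqP => [[Bv /eqP qv]|e].
    have := KR_refine_up kq' BB' qv (below_base (y := u) rB).
    by rewrite (iter_base rB) (iterK _ (rec_canV rB)) qu.
  have eu : q' y = q' u by rewrite e.
  have [pyu _] := KR_down rB kq (qq' eu).
  have by_ : iter j bi y = base bi B y by rewrite /base pyu.
  rewrite by_; split; first exact: V_base rB y.
  by apply/eqP; exact: (KR_refine_down rB kq kq' BB' qq').
- by move=> x Dx; rewrite t'w /w pos_V //; have [_ -> _] := ysP x; rewrite base_V.
- move=> x y e nD; have [exy _] := C4 _ _ e; have [ew _ _] := wP x.
  have -> : t' (c x) = q' (b (w x)).
    by rewrite t'w /w (pos_step rD) //= /ys (base_step rD).
  have h1 : ~~ B' (b (w x)).
    by apply: contra nD => /BB'; rewrite (sy_top sy (esym ew)).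
  have h2 : ~~ B' (b y) by apply: contra nD => /BB'; rewrite (sy_top sy exy).
  by apply: (kr_succ kq' h1 h2).1.
Qed.

End Propagate.

Lemma piecewise_power_continuous (X : topologicalType) (a ai c : X -> X) (n : X -> int) :
  is_homeo a ai -> lc n -> (forall x, c x = zpow a ai (n x) x) -> continuous c.
Proof.
move=> ha ln cn x U; rewrite cn => hU.
have cz := @continuous_zpow _ _ _ (n x) ha x U hU.
by apply: filterS (filterI (ln x) cz) => y [e h]; rewrite /= cn e.
Qed.

(** * Correcting the map on the old top *)

Section Rearrange.
Context {X Y : topologicalType}.
Variables (phi : X -> nat -> bool) (psi : Y -> nat -> bool).
Variables (a ai : X -> X) (b bi : Y -> Y) (r : (Y -> int) -> (X -> int)).
Hypotheses (cX : coord_space phi) (ha : is_homeo a ai) (ma : minimal_map a).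
Hypotheses (cY : coord_space psi) (hb : is_homeo b bi) (mb : minimal_map b).
Hypothesis hr : unital_order_hom ai bi r.
Variables (c ci : X -> X) (n : X -> int) (D : X -> bool) (t t' : X -> nat).
Variables (B B' : Y -> bool) (q q' : Y -> nat).
Hypotheses (hc : is_homeo c ci) (ln : lc n) (cn : forall x, c x = zpow a ai (n x) x).
Hypotheses (lD : lc D) (lB : lc B) (lB' : lc B').
Hypotheses (kq' : KR b B' q') (BB' : forall y, B' y -> B y).
Hypothesis sy : synced c D t b B q.
Hypotheses (lt' : lc t') (sr : same_range t' q').
Hypothesis clt' : forall l, cls ai r (fun x => t' x == l) (fun y => q' y == l).
Hypothesis t't : forall x y, t' x = q' y -> t x = q y.
Hypothesis t'succ : forall x y, t' x = q' y -> ~~ D (c x) -> t' (c x) = q' (b y).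
Variable pt : X.

(** Below the old top [c] already respects the new labels. On the old top it is replaced by a
    matching onto the old base, in which [kU] states the key where the point has to land and [kV]
    the key of the landing point. All of the new base shares one key, which leaves the map from the
    new top open to later corrections. *)
Lemma rearrange : exists (c' ci' : X -> X) (n' : X -> int) (D' : X -> bool),
  [/\ [/\ is_homeo c' ci', lc n', forall x, c' x = zpow a ai (n' x) x & lc D'],
      synced c' D' t' b B' q',
      forall x, D' x -> D x,
      forall x, ~~ D (c x) -> n' x = n x &
      forall x, D (c' x) = D (c x)].
Proof.
have [cc cci cK ciK] := hc; have [cb cbi bK biK] := hb.
have lq' := kr_lc kq'.
have [aK aiK] : cancel a ai /\ cancel ai a by case: ha.
have [y0 _] := sr.1 pt.
have /choice [rep hrep] : forall l, exists y, (exists z, q' z = l) -> q' y = l.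
  move=> l; have [[z qz]|h] := pselect (exists z, q' z = l); first by exists z.
  by exists y0.
have repP x : q' (rep (t' x)) = t' x by apply: hrep; exact: sr.1.
pose D' x := B' (rep (t' x)).
have D'B x y : t' x = q' y -> D' x = B' y.
  by move=> e; rewrite /D' (kr_base kq' (z := y)) // repP.
have lD' : lc D' by apply: (lc_comp1 (fun l => B' (rep l))).
have D'D x : D' x -> D x.
  move=> h; have [y qy] := sr.1 x; move: h; rewrite (D'B x y) // => /BB'.
  by rewrite (sy_base sy (t't (esym qy))).
(* key [1] marks the new base, key [l + 2] the old base with new label [l] *)
pose KD y := if B y then (if B' y then 1%N else (q' y).+2) else 0%N.
pose kV x := if D x then (if D' x then 1%N else (t' x).+2) else 0%N.
pose kU x := if D (c x) then
   (if B' (b (rep (t' x))) then 1%N else (q' (b (rep (t' x)))).+2) else 0%N.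
have lKD : lc KD.
  have l2 : lc (fun y => (B y, B' y)) by apply: (lc_comp2 pair).
  exact: (lc_comp2 (fun (u : bool * bool) v => if u.1 then (if u.2 then 1%N else v.+2) else 0%N) l2 lq').
have lkV : lc kV.
  have l2 : lc (fun x => (D x, D' x)) by apply: (lc_comp2 pair).
  exact: (lc_comp2 (fun (u : bool * bool) v => if u.1 then (if u.2 then 1%N else v.+2) else 0%N) l2 lt').
have lkU : lc kU.
  apply: (lc_comp2 (fun (u : bool) l => if u then
   (if B' (b (rep l)) then 1%N else (q' (b (rep l))).+2) else 0%N)) => //.
  exact: lc_cont.
have kVE x y : t' x = q' y -> kV x = KD y.
  by move=> e; rewrite /kV /KD (D'B x y e) (sy_base sy (t't e)) e.
have kUE x y : t' x = q' y -> kU x = KD (b y).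
  move=> e; rewrite /kU /KD (sy_top sy (t't e)).
  have e' : q' (rep (t' x)) = q' y by rewrite repP.
  case: ifP => // _; rewrite (kr_top kq' e'); case: ifP => // /negbT nB; congr _.+2.
  by apply: (kr_succ kq' _ nB).1 => //; rewrite (kr_top kq' e').
(* In Y the two key functions are [KD \o b] and [KD], so their level sets differ by a translation
   and have the same class. *)
have keys l : (0 < l)%N -> K0eq ai (ind (fun x => kU x == l)) (ind (fun x => kV x == l)).
  move=> _.
  have h1 : cls ai r (fun x => kU x == l) (fun y => KD (b y) == l).
    apply: (cls_saturated cX cY hr lt' lq' _ clt' sr) => [|x y e].
      by apply: lc_eq; exact: lc_cont.
    by rewrite (kUE x y e).
  have h2 : cls ai r (fun x => kV x == l) (fun y => KD y == l).
    apply: (cls_saturated cX cY hr lt' lq' _ clt' sr) => [|x y e].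
      exact: lc_eq.
    by rewrite (kVE x y e).
  apply: K0_trans h1 _; apply: K0_sym; apply: K0_trans h2 _; apply: K0_sym.
  apply: (hom_shift hb hr 1 (f := ind (fun y => KD y == l))).
  by apply: lc_ind; exact: lc_eq.
have [m [m' [lm lm' mP m'P]]] := keyed_matching pt cX ha ma lkU lkV keys.
have kU0 x : (0 < kU x)%N = D (c x) by rewrite /kU; case: ifP => //; case: ifP.
have kV0 x : (0 < kV x)%N = D x by rewrite /kV; case: ifP => //; case: ifP.
pose n' x := if D (c x) then m x else n x.
pose ni' x := if D x then m' x else - n (ci x).
pose c' x := zpow a ai (n' x) x; pose ci' x := zpow a ai (ni' x) x.
have c'nt x : ~~ D (c x) -> c' x = c x.
  by move=> h; rewrite /c' /n' (negbTE h) cn.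
have c't x : D (c x) -> [/\ c' x = zpow a ai (m x) x, kV (c' x) = kU x & D (c' x)].
  move=> h; have e : c' x = zpow a ai (m x) x by rewrite /c' /n' h.
  have kx : (0 < kU x)%N by rewrite kU0.
  have [e1 _] := mP x kx; rewrite e; split=> //.
  by rewrite -kV0 e1.
have ci'n x : ~~ D x -> ci' x = ci x.
  move=> h; rewrite /ci' /ni' (negbTE h) -{2}(ciK x) cn zpowK //.
have c'K : cancel c' ci'.
  move=> x; have [h|h] := boolP (D (c x)); last by rewrite c'nt // ci'n // cK.
  have [e _ De] := c't x h; rewrite /ci' /ni' De e.
  have kx : (0 < kU x)%N by rewrite kU0.
  by have [_ ->] := mP x kx; rewrite zpowK.
have ci'K : cancel ci' c'.
  move=> x; have [h|h] := boolP (D x); last first.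
    by rewrite ci'n // c'nt ?ciK.
  have kx : (0 < kV x)%N by rewrite kV0.
  have [e1 e2] := m'P x kx.
  have e : ci' x = zpow a ai (m' x) x by rewrite /ci' /ni' h.
  have Dc : D (c (ci' x)) by rewrite -kU0 e e1.
  by rewrite /c' /n' Dc e e2 zpowK.
have ln' : lc n'.
  have l2 : lc (fun x => (D (c x), m x)) by apply: (lc_comp2 pair) => //; exact: lc_cont.
  exact: (lc_comp2 (fun (u : bool * int) v => if u.1 then u.2 else v) l2 ln).
have lni' : lc ni'.
  have l2 : lc (fun x => (D x, m' x)) by apply: (lc_comp2 pair).
  apply: (lc_comp2 (fun (u : bool * int) v => if u.1 then u.2 else - v) l2).
  exact: (lc_cont cci ln).
exists c', ci', n', D'; split=> //.
- split=> //; split=> //.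
    exact: (piecewise_power_continuous ha ln').
  exact: (piecewise_power_continuous ha lni').
- split=> //.
  + move=> x y e; have e2 := t't e; have := sy_top sy e2.
    have [h|h] := boolP (D (c x)); last first.
      rewrite c'nt // => /esym/negbT nB.
      have -> : D' (c x) = false by apply/negbTE; apply: contra h; exact: D'D.
      by apply/esym/negbTE; apply: contra nB; exact: BB'.
    have [_ kk De] := c't x h; move=> hB; move: kk; rewrite (kUE _ _ e) /kV /KD De -hB.
    by case: (D' _); case: (B' _).
  + move=> x y e; have e2 := t't e; have := sy_top sy e2.
    have [h|h] := boolP (D (c x)); last by rewrite c'nt // => _ _; exact: t'succ.
    have [_ kk De] := c't x h; move=> hB; move: kk; rewrite (kUE _ _ e) /kV /KD De -hB.
    by case: (D' _) => //; case: (B' _) => // -[].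
- by move=> x /negbTE h; rewrite /n' h.
- move=> x; have [h|h] := boolP (D (c x)); first by have [_ _ ->] := c't x h.
  by rewrite c'nt // (negbTE h).
Qed.

End Rearrange.

(** * Controlled splittings *)

Section ControlledSplit.
Context {X Y : topologicalType}.
Variables (phi : X -> nat -> bool) (psi : Y -> nat -> bool).
Variables (a ai : X -> X) (b bi : Y -> Y) (r : (Y -> int) -> (X -> int)).
Hypotheses (cX : coord_space phi) (ha : is_homeo a ai) (ma : minimal_map a).
Hypotheses (cY : coord_space psi) (hb : is_homeo b bi) (mb : minimal_map b).
Hypothesis hr : unital_order_hom ai bi r.
Variables (pt : X) (t : X -> nat) (q q' : Y -> nat).
Hypotheses (lt : lc t) (lq : lc q) (lq' : lc q').
Hypothesis qq' : forall y z, q' y = q' z -> q y = q z.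

(* Clopen targets [G i] in [X] for the [q']-saturated sets [C i] in [Y], all
   inside one atom of the old labellings, with points that must correspond. *)
Variables (G : nat -> X -> bool) (C : nat -> Y -> bool) (p : nat -> X) (y : nat -> Y).
Variable l : nat -> nat.
Hypotheses (lG : forall i, lc (G i)) (lC : forall i, lc (C i)).
Hypotheses (Gp : forall i, G i (p i)) (Cy : forall i, C i (y i)).
Hypotheses (Gl : forall i x, G i x -> t x = l i) (Cl : forall i z, C i z -> q z = l i).
Hypothesis GC : forall i, K0pos ai (fun x => ind (G i) x - r (ind (C i)) x).
Hypothesis Csat : forall i z u, q' z = q' u -> C i z -> C i u.

Definition refined_split (D : X -> bool) (B : Y -> bool) (tD : X -> nat) : Prop :=
  splits ai r q' D B tD /\
  forall x, D x -> exists z, [/\ B z, q' z = tD x & q z = t x].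

(** The targets are served one at a time: [C n] is realized inside [G n] by a set through [p n],
    labelled, and removed before the remaining targets are treated. *)
Lemma controlled_split n D B : lc D -> lc B ->
  (forall k, cls ai r (fun x => D x && (t x == k)) (fun z => B z && (q z == k))) ->
  (forall i, (i < n)%N -> (forall x, G i x -> D x) /\ (forall z, C i z -> B z)) ->
  (forall i j, (i < j < n)%N ->
     (forall x, ~~ (G i x && G j x)) /\ (forall z, ~~ (C i z && C j z))) ->
  exists2 tD, refined_split D B tD & forall i, (i < n)%N ->
    tD (p i) = q' (y i) /\ forall x z, D x -> tD x = q' z -> C i z -> G i x.
Proof.
elim: n D B => [|n IH] D B lD lB clDB sub disj.
  have [tD sD hD] := splits_relative cX ha ma cY hb mb hr pt lq' lt lq lD lB clDB.
  by exists tD.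
have [GD CB] := sub n (ltnSn n).
have [E [lE EG Ep clE]] :=
  exists_realization cX ha ma cY hb mb hr (lG n) (lC n) (Gp n) (Cy n) (GC n).
have [tE sE tEp] := splits_exist_pointed cX ha ma cY hb mb hr pt lq' lE (lC n) clE Ep (Cy n).
pose D1 x := D x && ~~ E x; pose B1 z := B z && ~~ C n z.
have lD1 : lc D1 by apply: (lc_comp2 (fun u v => u && ~~ v)).
have lB1 : lc B1 by apply: (lc_comp2 (fun u v => u && ~~ v)).
have [|i ni|i j ij|tR [sR hR] cR] := IH D1 B1 lD1 lB1.
- move=> k.
  (* The removed pieces lie in the single old atom [l n], so the balance of the other old labels is
     untouched. *)
  have clk : cls ai r (fun x => E x && (t x == k)) (fun z => C n z && (q z == k)).
    have [lk|lk] := eqVneq (l n) k.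
      apply: eq_cls clE => z.
        by case Ez: (E z) => //; rewrite (Gl (EG _ Ez)) lk eqxx.
      by case Cz: (C n z) => //; rewrite (Cl Cz) lk eqxx.
    apply: (cls_empty hr) => z; apply/negP => /andP[h /eqP e].
      by move: lk; rewrite -e (Gl (EG _ h)) eqxx.
    by move: lk; rewrite -e (Cl h) eqxx.
  have := cls_diff hr _ _ _ _ (clDB k) clk.
  move=> h; apply: eq_cls (h _ _ _ _).
  + by move=> x; rewrite /D1; case: (D x); case: (E x); case: (t x == k).
  + by move=> x; rewrite /B1; case: (B x); case: (C n x); case: (q x == k).
  + exact: lc_sub.
  + exact: lc_sub.
  + by move=> x /andP[/EG/GD -> ->].
  + by move=> x /andP[/CB -> ->].
- have [s1 s2] := sub i (ltnW ni).
  have [d1 d2] := disj i n (introT andP (conj ni (ltnSn n))).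
  split=> [x h|z h]; rewrite /D1 /B1; first rewrite s1 //=.
    by apply/negP => /EG h'; have := d1 x; rewrite h h'.
  by rewrite s2 //=; apply/negP => h'; have := d2 z; rewrite h h'.
- by apply: disj; case/andP: ij => -> /=; exact: ltnW.
pose tD x := if E x then tE x else tR x.
have DE x : E x -> D x by move=> /EG/GD.
have sD : splits ai r q' D B tD.
  have [|||lt1 hl] := splits_glue hr lq' lE (lC n) _ _ _ sE sR.
  - exact: lB1.
  - by move=> x; rewrite /D1; case: (E x); rewrite ?andbF.
  - by move=> z; rewrite /B1; case: (C n z); rewrite ?andbF.
  split=> // k; apply: eq_cls (hl k).
    by move=> x; rewrite /D1 /tD; have := DE x; case: (E x) => [/(_ isT) ->|_]; rewrite ?andbT.
  by move=> z; rewrite /B1; have := CB z; case: (C n z) => [/(_ isT) ->|_]; rewrite ?andbT.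
have labE x : E x -> exists2 z, C n z & q' z = tE x.
  by move=> Ex; exact: (splits_label cX ha ma hr lE sE Ex).
exists tD.
  split=> // x Dx; rewrite /tD; case: ifP => Ex.
    have [z Cz qz] := labE x Ex; exists z; split=> //; first exact: CB.
    by rewrite (Cl Cz) (Gl (EG _ Ex)).
  have [|z [/andP[Bz _] h1 h2]] := hR x; first by rewrite /D1 Dx Ex.
  by exists z.
move=> i; rewrite ltnS leq_eqVlt => /orP[/eqP ->|ni].
  split; first by rewrite /tD Ep.
  move=> x z Dx; rewrite /tD; case: ifP => [/EG //|Ex] e Cz.
  have [|u [/andP[_ nC] h1 _]] := hR x; first by rewrite /D1 Dx Ex.
  by move: nC; rewrite (Csat _ Cz) // -e h1.
have [d1 d2] := disj i n (introT andP (conj ni (ltnSn n))).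
have [c1 c2] := cR i ni; split.
  rewrite /tD ifN //; apply/negP => /EG h; have := d1 (p i).
  by rewrite h Gp.
move=> x z Dx; rewrite /tD; case: ifP => Ex e Cz; last first.
  by apply: (c2 x z) => //; rewrite /D1 Dx Ex.
have [u Cu qu] := labE x Ex; have := d2 z; rewrite Cz /=.
by rewrite (Csat _ Cu) // qu.
Qed.

End ControlledSplit.

(** * The inductive construction of the factor map *)

Lemma cyl_separated (X : topologicalType) (phi : X -> nat -> bool) p p' k u :
  ~~ cyl phi p k p' -> cyl phi p k u -> ~~ cyl phi p' k u.
Proof.
move=> h /cylP h1; apply: contra h => /cylP h2; apply/cylP => i ik.
by rewrite -h2 // h1.
Qed.

Lemma ltn3_pairs i j : (i < j < 3)%N ->
  [\/ i = 0%N /\ j = 1%N, i = 0%N /\ j = 2%N | i = 1%N /\ j = 2%N].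
Proof.
case: i j => [|[|i]] [|[|[|j]]] h; try by [exfalso; lia].
- exact: Or31.
- exact: Or32.
- exact: Or33.
Qed.

Lemma ltn_bound4 m1 m2 m3 m4 : exists L,
  [/\ (m1 < L)%N, (m2 < L)%N, (m3 < L)%N & (m4 < L)%N].
Proof. by exists (m1 + m2 + m3 + m4).+1; split; lia. Qed.

Lemma ltn_window i j m L : (j < m)%N -> (m < L)%N -> (j < i + L.+1)%N.
Proof. lia. Qed.

Record stage_data (X Y : Type) := StageData {
  sB : Y -> bool; sq : Y -> nat;
  sc : X -> X; sci : X -> X; sn : X -> int;
  sD : X -> bool; st : X -> nat
}.

Section Stages.
Context {X Y : topologicalType}.
Variables (phi : X -> nat -> bool) (psi : Y -> nat -> bool).
Variables (a ai : X -> X) (b bi : Y -> Y) (r : (Y -> int) -> (X -> int)).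
Hypotheses (cX : coord_space phi) (ha : is_homeo a ai) (ma : minimal_map a).
Hypotheses (cY : coord_space psi) (hb : is_homeo b bi) (mb : minimal_map b).
Hypothesis hr : unital_order_hom ai bi r.
Variables (x0 : X) (y0 : Y).

Let x1 := ai x0.
Let y1 := bi y0.

(* [B] and [D] are the bases of the towers, [q] and [t] label the levels of the
   towers of [Y] and [X], and [c] approximates gamma. [sg_sep] keeps [x0] and
   [x1] on different vertical paths, so that the base can be shrunk to [x0] and
   the top to [x1] independently. *)
Record stage (s : stage_data X Y) : Prop := {
  sg_B : lc (sB s);
  sg_By0 : sB s y0;
  sg_kr : KR b (sB s) (sq s);
  sg_homeo : is_homeo (sc s) (sci s);
  sg_n : lc (sn s);
  sg_cn : forall x, sc s x = zpow a ai (sn s x) x;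
  sg_D : lc (sD s);
  sg_t : lc (st s);
  sg_cls : forall l, cls ai r (fun x => st s x == l) (fun y => sq s y == l);
  sg_sync : synced (sc s) (sD s) (st s) b (sB s) (sq s);
  sg_x0 : st s x0 = sq s y0;
  sg_x1 : st s x1 = sq s y1;
  sg_sep : forall j, (forall i, (i < j)%N -> ~~ sD s (iter i.+1 (sc s) x0)) ->
    iter j (sc s) x0 != x1
}.

(** The new labels must decide [g], while [V] and [V'] bound the new base and the new top. The visit
    to [A] in [rf_A] happens before the orbit of [x0] leaves its first new tower; later stages
    change the map only on tops, so the visit persists in the limit. *)
Record refines (s s' : stage_data X Y) (g : Y -> nat) (V V' A : X -> bool) : Prop := {
  rf_g : forall y z, sq s' y = sq s' z -> g y = g z;
  rf_t : forall x y, st s' x = sq s' y -> st s x = sq s y;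
  rf_D : forall x, sD s' x -> sD s x /\ V x;
  rf_T : forall x, sD s' (sc s' x) -> V' x;
  rf_n : forall x, ~~ sD s (sc s x) -> sn s' x = sn s x;
  rf_Dc : forall x, sD s (sc s' x) = sD s (sc s x);
  rf_A : exists p, (forall i, (i < p)%N -> ~~ sD s' (iter i.+1 (sc s') x0)) /\
           A (iter p (sc s') x0)
}.

(** The new base [B'] around [y0] is chosen sparse enough for its relevant translates to fit into
    small targets of X. The labelling of the old base sends them into these targets, is lifted to
    the old towers, and is completed by a rearrangement of the top. *)
Lemma stage_step s (g : Y -> nat) (V V' A : X -> bool) z : stage s -> lc g -> lc V -> V x0 -> lc V' -> V' x1 ->
  lc A -> A z -> exists2 s', stage s' & refines s s' g V V' A.
Proof.
case: s => B q c ci n D t [/= lB By0 kq hc ln cn lD lt clt sy ex0 ex1 sep].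
move=> lg lV Vx0 lV' V'x1 lA Az.
have [cc cci cK ciK] := hc; have [cb cbi bK biK] := hb.
have rB : recurrent b bi B := minimal_recurrent cY hb mb lB By0.
have rD : recurrent c ci D := sync_recurrent cK ciK rB kq sy.
have lq := kr_lc kq.
have Dx0 : D x0 by rewrite (sy_base sy ex0).
set h1 := pos ci D x1; set z1 := base ci D x1; set w1 := base bi B y1.
have [ph1 tz1] : h1 = pos bi B y1 /\ t z1 = q w1 := sync_down cK ciK rB kq sy ex1.
have Dz1 : D z1 := V_base rD x1.
have z1x0 : z1 != x0.
  apply/eqP => e; have := below_base (y := x1) rD; rewrite -/z1 e => /sep.
  by rewrite -e (iter_base rD) eqxx.
have [M hM] := lc_bounded cX (lc_ht hc lD rD).
(* [M] exceeds all heights, so a point off these iterates is on neither the vertical path of [x0]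
   nor that of [x1]. *)
pose avoid v := [seq iter j c v | j <- iota 0 M].
have [z' Az' nz'] := avoid_seq cX (avoid x0 ++ avoid z1) lA Az.
move: nz'; rewrite mem_cat negb_or => /andP[nz0 nz1].
set z2 := base ci D z'; set h2 := pos ci D z'.
have Dz2 : D z2 := V_base rD z'.
have avoidP v : z' \notin avoid v -> z2 != v.
  move=> h; apply/eqP => e; move: h; rewrite -(iter_base rD z') -/z2 e.
  move=> /mapP; apply; exists h2 => //; rewrite mem_iota add0n /=.
  exact: ltn_trans (pos_lt_ht rD z') (hM z').
have z2x0 := avoidP _ nz0; have z2z1 := avoidP _ nz1.
have [k [[k1 k2] k3]] := filter_ex (filterI (filterI (cyl_sep cX z1x0)
   (cyl_sep cX z2x0)) (cyl_sep cX z2z1)).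
have lcyl v : lc (cyl phi v k) := lc_cyl cX v k.
(* Base points in [V] near [x0]; base points near [z1] that are in [V'] at the height of [x1]; base
   points near [z2] that are in [A] at the height of [z']. *)
pose G (i : nat) x := D x && match i with
  | 0 => [&& t x == q y0, cyl phi x0 k x & V x]
  | 1 => [&& t x == q w1, cyl phi z1 k x & V' (iter h1 c x)]
  | _ => [&& t x == t z2, cyl phi z2 k x & A (iter h2 c x)]
  end.
pose pp (i : nat) := match i with 0 => x0 | 1 => z1 | _ => z2 end.
pose ll (i : nat) := match i with 0 => q y0 | 1 => q w1 | _ => t z2 end.
have lG i : lc (G i).
  apply: (lc_comp2 andb) => //.
  have l3 (m : nat) v (W : X -> bool) : lc W -> lc (fun x => [&& t x == m, cyl phi v k x & W x]).
    move=> lW; apply: (lc_comp2 andb); first exact: lc_eq.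
    exact: (lc_comp2 andb).
  by case: i => [|[|i]]; apply: l3 => //; exact: lc_iter.
have Gp i : G i (pp i).
  case: i => [|[|i]]; rewrite /G /=.
  - by rewrite Dx0 ex0 eqxx cyl_refl.
  - by rewrite Dz1 tz1 eqxx cyl_refl (iter_base rD).
  - by rewrite Dz2 eqxx cyl_refl (iter_base rD).
have Gl i x : G i x -> t x = ll i.
  by case: i => [|[|i]] /andP[_ /and3P[/eqP]].
have GD i x : G i x -> D x by move=> /andP[].
have Gcyl i x : G i x -> cyl phi (pp i) k x.
  by case: i => [|[|i]] /andP[_ /and3P[]].
have Gdisj i j : (i < j < 3)%N -> forall x, ~~ (G i x && G j x).
  move=> ij x; apply/negP => /andP[/Gcyl + /Gcyl].
  case: (ltn3_pairs ij) => -[-> ->] /=.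
  - by move=> /(cyl_separated k1) /negbTE ->.
  - by move=> /(cyl_separated k2) /negbTE ->.
  - by move=> /(cyl_separated k3) /negbTE ->.
have /choice [N hN] := fun i => clopen_dominates cX ha ma (lG i) (Gp i).
(* [y0] reaches the label of [z2] at a positive time [p]. The orbit of [x0] will follow it, arrive
   in the third target at time [p], and climb from there to [A]. *)
have [u0 qu0] := (sy_range sy).1 z2.
have qu0' : q u0 == t z2 by apply/eqP.
have [N' hN'] := rec_fwd cY hb mb (lc_eq (t z2) lq) qu0'.
have [p' _ /eqP qp] := hN' y0; set p := p'.+1 in qp.
have Bp : B (iter p b y0) by rewrite -(sy_base sy (esym qp)).
(* The bounds [N i] tell how sparse a set must be to fit into [G i]. The bound [h1 + p] excludes a
   return to [B'] during the first [p] steps of [y0] and the next [h1.+1]. *)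
have [L [L0 L1 L2 L3]] := ltn_bound4 (N 0%N) (N 1%N) (N 2%N) (h1 + p)%N.
have lqbi : lc (fun y => q (bi y)) by exact: lc_cont.
have [K [[K1 K2] K3]] := filter_ex (filterI (filterI (cyl_disjoint cY hb mb y0 L)
   (cyl_lc cY y0 lq)) (cyl_lc cY y0 lqbi)).
pose B' y := B y && cyl psi y0 K y.
have lB' : lc B' by apply: (lc_comp2 andb) => //; exact: lc_cyl.
have B'y0 : B' y0 by rewrite /B' By0 cyl_refl.
have BB' y : B' y -> B y by move=> /andP[].
have B'q y : B' y -> q y = q y0 by move=> /andP[_ /K2].
have B'qi y : B' y -> q (bi y) = q y1 by move=> /andP[_ /K3].
have sparse y j : (j < L)%N -> B' y -> ~~ B' (iter j.+1 b y).
  by move=> jL /andP[_ /K1 h]; apply/negP => /andP[_]; apply/negP/h.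
have sparse2 y i j : (i < j)%N -> (j < i + L.+1)%N -> B' (iter i b y) -> ~~ B' (iter j b y).
  move=> ij jL h; have -> : j = ((j - i.+1).+1 + i)%N by clear -ij; lia.
  by rewrite iterD; apply: sparse => //; clear -ij jL; lia.
have sparse0 j : (0 < j)%N -> (j <= L)%N -> ~~ B' (iter j b y0).
  by move=> j0 jL; apply: (sparse2 y0 0%N).
have h1p : (h1.+1 + p <= L)%N by rewrite addSn.
have h1L : (h1 < L)%N by apply: leq_ltn_trans L3; exact: leq_addr.
have pL : (p <= L)%N by apply: leq_trans h1p; exact: leq_addl.
have rB' : recurrent b bi B' := minimal_recurrent cY hb mb lB' B'y0.
(* Putting a cylinder that separates [w1'] from [y0] into the labels keeps [x0] and [x1] on
   different vertical paths at the new stage. *)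
set w1' := base bi B' y1.
have w1'y0 : w1' != y0.
  apply/eqP => e; have := aperiodic cY hb mb (pos bi B' y1) y0.
  by rewrite -{1}e /= (iter_base rB') biK eqxx.
have [K' hK'] := filter_ex (cyl_sep cY w1'y0).
pose g' y := pickle (q y, g y, cyl psi y0 K' y).
have lg' : lc g'.
  apply: (lc_comp2 (fun u v => pickle (u, v)) (f := fun y => (q y, g y))); last exact: lc_cyl.
  exact: (lc_comp2 pair).
have [q' kq' q'g'] := KR_exists hb lB' rB' lg'.
have q'P y u : q' y = q' u -> [/\ q y = q u, g y = g u & cyl psi y0 K' y = cyl psi y0 K' u].
  by move=> /q'g' /(pcan_inj pickleK) [].
have qq' y u : q' y = q' u -> q y = q u by move=> /q'P [].
have lq' := kr_lc kq'.
have sepq : q' y0 <> q' w1'.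
  by move=> /q'P [_ _]; rewrite cyl_refl (negbTE hK').
have y1w1 : iter h1 b w1 = y1 by rewrite ph1 (iter_base rB).
have below_w1 i : (i < h1)%N -> ~~ B (iter i.+1 b w1).
  by rewrite ph1; exact: below_base.
(* The new base; the old base points whose path ends just before [B'], that is, below the new top;
   the new atom of [iter p b y0]. *)
pose C (i : nat) y := match i with
  | 0 => B' y
  | 1 => (q y == q w1) && B' (iter h1.+1 b y)
  | _ => q' y == q' (iter p b y0)
  end.
pose yy (i : nat) := match i with 0 => y0 | 1 => w1 | _ => iter p b y0 end.
have lC i : lc (C i).
  case: i => [|[|i]] //=; last exact: lc_eq.
  apply: (lc_comp2 andb); first exact: lc_eq.
  exact: (lc_iter h1.+1 cb lB').
have Cy i : C i (yy i).
  by case: i => [|[|i]] //=; rewrite eqxx // y1w1 biK.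
have Cl i y : C i y -> q y = ll i.
  case: i => [|[|i]] /=; first exact: B'q.
    by move=> /andP[/eqP].
  by move=> /eqP /qq' ->.
have CB i y : C i y -> B y.
  move=> /[dup] /Cl h; case: i h => [|[|i]] h; first exact: BB'.
    by move=> _; rewrite (kr_base kq h) (V_base rB).
  by move=> _; rewrite -(sy_base sy (esym h)).
have Csat i y u : q' y = q' u -> C i y -> C i u.
  move=> e; case: i => [|[|i]] /=; rewrite -?e //; first by rewrite (kr_base kq' e).
  rewrite -(qq' _ _ e) => /andP[/eqP qy hB]; rewrite qy eqxx /=.
  have [_ hy] := KR_up kq qy below_w1.
  have eu := KR_refine_up kq' BB' (esym e) hy.
  by rewrite (kr_top kq' eu).
(* A common point would let [y0] return to [B'] at time [h1.+1 + p], which is at most [L]. *)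
have C1C2 y : C 1 y -> ~~ C 2 y.
  move=> h; apply/negP => /eqP e; have := Csat 1%N _ _ e h.
  case/andP => _; rewrite -iterD; apply/negP.
  exact: sparse0.
have Cdisj i j : (i < j < 3)%N -> forall y, ~~ (C i y && C j y).
  move=> /ltn3_pairs ij y; case: ij => -[-> ->] /=; apply/negP => /andP[h h'].
  - by case/andP: h' => _; apply/negP; exact: (sparse y).
  - have := Csat 0%N _ _ (eqP h') h; apply/negP.
    exact: (sparse0 p).
  - by have := C1C2 y h; rewrite /= h'.
(* The third set is carried into [B'] by [p] backward steps, so it is as sparse as [B']. *)
have C2p y : C 2 y -> B' (iter p bi y).
  move=> /eqP e; have [py _] := KR_down rB' kq' e.
  have [||pp0 _] := @pos_iter _ _ _ _ rB' y0 p.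
  - exact: B'y0.
  - by move=> i ip; apply: sparse0 => //; exact: leq_trans ip pL.
  have := V_base rB' y; rewrite /base py pp0.
  by [].
have GC i : K0pos ai (fun x => ind (G i) x - r (ind (C i)) x).
  have hC j m : (m < 3)%N -> K0pos ai (fun x => 1 - (N m)%:R * r (ind (C j)) x) ->
      K0pos ai (fun x => ind (G m) x - r (ind (C j)) x).
    by move=> m3 h; apply: hN => //; case: hr => h' _ _ _ _; apply: h'; exact: lc_ind.
  have sp j m : (m < 3)%N -> (forall y i0 j0, (i0 < j0 < N m)%N -> C j (iter i0 b y) ->
      ~~ C j (iter j0 b y)) -> K0pos ai (fun x => ind (G m) x - r (ind (C j)) x).
    by move=> m3 h; apply: hC => //; exact: (hom_sparse hb hr).
  case: i => [|[|i]].
  - apply: sp => // y i j /andP[ij jN]; apply: sparse2 => //; exact: ltn_window jN L0.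
  - apply: sp => // y i j /andP[ij jN] /andP[_]; rewrite -iterD => h.
    apply/negP => /andP[_]; rewrite -iterD; apply/negP; apply: sparse2 h.
      by rewrite ltn_add2l.
    by rewrite -addnA ltn_add2l; exact: ltn_window jN L1.
  - apply: (sp 2%N 2%N) => // y i0 j /andP[ij jN] /C2p h; apply/negP => /C2p; apply/negP.
    have e m : iter p bi (iter m b y) = iter m b (iter p bi y).
      by rewrite -{1}(iterK p biK y) -iterD addnC iterD iterK.
    by move: h; rewrite !e; apply: sparse2 => //; exact: ltn_window jN L2.
have clDB m : cls ai r (fun x => D x && (t x == m)) (fun y => B y && (q y == m)).
  apply: (cls_saturated cX cY hr lt lq _ clt (sy_range sy)) => [|x y e].
    exact: lc_sub.
  by rewrite (sy_base sy e) e.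
have [|i j ij|tD [sDB hDB] ctl] :=
  controlled_split cX ha ma cY hb mb hr x0 lt lq lq' lG lC Gp Cy Gl Cl GC Csat lD lB (n := 3) clDB.
- by move=> i _; split=> w; [exact: GD|exact: CB].
- by split; [exact: Gdisj|exact: Cdisj].
have [t' [lt' clt' t'D t'C t'succ]] :=
  propagate cX ha hb hr hc ln cn lD lB rB kq kq' BB' qq' sy x0 sDB hDB.
have t't x y : t' x = q' y -> t x = q y by move=> /t'C [].
have sr' := cls_same_range cX ha ma cY hb mb hr x0 lt' lq' clt'.
have [c' [ci' [n' [D' [[hc' ln' cn' lD'] sy' D'D n'n Dc']]]]] :=
  rearrange cX ha ma cY hb hr hc ln cn lD lB lB' kq' BB' sy lt' sr' clt' t't t'succ x0.
have c'c x : ~~ D (c x) -> c' x = c x by move=> h; rewrite cn' n'n // cn.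
have D'C0 x : D' x -> V x.
  move=> D'x; have [u qu] := sr'.1 x; have Dx := D'D x D'x.
  have B'u : B' u by rewrite -(sy_base sy' (esym qu)).
  have [_ /(_ x u Dx)] := ctl 0%N isT; rewrite -(t'D _ Dx) -qu => /(_ erefl B'u).
  by case/andP => _ /and3P[].
have ex0' : t' x0 = q' y0 by rewrite t'D //; have [] := ctl 0%N isT.
have ex1' : t' x1 = q' y1.
  have [u qu] := sr'.1 x1; have [txu tbu] := t'C _ _ (esym qu).
  have [pu _] := sync_down cK ciK rB kq sy txu.
  have [tz1' _] := ctl 1%N isT.
  have e : q' (base bi B u) = q' w1 by rewrite -tbu -/z1 tz1'.
  have := KR_refine_up kq' BB' e below_w1; rewrite y1w1 => <-.
  by rewrite /h1 pu (iter_base rB).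
exists (StageData B' q' c' ci' n' D' t').
  split=> //= j hj; apply/eqP => e.
  have [e1 hB] := sync_up_rev sy' ex0' hj.
  have [_ bj] := pos_iter rB' B'y0 hB.
  move: e1; rewrite e ex1' => /(KR_down rB' kq') [_]; rewrite bj => h.
  exact: sepq.
split=> //=.
- by move=> y u /q'P [].
- by move=> x hx; split; [exact: D'D|exact: D'C0].
(* A point of the new top has a partner that [b] sends into [B'], hence with the old label of [y1].
   The base point below it is labelled in [C 1], so it lies in [G 1], which places [x] in [V']. *)
- move=> x hx; have [y qy] := sr'.1 x; have e := esym qy.
  have B'y : B' (b y) by rewrite -(sy_top sy' e).
  have [txy tby] := t'C _ _ e.
  have qy1 : q y = q y1 by rewrite -(B'qi _ B'y) bK.
  have [py qb] := KR_down rB kq qy1.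
  have [px _] := sync_down cK ciK rB kq sy txy.
  have Cb : C 1 (base bi B y).
    by rewrite /C qb eqxx /= ph1 -py (iter_base rB).
  have [_ /(_ _ _ (V_base rD x) tby Cb)] := ctl 1%N isT.
  by case/andP => _ /and3P[_ _]; rewrite /= ph1 -py -px (iter_base rD).
- have nB i : (i < p)%N -> ~~ B' (iter i.+1 b y0).
    by move=> ip; apply: sparse0 => //; exact: leq_trans ip pL.
  have [ep nDp] := sync_up sy' ex0' nB.
  set v := iter p c' x0 in ep.
  have Dv : D v by rewrite (sy_base sy (t't _ _ ep)).
  have Gv : G 2 v.
    have [_] := ctl 2%N isT; apply; first exact: Dv.
      by rewrite -t'D //; exact: ep.
    by rewrite /= eqxx.
  have tv : t v = t z2 := Gl _ _ Gv.
  have nDv i : (i < h2)%N -> ~~ D (iter i.+1 c v).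
    have [y qy] := (sy_range sy).1 z2.
    have [_ hy] := sync_up_rev sy (esym qy) (below_base (y := z') rD).
    have e : t v = q y by rewrite tv.
    by have [_] := sync_up sy e hy; apply.
  (* Between [v] and height [h2] the path stays off the old top, where the old and new maps
     coincide. *)
  have cv i : (i <= h2)%N -> iter i c' v = iter i c v.
    by elim: i => //= i IH ih; rewrite IH ?(ltnW ih) // c'c // nDv.
  exists (h2 + p)%N; split=> [i ih|].
    have [ip|ip] := ltnP i p; first exact: nDp.
    rewrite -[c' _]/(iter i.+1 c' x0) -(subnK (leqW ip : (p <= i.+1)%N)) subSn // iterD -/v.
    have ih2 : (i - p < h2)%N by rewrite ltn_subLR // addnC.
    by rewrite cv //; apply: contra (nDv _ ih2); exact: D'D.
  by rewrite iterD -/v cv //; case/andP: Gv => _ /and3P[].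
Qed.

End Stages.

Lemma clopen_basis (X : topologicalType) (phi : X -> nat -> bool) (x0 : X) :
  coord_space phi -> exists A : nat -> X -> bool,
  [/\ forall k, lc (A k), forall k, exists x, A k x &
      forall (x : X) (U : set X), nbhs x U -> exists k, forall y, A k y -> U y].
Proof.
move=> cX.
pose P (s : seq bool) x := all (fun i => phi x i == nth false s i) (iota 0 (size s)).
have lP s : lc (P s).
  apply: (@lc_all _ _ (fun i x => phi x i == nth false s i)) => i.
  by apply: (lc_comp1 (fun u => u == nth false s i)); exact: coord_lc.
(* Empty cylinders and invalid codes are replaced by the whole space, so every member of the
   sequence is nonempty. *)
pose A k x := if unpickle k is Some s then `[< exists y, P s y >] ==> P s x else true.
exists A; split.
- move=> k; rewrite /A; case: (unpickle k) => [s|]; last exact: lc_cst.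
  exact: (lc_comp1 (fun u => _ ==> u)).
- move=> k; rewrite /A; case: (unpickle k) => [s|]; last by exists x0.
  have [[y Py]|h] := pselect (exists y, P s y); first by exists y; rewrite Py implybT.
  by exists x0; rewrite asboolF.
- move=> x U nU; have [m hm] := filter_ex (cyl_near cX nU).
  pose s := [seq phi x i | i <- iota 0 m].
  have Ps y : P s y = cyl phi x m y.
    rewrite /P size_map size_iota; apply: eq_in_all => i.
    by rewrite mem_iota add0n /= => im; rewrite (nth_map 0%N) ?size_iota // nth_iota.
  exists (pickle s) => y; rewrite /A pickleK asboolT /=; last first.
    by exists x; rewrite Ps; exact: cyl_refl.
  by rewrite Ps; exact: hm.
Qed.

(** * The limit homeomorphism and the factor map *)

Section FactorMap.
Context {X Y : topologicalType}.
Variables (phi : X -> nat -> bool) (psi : Y -> nat -> bool).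
Variables (a ai : X -> X) (b bi : Y -> Y) (r : (Y -> int) -> (X -> int)).
Hypotheses (cX : coord_space phi) (ha : is_homeo a ai) (ma : minimal_map a).
Hypotheses (cY : coord_space psi) (hb : is_homeo b bi) (mb : minimal_map b).
Hypothesis hr : unital_order_hom ai bi r.
Variables (x0 : X) (y0 : Y).

Let x1 := ai x0.
Let y1 := bi y0.

(** A single tower of height one with [c = a]. Only [j = 0] is constrained by [sg_sep], and [x0]
    differs from [x1] by aperiodicity. *)
Lemma initial_stage : stage a ai b bi r x0 y0
  (StageData xpredT (fun _ => 0%N) a ai (fun _ => 1) xpredT (fun _ => 0%N)).
Proof.
have [ca cai aK aiK] := ha.
split=> //=; try exact: lc_cst.
- by split=> //; exact: lc_cst.
- move=> l; have [_|_] := eqVneq 0%N l; first by apply: K0_sym; exact: (hom1 hr).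
  exact: (cls_empty hr).
- case=> [|j] hj; last by have := hj 0%N isT.
  by have := aperiodic cX ha ma 0 x1; rewrite /= aiK.
Qed.

Lemma stage_sequence (A : nat -> X -> bool) :
  (forall k, lc (A k)) -> (forall k, exists x, A k x) ->
  exists s : nat -> stage_data X Y, (forall k, stage a ai b bi r x0 y0 (s k)) /\
    forall k, refines x0 (s k) (s k.+1) (fun y => psi y k : nat)
                (cyl phi x0 k) (cyl phi x1 k) (A k).
Proof.
move=> lA eA.
pose S := {s : stage_data X Y | stage a ai b bi r x0 y0 s}.
have step (k : nat) (s : S) : {s' : S | refines x0 (sval s) (sval s')
    (fun y => psi y k : nat) (cyl phi x0 k) (cyl phi x1 k) (A k)}.
  apply: cid; case: s => s hs /=; have [z Az] := eA k.
  have lg : lc (fun y => psi y k : nat) by apply: (lc_comp1 nat_of_bool); exact: coord_lc.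
  have [s' hs' rs'] := stage_step cX ha ma cY hb mb hr hs lg
    (lc_cyl cX x0 k) (cyl_refl phi x0 k) (lc_cyl cX x1 k) (cyl_refl phi x1 k) (lA k) Az.
  by exists (exist _ s' hs').
pose fix sq_ (k : nat) : S :=
  if k is k'.+1 then sval (step k' (sq_ k')) else exist _ _ initial_stage.
exists (fun k => sval (sq_ k)); split=> k; first exact: svalP.
exact: (svalP (step k (sq_ k))).
Qed.

Section LimitSystem.
Variables (A : nat -> X -> bool) (s : nat -> stage_data X Y).
Hypothesis Abasis : forall (x : X) (U : set X), nbhs x U -> exists k, forall y, A k y -> U y.
Hypothesis hs : forall k, stage a ai b bi r x0 y0 (s k).
Hypothesis rs : forall k, refines x0 (s k) (s k.+1) (fun y => psi y k : nat)
                  (cyl phi x0 k) (cyl phi x1 k) (A k).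

Let c k := sc (s k).
Let ci k := sci (s k).
Let D k := sD (s k).
Let T k x := D k (c k x).

Let aK : cancel a ai. Proof. by case: ha. Qed.
Let aiK : cancel ai a. Proof. by case: ha. Qed.
Let bK : cancel b bi. Proof. by case: hb. Qed.
Let biK : cancel bi b. Proof. by case: hb. Qed.
Let cK k : cancel (c k) (ci k). Proof. by case: (sg_homeo (hs k)). Qed.
Let ciK k : cancel (ci k) (c k). Proof. by case: (sg_homeo (hs k)). Qed.
Let cc k : continuous (c k). Proof. by case: (sg_homeo (hs k)). Qed.
Let cci k : continuous (ci k). Proof. by case: (sg_homeo (hs k)). Qed.
Let lD k : lc (D k). Proof. exact: sg_D. Qed.
Let lT k : lc (T k). Proof. exact: (lc_cont (@cc k) (lD k)). Qed.

Let c_step k x : ~~ T k x -> c k.+1 x = c k x.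
Proof. by move=> h; rewrite /c !(sg_cn (hs _)) (rf_n (rs k)). Qed.

Let D_step k x : D k.+1 x -> D k x.
Proof. by move=> /(rf_D (rs k)) []. Qed.

Let T_step k x : T k.+1 x -> T k x.
Proof. by move=> /D_step; rewrite /T /D /c (rf_Dc (rs k)). Qed.

Let D_le j k x : (j <= k)%N -> D k x -> D j x.
Proof.
move=> jk; elim: k jk => [|k IH]; first by rewrite leqn0 => /eqP ->.
by rewrite leq_eqVlt => /orP[/eqP -> //|jk /D_step /IH]; apply.
Qed.

Let T_le j k x : (j <= k)%N -> T k x -> T j x.
Proof.
move=> jk; elim: k jk => [|k IH]; first by rewrite leqn0 => /eqP ->.
by rewrite leq_eqVlt => /orP[/eqP -> //|jk /T_step /IH]; apply.
Qed.

Let n_le j k x : (j <= k)%N -> ~~ T j x -> sn (s k) x = sn (s j) x.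
Proof.
move=> jk nT; elim: k jk => [|k IH]; first by rewrite leqn0 => /eqP ->.
rewrite leq_eqVlt => /orP[/eqP -> //|jk].
by rewrite (rf_n (rs k)) ?IH //; apply: contra nT; exact: T_le.
Qed.

Let Dc_le j k x : (j <= k)%N -> D j (c k x) = T j x.
Proof.
move=> jk; elim: k jk => [|k IH]; first by rewrite leqn0 => /eqP ->.
rewrite leq_eqVlt => /orP[/eqP -> //|jk]; rewrite -IH //.
have [Tk|nTk] := boolP (T k x); last by rewrite c_step.
rewrite (@D_le j k _ jk Tk); apply: (@D_le j k _ jk).
by rewrite /D /c (rf_Dc (rs k)).
Qed.

Let T_x1 k : T k x1.
Proof.
by rewrite /T /D /c (sy_top (sg_sync (hs k)) (sg_x1 (hs k))) biK (sg_By0 (hs k)).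
Qed.

Let D_x0 k : D k x0.
Proof. by rewrite /D (sy_base (sg_sync (hs k)) (sg_x0 (hs k))) (sg_By0 (hs k)). Qed.

Let T_ex x : x != x1 -> exists k, ~~ T k x.
Proof.
move=> /(cyl_sep cX) /(@filter_ex _ _ _) [k hk]; exists k.+1.
by apply: contra hk => /(rf_T (rs k)).
Qed.

Let D_ex x : x != x0 -> exists k, ~~ D k x.
Proof.
move=> /(cyl_sep cX) /(@filter_ex _ _ _) [k hk]; exists k.+1.
by apply: contra hk => /(rf_D (rs k)) [].
Qed.

(** Off [x1] the exponents stabilize once the point leaves the tops. The point [x1] stays in every
    top, and the value 1 there gives [a x1 = x0]. *)
Let n_ex : exists n : X -> int, n x1 = 1 /\ forall x k, ~~ T k x -> n x = sn (s k) x.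
Proof.
have /choice [n hn] : forall x, exists m : int, (x = x1 -> m = 1) /\
    forall k, ~~ T k x -> m = sn (s k) x.
  move=> x; have [->|xx1] := eqVneq x x1.
    by exists 1; split=> // k; rewrite T_x1.
  have [k hk] := T_ex xx1; exists (sn (s k) x); split; first by move/eqP: xx1.
  move=> j hj; have [jk|kj] := leqP j k; first exact: n_le.
  by apply/esym; apply: n_le => //; exact: ltnW.
by exists n; split=> [|x k]; [exact: (hn x1).1|exact: (hn x).2].
Qed.

(** The inverse is built in the same way on the complements of the bases, with [x0] as the
    exceptional point. *)
Let inv_ex : exists d : X -> X, d x0 = x1 /\ forall x k, ~~ D k x -> d x = ci k x.
Proof.
have agree j k x : (j <= k)%N -> ~~ D j x -> ci k x = ci j x.
  move=> jk nD; have nT : ~~ T j (ci j x) by rewrite /T ciK.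
  have e : c k (ci j x) = x.
    by rewrite /c (sg_cn (hs _)) (n_le jk) // -(sg_cn (hs _)) -/(c j) ciK.
  by rewrite -{1}e cK.
have /choice [d hd] : forall x, exists y : X, (x = x0 -> y = x1) /\
    forall k, ~~ D k x -> y = ci k x.
  move=> x; have [->|xx0] := eqVneq x x0.
    by exists x1; split=> // k; rewrite D_x0.
  have [k hk] := D_ex xx0; exists (ci k x); split; first by move/eqP: xx0.
  move=> j hj; have [jk|kj] := leqP j k; first exact: agree.
  by apply/esym; apply: agree => //; exact: ltnW.
by exists d; split=> [|x k]; [exact: (hd x0).1|exact: (hd x).2].
Qed.

Lemma limit_system : exists (F : X -> Y) (g gi : X -> X) (n : X -> int),
  [/\ continuous F, is_homeo g gi /\ minimal_map g,
      (forall x, g x = zpow a ai (n x) x),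
      (exists p : X, forall x, x <> p -> zcont_at n x) &
      (forall x, b (F x) = F (g x))].
Proof.
have [n [n1 hn]] := n_ex; have [gi [gi0 hgi]] := inv_ex.
pose g x := zpow a ai (n x) x.
have g1 : g x1 = x0 by rewrite /g n1 /= aiK.
have hg x k : ~~ T k x -> g x = c k x.
  by move=> h; rewrite /g (hn x k h) /c (sg_cn (hs k)).
have gK : cancel g gi.
  move=> x; have [->|xx1] := eqVneq x x1; first by rewrite g1.
  have [k hk] := T_ex xx1; rewrite (hg _ _ hk) (hgi _ k) ?cK //.
have giK : cancel gi g.
  move=> x; have [->|xx0] := eqVneq x x0; first by rewrite gi0.
  have [k hk] := D_ex xx0; rewrite (hgi _ _ hk) (hg _ k) ?ciK //.
  by rewrite /T ciK.
(* Evaluate at a stage beyond [k] whose top no longer contains [x]: there [g] agrees with the stage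
   map, and later maps send the old top into the old base. *)
have Dg k x : D k (g x) = T k x.
  have [->|xx1] := eqVneq x x1; first by rewrite g1 D_x0 T_x1.
  have [j hj] := T_ex xx1.
  have nTj : ~~ T (maxn j k) x by apply: contra hj; apply: T_le; exact: leq_maxl.
  by rewrite (hg _ _ nTj) Dc_le // leq_maxr.
have cg : continuous g.
  move=> x; have [->|xx1] := eqVneq x x1.
    move=> U; rewrite g1 => nU; have [m hm] := filter_ex (cyl_near cX nU).
    (* The top [T m.+1] is a neighbourhood of [x1] that [g] maps into [D m.+1], hence into the
       [m]-th cylinder of [x0]. *)
    apply: filterS (lT m.+1 x1) => y; rewrite T_x1 -Dg => Dy.
    by apply: hm; have [] := rf_D (rs m) Dy.
  have [k hk] := T_ex xx1; move=> U; rewrite (hg _ _ hk) => nU.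
  apply: filterS (filterI (lT k x) (@cc k x U nU)) => y [e Uy].
  by rewrite /= (hg _ k) // e.
have cgi : continuous gi.
  move=> x; have [->|xx0] := eqVneq x x0.
    move=> U; rewrite gi0 => nU; have [m hm] := filter_ex (cyl_near cX nU).
    apply: filterS (lD m.+1 x0) => y; rewrite D_x0 => Dy.
    by apply: hm; apply: (rf_T (rs m)); have := Dg m.+1 (gi y); rewrite giK Dy => /esym.
  have [k hk] := D_ex xx0; move=> U; rewrite (hgi _ _ hk) => nU.
  apply: filterS (filterI (lD k x) (@cci k x U nU)) => y [e Uy].
  by rewrite /= (hgi _ k) // e.
pose t k := st (s k); pose q k := sq (s k).
have lt k : lc (t k) := sg_t (hs k).
have lq k : lc (q k) := kr_lc (sg_kr (hs k)).
have tq k x : exists y, q k y = t k x := (sy_range (sg_sync (hs k))).1 x.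
have coh k x y : t k.+1 x = q k.+1 y -> t k x = q k y by move=> /(rf_t (rs k)).
have sepq y z : (forall k, q k y = q k z) -> y = z.
  move=> h; apply: (coord_inj cY); apply/funext => k.
  by have := rf_g (rs k) (h k.+1); case: (psi y k); case: (psi z k).
have [F cF hF] := limit_map cY lt lq tq coh sepq.
have F1 : F x1 = y1 by apply: sepq => k; rewrite hF; exact: sg_x1.
have F0 : F x0 = y0 by apply: sepq => k; rewrite hF; exact: sg_x0.
have bF x : b (F x) = F (g x).
  have [->|xx1] := eqVneq x x1; first by rewrite F1 g1 F0 biK.
  (* Labels are compared at a stage beyond [k] where [x] is off the top; coherence brings the
     equality down to [k]. *)
  apply: sepq => k; have [j hj] := T_ex xx1.
  have nT : ~~ T (maxn j k) x by apply: contra hj; apply: T_le; exact: leq_maxl.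
  rewrite hF; apply/esym; apply: (labels_coherent coh (leq_maxr j k)).
  rewrite (hg _ _ nT); apply: (sy_succ (sg_sync (hs _))) => //.
  by apply/esym; exact: hF.
have bFi j x : F (iter j g x) = iter j b (F x).
  by elim: j => //= j IH; rewrite -bF IH.
exists F, g, gi, n; split=> //; last first.
  exists x1 => x /eqP xx1; have [k hk] := T_ex xx1.
  apply: filterS (filterI (lT k x) (sg_n (hs k) x)) => y [e e'].
  by rewrite (hn y k) ?e // (hn x k).
split=> // Z cZ gZ.
have [[z Zz]|nZ] := pselect (exists z, Z z); last first.
  by left; apply/seteqP; split=> // z Zz; apply: nZ; exists z.
have Zg j x : Z x -> Z (iter j g x).
  move=> Zx; elim: j => //= j IH; rewrite -gZ; exact: (ex_intro2 _ _ _ IH erefl).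
right; apply/seteqP; split=> // x _.
have Zx0 : Z x0.
  apply: cZ => U nU; have [m hm] := filter_ex (cyl_near cX nU).
  (* The orbit of [z] enters each base because its image under [F] is a [b]-orbit, which is
     recurrent, and [F] preserves labels. *)
  have rB := minimal_recurrent cY hb mb (sg_B (hs m.+1)) (sg_By0 (hs m.+1)).
  have [j hj] := rec_future rB (F z).
  exists (iter j.+1 g z); split; first exact: Zg.
  apply: hm.
  have e : st (s m.+1) (iter j.+1 g z) = sq (s m.+1) (iter j.+1 b (F z)).
    by rewrite -bFi; apply/esym; exact: hF.
  have Dj : sD (s m.+1) (iter j.+1 g z) by rewrite (sy_base (sg_sync (hs m.+1)) e).
  by have [] := rf_D (rs m) Dj.
apply: cZ => U nU; have [k hk] := Abasis nU.
have [p [np Ap]] := rf_A (rs k).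
exists (iter p g x0); split; first exact: Zg.
(* Up to time [p] the orbit of [x0] avoids the top of stage [k.+1], so [g] and the map of that stage
   have the same iterates there. *)
apply: hk; suff -> : iter p g x0 = iter p (sc (s k.+1)) x0 by [].
elim: p np {Ap} => //= p IH np.
rewrite IH; last by move=> i ip; apply: np; exact: ltnW.
by rewrite (hg _ k.+1) //; exact: (np p (ltnSn p)).
Qed.

End LimitSystem.

Lemma hom_factor : exists (F : X -> Y) (g gi : X -> X) (n : X -> int),
  [/\ continuous F, is_homeo g gi /\ minimal_map g,
      (forall x, g x = zpow a ai (n x) x),
      (exists p : X, forall x, x <> p -> zcont_at n x) &
      (forall x, b (F x) = F (g x))].
Proof.
have [A [lA eA bA]] := clopen_basis x0 cX.
have [s [hs rs]] := stage_sequence lA eA.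
exact: (limit_system bA hs rs).
Qed.

End FactorMap.

Theorem theorem3p5 (R : realType) (X Y : pseudoPMetricType R)
  (a ai : X -> X) (b bi : Y -> Y) :
  cantor_minimal a ai -> cantor_minimal b bi ->
  [<->
    (* (1) *)
    (exists r : (Y -> int) -> (X -> int), unital_order_hom ai bi r);
    (* (2) *)
    (exists (F : X -> Y) (c ci : X -> X) (n : X -> int),
       [/\ continuous F, is_homeo c ci /\ minimal_map c,
           (forall x, c x = zpow a ai (n x) x),
           (exists x0 : X, forall x, x <> x0 -> zcont_at n x) &
           (forall x, b (F x) = F (c x))]);
    (* (3) *)
    (exists F : X -> Y, continuous F /\
       (forall g : Y -> int, Bset bi g -> Bset ai (g \o F)));
    (* (4) *)
    (exists (s : nat -> X -> Y) (si : nat -> Y -> X),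
       [/\ (forall k, is_homeo (s k) (si k)),
           (forall e : R, 0 < e ->
              \forall k \near \oo, forall y : Y, ball (b y) e (s k (a (si k y)))) &
           (forall f : Y -> int, CZ f ->
              exists N : nat, forall k, (N <= k)%N ->
                K0eq ai (f \o s k) (f \o s N))])].
Proof.
move=> [cantX ha ma] [cantY hb mb].
have [phi cX] := cantor_coord cantX; have [psi cY] := cantor_coord cantY.
tfae.
- by move=> [r hr]; exact: (hom_factor cX ha ma cY hb mb hr point point).
- move=> [F [c [ci [n [cF [hc _] cn [x0 nc] bF]]]]]; exists F; split=> //.
  exact: (factor_preserves_cobound cX ha hb cF hc cn nc bF).
- move=> [F [cF hF]].
  exact: (hom_approx_conj cX ha ma cY hb mb (factor_hom cF hF)).
- by move=> [s [si [hs conv cls]]]; exact: (approx_conj_hom ha cY hb hs conv cls).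
Qed.
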